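(* Let $\Gamma$ be a Fuchsian group and $t_0\in\mathbb T$ with $\sum_{\gamma\in\Gamma}|\gamma'(t_0)|<\infty$ and $m'_{t_0}$ of bounded characteristic. Assume that the nontangential limits $\Delta_{t_0}(t_0)$, with $|\Delta_{t_0}(t_0)|=1$, and $\Delta'_{t_0}(t_0)$, finite, exist, that is, $$ \Delta_{t_0}(\zeta)=\Delta_{t_0}(t_0)+\Delta'_{t_0}(t_0)(\zeta-t_0)+o(\zeta-t_0),\qquad |\Delta_{t_0}(t_0)|=1, $$ as $\zeta\to t_0$ nontangentially. Assume also that $$ |t_0-\zeta|\sum_{\gamma\in\Gamma,\ \gamma\ne e}\frac{|\gamma'(t_0)|}{|\gamma(t_0)-\zeta|^2}=o(1) $$ as $\zeta\to t_0$ nontangentially. Then for every unitary character $\alpha$ of $\Gamma$: (i) $\mathcal P^\alpha\Delta_{t_0}\in H^\infty$ and $\|\mathcal P^\alpha\Delta_{t_0}\|_{H^\infty}\le 1$; (ii) $(\mathcal P^\alpha\Delta_{t_0})(\zeta)=\Delta_{t_0}(t_0)+\Delta'_{t_0}(t_0)(\zeta-t_0)+o(\zeta-t_0)$ as $\zeta\to t_0$ nontangentially; (iii) $$ \int_{\mathbb T}\frac{|(\mathcal P^\alpha\Delta_{t_0})(t)-\Delta_{t_0}(t_0)|^2}{|t-t_0|^2}\mu(dt)+\int_{\mathbb T}\frac{1-|(\mathcal P^\alpha\Delta_{t_0})(t)|^2}{|t-t_0|^2}\mu(dt)=t_0\frac{\Delta'_{t_0}(t_0)}{\Delta_{t_0}(t_0)}.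 $$
   Context: $\mathbb D$ is the open unit disk, $\mathbb T$ the unit circle, $\mu$ the normalized Lebesgue measure on $\mathbb T$. A Fuchsian group $\Gamma$ is a discrete subgroup of the group of conformal automorphisms $\zeta\mapsto\frac{a\zeta+b}{\overline b\zeta+\overline a}$, $|a|^2-|b|^2=1$, of $\mathbb D$; $e$ is its identity. A unitary character of $\Gamma$ is a homomorphism $\alpha:\Gamma\to\mathbb T$. When $\sum_{\gamma\in\Gamma}|\gamma'(t_0)|<\infty$, the Martin function is $m_{t_0}(\zeta)=\frac i2\sum_{\gamma\in\Gamma}\frac{\gamma(t_0)+\zeta}{\gamma(t_0)-\zeta}|\gamma'(t_0)|$, so $m'_{t_0}(\zeta)=i t_0\sum_{\gamma\in\Gamma}\frac{\gamma'(t_0)}{(\gamma(t_0)-\zeta)^2}$, $\zeta\in\mathbb D$. A function is of bounded characteristic if it is a quotient of two bounded analytic functions on $\mathbb D$. When $m'_{t_0}$ is of bounded characteristic it factors as $m'_{t_0}=\Delta_{t_0}/\varphi$ with $\Delta_{t_0}$ inner and $\varphi$ outer, $|\varphi|\le4$; $\Delta_{t_0}$ is determined up to a unimodular constant and is fixed. The Poincaré theta series associated with $m_{t_0}$ and a unitary character $\alpha$ is $$ (\mathcal P^\alpha f)(\zeta)=\frac{\sum_{\gamma\in\Gamma}\overline{\alpha(\gamma)}f(\gamma(\zeta))\frac{\gamma'(\zeta)}{(\gamma(\zeta)-t_0)^2}}{\sum_{\gamma\in\Gamma}\frac{\gamma'(\zeta)}{(\gamma(\zeta)-t_0)^2}}=\frac{\sum_{\gamma\in\Gamma}\alpha(\gamma)f(\gamma^{-1}(\zeta))\frac{\gamma'(t_0)}{(\gamma(t_0)-\zeta)^2}}{\sum_{\gamma\in\Gamma}\frac{\gamma'(t_0)}{(\gamma(t_0)-\zeta)^2}},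 $$ for bounded analytic $f$ on $\mathbb D$ (a priori a meromorphic function of $\zeta\in\mathbb D$; removable singularities are removed). *)

(* Defs.v *)
From HB Require Import structures.
From mathcomp Require Import all_boot all_order all_algebra.
From mathcomp Require Import all_classical all_reals all_analysis.
From mathcomp Require Import complex.
From mathcomp.analysis.showcase Require summability.

Set Implicit Arguments.
Unset Strict Implicit.
Unset Printing Implicit Defensive.

Import Order.TTheory GRing.Theory Num.Theory.
Import numFieldNormedType.Exports.

Local Open Scope classical_set_scope.
Local Open Scope ring_scope.
Local Open Scope complex_scope.

(* The topology of R[i] is the one given by its modulus. *)
HB.instance Definition _ (R : rcfType) := NormedModule.copy R[i] (R[i]^o).

Section Defs.
Variable R : realType.
Local Notation C := R[i].
Implicit Types (z t : C) (f g F : C -> C).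

Definition disk : set C := [set z | `|z| < 1].

Definition cabs z : R := complex.Re `|z|.

Definition cis (x : R) : C := cos x +i* sin x.

Definition cexp z : C := (expR (complex.Re z))%:C * cis (complex.Im z).

Definition analytic F := forall z, disk z -> derivable F z 1.

Definition Hinfty F :=
  analytic F /\ exists M : R, forall z, disk z -> cabs (F z) <= M.

Definition Hinfty_norm F : R := sup [set cabs (F z) | z in disk].

Definition bounded_characteristic F :=
  exists g h : C -> C, [/\ Hinfty g, Hinfty h,
    exists2 z, disk z & h z != 0 &
    forall z, disk z -> h z != 0 -> F z = g z / h z].

Definition stolz t (M : R) : set C :=
  [set z | disk z /\ cabs (z - t) <= M * (1 - cabs z)].

(* A property holds along this filter when, for every aperture M, it holds on
   the part of the Stolz region [stolz t M] that is close to t. *)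
Definition nontangential t : set_system C :=
  [set A | forall M : R, within (stolz t M) (nbhs t) A].

Definition boundary_value F t : C := lim (F @ nontangential t).

(* F(z) = a + b (z - t) + o(z - t) as z -> t nontangentially *)
Definition nt_expansion F t (a b : C) :=
  (F z - a - b * (z - t)) / (z - t) @[z --> nontangential t] --> (0 : C).

(* Integration against the normalized Lebesgue measure of the unit circle,
   parametrized by t = cis x with 0 <= x <= 2 pi. *)
Definition circle_integral (F : C -> \bar R) : \bar R :=
  (((2 * pi)^-1)%R%:E *
   \int[lebesgue_measure]_(x in `[0%R, (2 * pi)%R]) F (cis x))%E.

Definition circle_Cintegral F : C :=
  fine (circle_integral (fun t => (complex.Re (F t))%:E)) +i*
  fine (circle_integral (fun t => (complex.Im (F t))%:E)).

Definition inner F :=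
  [/\ analytic F,
      forall z, disk z -> cabs (F z) <= 1 &
      {ae lebesgue_measure, forall x : R,
        exists2 l : C, cabs l = 1 & F @ nontangential (cis x) --> l}].

Definition outer F :=
  exists (c : C) (k : C -> R), [/\ cabs c = 1,
    forall t, cabs t = 1 -> 0 < k t,
    lebesgue_measure.-integrable `[0, 2 * pi]
      (fun x : R => (ln (k (cis x)))%:E) &
    forall z, disk z ->
      F z = c * cexp (circle_Cintegral
                        (fun t => (t + z) / (t - z) * (ln (k t))%:C))].

(* On SU(1,1) this is the total function given by the formula; its pole, if
   any, lies outside the closed disk. Hence [mobius a b] is determined by its
   values on the disk, two pairs in SU(1,1) give the same function exactly when
   they are opposite, and [derive1 (mobius a b)] is the derivative at every point
   of the closed disk. Only composition has to be taken on the disk. *)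
Definition mobius (a b : C) : C -> C :=
  fun z => (a * z + b) / (b^* * z + a^*).

Definition SU11 : set (C * C) := [set p | `|p.1| ^+ 2 - `|p.2| ^+ 2 = 1].

Definition is_comp f g h := forall z, disk z -> h z = f (g z).

Definition SU11_preimage (Gamma : set (C -> C)) : set (C * C) :=
  [set p | SU11 p /\ Gamma (mobius p.1 p.2)].

(* Discreteness is that of the preimage of Gamma in SU(1,1), a two-fold cover
   of the automorphism group of the disk. *)
Record fuchsian (Gamma : set (C -> C)) : Prop := Fuchsian {
  fuchsian_mobius : forall g, Gamma g ->
    exists2 p, SU11 p & g = mobius p.1 p.2;
  fuchsian_id : Gamma idfun;
  fuchsian_comp : forall f g, Gamma f -> Gamma g ->
    exists2 h, Gamma h & is_comp f g h;
  fuchsian_inv : forall g, Gamma g ->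
    exists2 h, Gamma h & is_comp h g idfun;
  fuchsian_discrete : SU11_preimage Gamma `<=` isolated (SU11_preimage Gamma)
}.

Record unitary_character (Gamma : set (C -> C)) (alpha : (C -> C) -> C) : Prop
    := UnitaryCharacter {
  character_unit : forall g, Gamma g -> `|alpha g| = 1;
  character_comp : forall f g h, Gamma f -> Gamma g -> Gamma h ->
    is_comp f g h -> alpha h = alpha f * alpha g
}.

(* Limit of the finite subsums; u \_ Gamma is zero outside Gamma. *)
Definition gsum (Gamma : set (C -> C)) (u : (C -> C) -> C) : C :=
  summability.sum (u \_ Gamma).

Definition martin Gamma t0 z : C :=
  'i / 2 * gsum Gamma (fun g => (g t0 + z) / (g t0 - z) * `|derive1 g t0|).

Definition theta_num Gamma t0 (alpha : (C -> C) -> C) f z : C :=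
  gsum Gamma (fun g => (alpha g)^* * f (g z) * (derive1 g z / (g z - t0) ^+ 2)).

Definition theta_den Gamma t0 z : C :=
  gsum Gamma (fun g => derive1 g z / (g z - t0) ^+ 2).

(* The limit over the punctured neighbourhoods fills in the removable
   singularities of the quotient and is its value where the denominator does
   not vanish; at a pole it is arbitrary, and [theta] is not analytic there. *)
Definition theta Gamma t0 alpha f z : C :=
  lim (theta_num Gamma t0 alpha f w / theta_den Gamma t0 w @[w --> z^']).

End Defs.

(* Main.v *)
(* Write D for the denominator of the theta series, so m' = i t0 D. Since D (g z)
   g'(z) = D z and phi m' = Delta, each term of the numerator is a multiple of D:
   it is D times i t0 c_g h_g with h_g(z) = phi(g^-1 z) / (g^-1 z - t0)^2 and
   |c_g| = 1. Hence P = i t0 sum_g c_g h_g away from the zeros of D, and it is enough to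
   bound sum_g |h_g| by 1. For a finite set of g, |h_g D| <= |g'(t0)| / |g t0 - z|^2
   because |Delta| <= 1, while on almost every radius |D| comes arbitrarily close
   to, or above, the sum of these quantities: Im m vanishes radially almost
   everywhere but grows at least like the corresponding finite sum. The maximum
   principle for bounded functions, proved through Poisson integrals and Fatou's
   theorem, gives the bound after pushing the pole of h_g off the disk.

   Near t0 the terms of index e dominate numerator and denominator, which gives
   P - Delta = o(z - t0). The integral identity is Poisson's formula for
   Re (1 - P conj Delta(t0)) along the radius to t0, combined with
   |u - a|^2 + 1 - |u|^2 = 2 Re (1 - u conj a) for |a| = 1. *)
Require Import Defs.
From HB Require Import structures.
From mathcomp Require Import all_boot all_order all_algebra.
From mathcomp Require Import finmap.
From mathcomp Require Import all_classical all_reals all_analysis.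
From mathcomp Require Import complex measurable_realfun.
From mathcomp Require Import ring lra.
From mathcomp.analysis.showcase Require summability.
Import Order.TTheory GRing.Theory Num.Theory.
Import numFieldNormedType.Exports.
Local Open Scope classical_set_scope.
Local Open Scope ring_scope.
Local Open Scope complex_scope.
Set Implicit Arguments. Unset Strict Implicit. Unset Printing Implicit Defensive.

(** * Complex modulus *)

(** Inside the disk |D| may be far smaller than the sum of the |g'(t0)| / |g t0 - z|^2, because the
    terms of D carry phases. The comparison survives only at the boundary, and there only along
    radii that depend on the boundary point. This is enough for a bounded analytic function: it has
    radial limits almost everywhere, and their size can be read off any sequence of radii tending to
    1. Boundedness must be known beforehand, however, and |phi| <= 4 does not bound h_g, whose
    denominator vanishes at the boundary point g t0: hence the passage through s t0 with s > 1. The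
    maximum principle concerns analytic functions, not the sum of the |h_g|; at a fixed point that
    sum is the value of a finite combination with coefficients of modulus at most 1, chosen for this
    point. The character is absorbed in the same way and enters through |c_g| <= 1 and c_e = 1. The
    function theory rests on quadratic remainders: an integral over a circle is moved by a real
    parameter, and its derivative in the parameter is the mean of an angular derivative, hence
    zero. *)

Section ComplexModulus.
Variable R : realType.
Local Notation C := R[i].
Implicit Types (x y z w : C) (r : R).

Lemma cabsE z : (cabs z)%:C = `|z|.
Proof. by rewrite /cabs normc_def. Qed.

Lemma cabs_ge0 z : 0 <= cabs z.
Proof. by rewrite -lecR cabsE normr_ge0. Qed.

Lemma cabs0 : cabs (0 : C) = 0.
Proof. by apply/(@complexI R); rewrite cabsE normr0. Qed.

Lemma cabs1 : cabs (1 : C) = 1.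
Proof. by apply/(@complexI R); rewrite cabsE normr1. Qed.

Lemma cabsN z : cabs (- z) = cabs z.
Proof. by apply/(@complexI R); rewrite !cabsE normrN. Qed.

Lemma cabsM z w : cabs (z * w) = cabs z * cabs w.
Proof. by apply/(@complexI R); rewrite rmorphM /= !cabsE normrM. Qed.

Lemma cabsV z : cabs z^-1 = (cabs z)^-1.
Proof. by apply/(@complexI R); rewrite fmorphV /= !cabsE normfV. Qed.

Lemma cabsX z n : cabs (z ^+ n) = cabs z ^+ n.
Proof. by apply/(@complexI R); rewrite rmorphXn /= !cabsE normrX. Qed.

Lemma cabsBC z w : cabs (z - w) = cabs (w - z).
Proof. by rewrite -cabsN opprB. Qed.

Lemma ler_cabsD z w : cabs (z + w) <= cabs z + cabs w.
Proof. by rewrite -lecR rmorphD /= !cabsE ler_normD. Qed.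

Lemma ler_cabsB z w : cabs (z - w) <= cabs z + cabs w.
Proof. by rewrite -(cabsN w) ler_cabsD. Qed.

Lemma ler_dist_cabs z w : cabs z - cabs w <= cabs (z - w).
Proof. by rewrite lerBlDr -{1}(subrK w z) ler_cabsD. Qed.

Lemma cabs_dist_triangle y z w : cabs (z - w) <= cabs (z - y) + cabs (y - w).
Proof. by rewrite -[z - w](subrKA y) ler_cabsD. Qed.

Lemma cabs_eq0 z : (cabs z == 0) = (z == 0).
Proof. by rewrite -(inj_eq (@complexI R)) cabsE normr_eq0. Qed.

Lemma cabs_gt0 z : (0 < cabs z) = (z != 0).
Proof. by rewrite lt_def cabs_ge0 andbT cabs_eq0. Qed.

Lemma cabs_real r : cabs r%:C = `|r|.
Proof.
by apply/(@complexI R); rewrite cabsE normc_def /= expr0n addr0 sqrtr_sqr.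
Qed.

Lemma cabs_conj z : cabs z^*%C = cabs z.
Proof. by apply/(@complexI R); rewrite !cabsE normcJ. Qed.

Lemma cabs_i : cabs ('i%C : C) = 1.
Proof. by apply/(@complexI R); rewrite cabsE normc_def /= expr0n expr1n add0r sqrtr1. Qed.

Lemma cabs2 z : cabs z ^+ 2 = complex.Re z ^+ 2 + complex.Im z ^+ 2.
Proof. by apply/(@complexI R); rewrite rmorphXn /= cabsE add_Re2_Im2. Qed.

Lemma conjcD z w : (z + w)^*%C = z^*%C + w^*%C.
Proof. exact: (rmorphD (@conjc R)). Qed.

Lemma conjcB z w : (z - w)^*%C = z^*%C - w^*%C.
Proof. exact: (rmorphB (@conjc R)). Qed.

Lemma conjcM z w : (z * w)^*%C = z^*%C * w^*%C.
Proof. exact: (rmorphM (@conjc R)). Qed.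

Lemma mul_conj z : z * z^*%C = (cabs z ^+ 2)%:C.
Proof. by rewrite rmorphXn /= cabsE sqr_normc. Qed.

Lemma ReM z w : complex.Re (z * w) =
  complex.Re z * complex.Re w - complex.Im z * complex.Im w.
Proof. by case: z w => [a b] [c d]. Qed.

Lemma ImM z w : complex.Im (z * w) =
  complex.Re z * complex.Im w + complex.Im z * complex.Re w.
Proof. by case: z w => [a b] [c d]; rewrite /= addrC (mulrC b). Qed.

Lemma ReD z w : complex.Re (z + w) = complex.Re z + complex.Re w.
Proof. by case: z w => [a b] [c d]. Qed.

Lemma ImD z w : complex.Im (z + w) = complex.Im z + complex.Im w.
Proof. by case: z w => [a b] [c d]. Qed.

Lemma ReN z : complex.Re (- z) = - complex.Re z.
Proof. by case: z. Qed.

Lemma ImN z : complex.Im (- z) = - complex.Im z.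
Proof. by case: z. Qed.

Lemma ReB z w : complex.Re (z - w) = complex.Re z - complex.Re w.
Proof. by rewrite ReD ReN. Qed.

Lemma ImB z w : complex.Im (z - w) = complex.Im z - complex.Im w.
Proof. by rewrite ImD ImN. Qed.

Lemma ReZ r z : complex.Re (r%:C * z) = r * complex.Re z.
Proof. by rewrite ReM /= mul0r subr0. Qed.

Lemma ImZ r z : complex.Im (r%:C * z) = r * complex.Im z.
Proof. by rewrite ImM /= mul0r addr0. Qed.

Lemma ler_Re_cabs z : `|complex.Re z| <= cabs z.
Proof. by rewrite -lecR cabsE normc_ge_Re. Qed.

Lemma ler_Im_cabs z : `|complex.Im z| <= cabs z.
Proof.
by rewrite -(ler_pXn2r (n := 2)) ?nnegrE ?normr_ge0 ?cabs_ge0// cabs2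
  real_normK ?num_real// lerDr sqr_ge0.
Qed.

Lemma ler_cabs_ReIm z : cabs z <= `|complex.Re z| + `|complex.Im z|.
Proof.
rewrite -(ler_pXn2r (n := 2)) ?nnegrE ?addr_ge0 ?normr_ge0 ?cabs_ge0// cabs2.
rewrite sqrrD !real_normK ?num_real// lerD2r lerDl.
by rewrite mulrn_wge0// mulr_ge0.
Qed.

Lemma diskE z : disk z <-> cabs z < 1.
Proof. by rewrite /disk /= -cabsE -(ltcR (cabs z) 1). Qed.

(** The norm of [C] is [C]-valued, so radii of balls are positive elements of [C]. Such elements
    have zero imaginary part, which allows real epsilons from here on. *)
Lemma nbhsC z (A : set C) : nbhs z A <->
  exists2 e : R, 0 < e & forall w, cabs (w - z) < e -> A w.
Proof.
split=> [/nbhs_ballP[e /= e0 zA]|[e e0 zA]].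
  exists (complex.Re e); first by move: e0; rewrite ltcE => /andP[].
  have eE : e = (complex.Re e)%:C.
    by move: e0; rewrite ltcE; case: (e) => a b /= /andP[/eqP-> _].
  move=> w zw; apply: zA; rewrite -ball_normE /= distrC -cabsE eE.
  by rewrite ltcR.
apply/nbhs_ballP; exists e%:C => /=; first by rewrite ltcR.
move=> w; rewrite -ball_normE /= distrC -cabsE ltcR; exact: zA.
Qed.

Lemma cvgC (T : Type) (F : set_system T) {FF : Filter F} (f : T -> C) (l : C) :
  (f @ F --> l) <-> forall e : R, 0 < e -> \forall t \near F, cabs (f t - l) < e.
Proof.
split=> [fl e e0|fl A /nbhsC[e e0 lA]].
  by apply: (fl [set w | cabs (w - l) < e]); apply/nbhsC; exists e.
by apply: filterS (fl _ e0) => t; exact: lA.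
Qed.

Lemma pdnbhsC z (A : set C) : z^' A <->
  exists2 e : R, 0 < e & forall w, w != z -> cabs (w - z) < e -> A w.
Proof.
split=> [/nbhsC[e e0 zA]|[e e0 zA]].
  by exists e => // w wz we; exact: zA.
by apply/nbhsC; exists e => // w we wz; exact: zA.
Qed.

Lemma pdnbhsC_proper z : ProperFilter z^'.
Proof.
apply: Build_ProperFilter_ex => A /pdnbhsC[e e0 zA].
exists (z + (e / 2)%:C); apply: zA.
  by rewrite -subr_eq0 addrC addKr -cabs_eq0 cabs_real normr_eq0 gt_eqF// divr_gt0.
by rewrite addrC addKr cabs_real gtr0_norm ?divr_gt0// ltr_pdivrMr// mulr2n mulrDr mulr1 ltrDl.
Qed.

End ComplexModulus.

(** * Analytic functions with a second-order remainder *)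

Section Exponentials.
Variable R : realType.
Local Notation C := R[i].
Implicit Types (z w : C) (x y h : R).

(** Locating [c] by its distance to [x] lets one statement serve both orders of the end points. *)
Lemma mean_value (f df : R -> R) x y : (forall t : R, is_derive t 1 f (df t)) ->
  exists2 c, `|c - x| <= `|y - x| & f y - f x = df c * (y - x).
Proof.
move=> fdf; have fc (a b : R) : {within `[a, b], continuous f}.
  apply: continuous_subspaceT => t.
  by apply: differentiable_continuous; apply/derivable1_diffP; case: (fdf t).
have [xy|/ltW yx] := lerP x y.
  have [c] := MVT_segment xy (fun t _ => fdf t) (fc _ _).
  rewrite in_itv /= => /andP[xc cy] e; exists c => //.
  by rewrite !ger0_norm ?subr_ge0// lerD2r.
have [c] := MVT_segment yx (fun t _ => fdf t) (fc _ _).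
rewrite in_itv /= => /andP[yc cx] e; exists c.
  by rewrite distrC ger0_norm ?subr_ge0// lerD2l lerN2.
by rewrite -opprB e -mulrN opprB.
Qed.

Lemma ler_sin h : `|sin h| <= `|h|.
Proof.
have [c _] := @mean_value sin cos 0 h (fun t => is_derive_sin t).
rewrite sin0 !subr0 => ->; rewrite normrM ler_piMl//.
by rewrite ler_norml cos_geN1 cos_le1.
Qed.

Lemma ler_cosB1 h : `|cos h - 1| <= h ^+ 2.
Proof.
have [c] := @mean_value cos (fun t => - sin t) 0 h (fun t => is_derive_cos t).
rewrite cos0 !subr0 => ch ->; rewrite normrM normrN -[h ^+ 2]real_normK ?num_real//.
by rewrite expr2 ler_wpM2r// (le_trans (ler_sin c)).
Qed.

Lemma ler_sinB h : `|sin h - h| <= h ^+ 2.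
Proof.
have [c] := @mean_value (fun t => sin t - t) (fun t => cos t - 1) 0 h
  (fun t => is_deriveB _ _).
rewrite sin0 !subr0 => ch ->; rewrite normrM -[h ^+ 2]real_normK ?num_real//.
rewrite expr2 ler_wpM2r// (le_trans _ ch)//.
have [d _] := @mean_value cos (fun t => - sin t) 0 c (fun t => is_derive_cos t).
rewrite cos0 !subr0 => ->; rewrite normrM normrN ler_piMl//.
by rewrite ler_norml sin_geN1 sin_le1.
Qed.

Lemma ler_expRB1 (B h : R) : `|h| <= B -> `|expR h - 1| <= expR B * `|h|.
Proof.
move=> hB; have [c] := @mean_value expR expR 0 h (fun t => is_derive_expR t).
rewrite expR0 !subr0 => ch ->; rewrite normrM ler_wpM2r//.
by rewrite (ger0_norm (expR_ge0 _)) ler_expR (le_trans (ler_norm _))// (le_trans ch).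
Qed.

Lemma ler_expRB1B (B h : R) : `|h| <= B -> `|expR h - 1 - h| <= expR B * h ^+ 2.
Proof.
move=> hB; have [c] := @mean_value (fun t => expR t - t) (fun t => expR t - 1) 0 h
  (fun t => is_deriveB _ _).
rewrite expR0 !subr0 addrAC => ch ->; rewrite normrM -[h ^+ 2]real_normK ?num_real//.
rewrite expr2 mulrA ler_wpM2r// (le_trans (ler_expRB1 (le_trans ch hB)))//.
by rewrite ler_wpM2l ?expR_ge0.
Qed.

Lemma cisD x y : cis (x + y) = cis x * cis y.
Proof. by rewrite /cis cosD sinD; apply/eqP; rewrite eq_complex /= eqxx [sin x * cos y]mulrC [cos y * _]mulrC addrC mulrC eqxx. Qed.

Lemma cabs_cis x : cabs (cis x) = 1.
Proof.
apply/eqP; rewrite -(eqrXn2 (n := 2)) ?cabs_ge0// cabs2 /=.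
by rewrite cos2Dsin2 expr1n.
Qed.

Lemma cis_neq0 x : cis x != 0.
Proof. by rewrite -cabs_gt0 cabs_cis. Qed.

Lemma cis0 : cis 0 = 1 :> C.
Proof. by rewrite /cis cos0 sin0. Qed.

Lemma cis2pi : cis (2 * pi) = 1 :> C.
Proof. by rewrite /cis mulr_natl cos2pi sin2pi. Qed.

(** Rotating by [cis x] reduces to the Taylor remainders of cosine and sine at 0, one for each
    coordinate; hence the factor 2. *)
Lemma cis_quad x y :
  cabs (cis y - cis x - 'i%C * cis x * (y - x)%:C) <= 2 * (y - x) ^+ 2.
Proof.
have -> : cis y - cis x - 'i%C * cis x * (y - x)%:C =
    cis x * (cis (y - x) - 1 - 'i%C * (y - x)%:C).
  by rewrite -{1}(subrKC x y) (cisD x (y - x)); ring.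
rewrite cabsM cabs_cis mul1r.
have -> : cis (y - x) - 1 - 'i%C * (y - x)%:C =
    (cos (y - x) - 1) +i* (sin (y - x) - (y - x)) :> C.
  apply/eqP; rewrite eq_complex !ReB !ImB ReM ImM /= !mul0r !mul1r.
  by rewrite !subr0 add0r !eqxx.
apply: le_trans (ler_cabs_ReIm _) _ => /=.
by rewrite mulr2n mulrDl mul1r lerD ?ler_cosB1 ?ler_sinB.
Qed.

Lemma cis_lip x y : cabs (cis y - cis x) <= 2 * `|y - x|.
Proof.
have -> : cis y - cis x = cis x * (cis (y - x) - 1).
  by rewrite -{1}(subrKC x y) (cisD x (y - x)); ring.
rewrite cabsM cabs_cis mul1r (le_trans (ler_cabs_ReIm _))//= subr0.
rewrite mulr2n mulrDl mul1r lerD ?ler_sin//.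
have [c _] := @mean_value cos (fun t => - sin t) 0 (y - x) (fun t => is_derive_cos t).
rewrite cos0 !subr0 => ->; rewrite normrM normrN ler_piMl//.
by rewrite ler_norml sin_geN1 sin_le1.
Qed.

Lemma cexpD z w : cexp (z + w) = cexp z * cexp w.
Proof. by rewrite /cexp ReD ImD expRD cisD rmorphM /=; ring. Qed.

Lemma cabs_cexp z : cabs (cexp z) = expR (complex.Re z).
Proof. by rewrite /cexp cabsM cabs_cis mulr1 cabs_real ger0_norm ?expR_ge0. Qed.

Lemma cexp_neq0 z : cexp z != 0.
Proof. by rewrite -cabs_gt0 cabs_cexp expR_gt0. Qed.

(** The real and the imaginary part each split into two pieces made of one-variable remainders, and
    each of the four pieces is at most [expR B * cabs z ^+ 2]. *)
Lemma cexp_quad0 (B : R) z : cabs z <= B ->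
  cabs (cexp z - 1 - z) <= 4 * expR B * cabs z ^+ 2.
Proof.
move=> zB; set K := expR B.
have K0 : 0 <= K := expR_ge0 _.
set a := complex.Re z; set b := complex.Im z; set m := cabs z.
have m0 : 0 <= m := cabs_ge0 _.
have am : `|a| <= m := ler_Re_cabs z.
have bm : `|b| <= m := ler_Im_cabs z.
have eaK : expR a <= K by rewrite ler_expR (le_trans (ler_norm _))// (le_trans am).
have sq (r : R) : `|r| <= m -> r ^+ 2 <= m ^+ 2.
  by move=> rm; rewrite -[r ^+ 2]real_normK ?num_real// ler_pXn2r ?nnegrE.
rewrite (le_trans (ler_cabs_ReIm _))//.
have -> : complex.Re (cexp z - 1 - z) = expR a * (cos b - 1) + (expR a - 1 - a).
  by rewrite !ReB /cexp ReZ /= -/a -/b; ring.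
have -> : complex.Im (cexp z - 1 - z) = expR a * (sin b - b) + (expR a - 1) * b.
  by rewrite !ImB /cexp ImZ /= -/a -/b; ring.
have -> : 4 * K * m ^+ 2 = (K * m ^+ 2 + K * m ^+ 2) + (K * m ^+ 2 + K * m ^+ 2).
  by ring.
have ea0 := expR_ge0 a.
apply: lerD; apply: le_trans (ler_normD _ _) _; apply: lerD.
- by rewrite normrM ger0_norm// ler_pM// (le_trans (ler_cosB1 _))// sq.
- by rewrite (le_trans (ler_expRB1B (le_trans am zB)))// ler_wpM2l// sq.
- by rewrite normrM ger0_norm// ler_pM// (le_trans (ler_sinB _))// sq.
- rewrite normrM expr2 mulrA ler_pM//.
  by rewrite (le_trans (ler_expRB1 (le_trans am zB)))// ler_wpM2l.
Qed.

End Exponentials.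

(** * Calculus of quadratic remainders *)

Section HoloOn.
Variable R : realType.
Local Notation C := R[i].
Implicit Types (z w : C) (r : R) (F G : C -> C).

(* Analyticity with a locally uniform second-order remainder: it makes the
   derivative locally Lipschitz, which spares Goursat's theorem. *)
Definition holo_on r F F' := exists2 K : R, 0 <= K &
  forall z w, cabs z <= r -> cabs w <= r ->
    cabs (F w - F z - F' z * (w - z)) <= K * cabs (w - z) ^+ 2.

Definition holo F F' := forall r, 0 <= r -> r < 1 -> holo_on r F F'.

Lemma holo_onS r s F F' : r <= s -> holo_on s F F' -> holo_on r F F'.
Proof.
by move=> rs [K K0 FK]; exists K => // z w zr wr; apply: FK; apply: le_trans rs.
Qed.

Lemma eq_holo_on r F F' G G' : (forall z, cabs z <= r -> F z = G z) ->
  (forall z, cabs z <= r -> F' z = G' z) -> holo_on r F F' -> holo_on r G G'.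
Proof.
move=> FG FG' [K K0 FK]; exists K => // z w zr wr.
by rewrite -!FG// -FG'// FK.
Qed.

(** Adding the remainder estimates from z to w and from w to z cancels the values of F; what is left
    is the increment of F' times [w - z]. *)
Lemma holo_on_derivB r F F' : holo_on r F F' ->
  exists2 K, 0 <= K & forall z w, cabs z <= r -> cabs w <= r ->
    cabs (F' w - F' z) <= K * cabs (w - z).
Proof.
move=> [K K0 FK]; exists (K *+ 2); first exact: mulrn_wge0.
move=> z w zr wr; have [->|wz] := eqVneq w z.
  by rewrite !subrr cabs0 mulr0.
have d0 : 0 < cabs (w - z) by rewrite cabs_gt0 subr_eq0.
rewrite -(ler_pM2r d0) -cabsM.
have -> : (F' w - F' z) * (w - z) =
    (F z - F w - F' w * (z - w)) + (F w - F z - F' z * (w - z)) by ring.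
rewrite (le_trans (ler_cabsD _ _))// -mulrA -expr2 mulrnAl mulr2n.
by rewrite lerD ?FK// (le_trans (FK _ _ _ _))// cabsBC.
Qed.

Lemma holo_on_deriv_bound r F F' : 0 <= r -> holo_on r F F' ->
  exists2 B, 0 <= B & forall z, cabs z <= r -> cabs (F' z) <= B.
Proof.
move=> r0 /holo_on_derivB[K K0 FK]; exists (cabs (F' 0) + K * r).
  by rewrite addr_ge0 ?cabs_ge0 ?mulr_ge0.
move=> z zr; rewrite -{1}(subrK (F' 0) (F' z)) addrC.
rewrite (le_trans (ler_cabsD _ _))// lerD2l (le_trans (FK _ _ _ _)) ?cabs0//.
by rewrite subr0 ler_wpM2l.
Qed.

Lemma holo_on_lip r F F' : 0 <= r -> holo_on r F F' ->
  exists2 L, 0 <= L & forall z w, cabs z <= r -> cabs w <= r ->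
    cabs (F w - F z) <= L * cabs (w - z).
Proof.
move=> r0 FF'; have [B B0 FB] := holo_on_deriv_bound r0 FF'.
case: FF' => K K0 FK; exists (K * (r + r) + B).
  by rewrite addr_ge0 ?mulr_ge0 ?addr_ge0.
move=> z w zr wr; rewrite -{1}(subrK (F' z * (w - z)) (F w - F z)).
rewrite (le_trans (ler_cabsD _ _))// mulrDl lerD//.
  rewrite (le_trans (FK _ _ _ _))// expr2 mulrA ler_wpM2r ?cabs_ge0//.
  by rewrite ler_wpM2l// (le_trans (ler_cabsB _ _))// lerD.
by rewrite cabsM ler_wpM2r ?cabs_ge0// FB.
Qed.

Lemma holo_on_bound r F F' : 0 <= r -> holo_on r F F' ->
  exists2 B, 0 <= B & forall z, cabs z <= r -> cabs (F z) <= B.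
Proof.
move=> r0 /(holo_on_lip r0)[K K0 FK]; exists (cabs (F 0) + K * r).
  by rewrite addr_ge0 ?cabs_ge0 ?mulr_ge0.
move=> z zr; rewrite -{1}(subrK (F 0) (F z)) addrC.
rewrite (le_trans (ler_cabsD _ _))// lerD2l (le_trans (FK _ _ _ _)) ?cabs0//.
by rewrite subr0 ler_wpM2l.
Qed.

Lemma holo_on_cst r (c : C) : holo_on r (fun=> c) (fun=> 0).
Proof. by exists 0 => // z w _ _; rewrite subrr mul0r subrr cabs0 mul0r. Qed.

Lemma holo_on_id r : holo_on r id (fun=> 1).
Proof. by exists 0 => // z w _ _; rewrite mul1r subrr cabs0 mul0r. Qed.

Lemma holo_onD r F F' G G' : holo_on r F F' -> holo_on r G G' ->
  holo_on r (fun z => F z + G z) (fun z => F' z + G' z).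
Proof.
move=> [K K0 FK] [L L0 GL]; exists (K + L); first exact: addr_ge0.
move=> z w zr wr.
have -> : F w + G w - (F z + G z) - (F' z + G' z) * (w - z) =
  (F w - F z - F' z * (w - z)) + (G w - G z - G' z * (w - z)) by ring.
by rewrite mulrDl (le_trans (ler_cabsD _ _))// lerD ?FK ?GL.
Qed.

Lemma holo_onM r F F' G G' : 0 <= r -> holo_on r F F' -> holo_on r G G' ->
  holo_on r (fun z => F z * G z) (fun z => F' z * G z + F z * G' z).
Proof.
move=> r0 FF GG.
have [B B0 FB] := holo_on_bound r0 FF.
have [B' B'0 FB'] := holo_on_deriv_bound r0 FF.
have [D D0 GD] := holo_on_bound r0 GG.
have [M M0 GM] := holo_on_lip r0 GG.
case: FF GG => K K0 FK [L L0 GL].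
exists (K * D + B' * M + B * L).
  by rewrite !addr_ge0// mulr_ge0.
move=> z w zr wr; set h := w - z.
have -> : F w * G w - F z * G z - (F' z * G z + F z * G' z) * h =
  (F w - F z - F' z * h) * G w + F' z * h * (G w - G z)
   + F z * (G w - G z - G' z * h) by ring.
rewrite (le_trans (ler_cabsD _ _))// [leRHS]mulrDl lerD//; last first.
  by rewrite cabsM -mulrA ler_pM ?cabs_ge0 ?FB ?GL.
rewrite (le_trans (ler_cabsD _ _))// [leRHS]mulrDl lerD//.
  by rewrite cabsM mulrAC ler_pM ?cabs_ge0 ?FK ?GD.
have -> : B' * M * cabs h ^+ 2 = B' * cabs h * (M * cabs h) by ring.
by rewrite !cabsM ler_pM ?mulr_ge0 ?cabs_ge0 ?GM// ler_wpM2r ?cabs_ge0 ?FB'.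
Qed.

Lemma holo_onZ r (c : C) F F' : 0 <= r -> holo_on r F F' ->
  holo_on r (fun z => c * F z) (fun z => c * F' z).
Proof.
move=> r0 FF; apply: eq_holo_on (holo_onM r0 (holo_on_cst r c) FF) => // z _.
by rewrite mul0r add0r.
Qed.

Lemma holo_onV r (c : R) F F' : 0 <= r -> 0 < c ->
  (forall z, cabs z <= r -> c <= cabs (F z)) -> holo_on r F F' ->
  holo_on r (fun z => (F z)^-1) (fun z => - F' z / F z ^+ 2).
Proof.
move=> r0 c0 cF FF.
have [B' B'0 FB'] := holo_on_deriv_bound r0 FF.
have [M M0 FM] := holo_on_lip r0 FF.
case: FF => K K0 FK.
exists (K / c ^+ 2 + B' * M / c ^+ 3).
  by rewrite addr_ge0// ?mulr_ge0// ?invr_ge0 exprn_ge0// ltW.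
move=> z w zr wr; set h := w - z.
have Fz0 : F z != 0 by rewrite -cabs_gt0 (lt_le_trans c0)// cF.
have Fw0 : F w != 0 by rewrite -cabs_gt0 (lt_le_trans c0)// cF.
have -> : (F w)^-1 - (F z)^-1 - (- F' z / F z ^+ 2) * h =
  - ((F w - F z - F' z * h) * ((F z)^-1 * (F w)^-1)) +
   F' z * h * (F w - F z) * ((F z)^-1 * (F z)^-1 * (F w)^-1).
  by field; rewrite Fz0 Fw0.
have iv u : cabs u <= r -> (cabs (F u))^-1 <= c^-1.
  by move=> ur; rewrite lef_pV2 ?posrE ?cF// (lt_le_trans c0)// cF.
have ivc u : 0 <= (cabs (F u))^-1 by rewrite invr_ge0 cabs_ge0.
rewrite (le_trans (ler_cabsD _ _))// [leRHS]mulrDl lerD//.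
  rewrite cabsN [cabs _]cabsM cabsM !cabsV.
  have -> : K / c ^+ 2 * cabs h ^+ 2 = K * cabs h ^+ 2 * (c^-1 * c^-1).
    by rewrite -invfM -expr2 mulrAC.
  by rewrite ler_pM ?cabs_ge0 ?mulr_ge0 ?FK// ler_pM ?iv.
have -> : B' * M / c ^+ 3 * cabs h ^+ 2 =
    B' * cabs h * (M * cabs h) * (c^-1 * c^-1 * c^-1).
  by field; rewrite gt_eqF.
rewrite !cabsM !cabsV ler_pM ?mulr_ge0 ?cabs_ge0//.
  by rewrite ler_pM ?mulr_ge0 ?cabs_ge0 ?FM// ler_wpM2r ?cabs_ge0 ?FB'.
by rewrite ler_pM ?mulr_ge0 ?iv// ler_pM ?mulr_ge0 ?iv.
Qed.

Lemma holo_on_comp r s F F' G G' : 0 <= r -> 0 <= s ->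
  (forall z, cabs z <= r -> cabs (G z) <= s) ->
  holo_on s F F' -> holo_on r G G' ->
  holo_on r (fun z => F (G z)) (fun z => F' (G z) * G' z).
Proof.
move=> r0 s0 Gs FF GG.
have [B' B'0 FB'] := holo_on_deriv_bound s0 FF.
have [M M0 GM] := holo_on_lip r0 GG.
case: FF GG => K K0 FK [L L0 GL].
exists (K * M ^+ 2 + B' * L).
  by rewrite !addr_ge0// mulr_ge0// exprn_ge0.
move=> z w zr wr; set h := w - z.
have -> : F (G w) - F (G z) - F' (G z) * G' z * h =
  (F (G w) - F (G z) - F' (G z) * (G w - G z)) +
  F' (G z) * (G w - G z - G' z * h) by ring.
rewrite (le_trans (ler_cabsD _ _))// [leRHS]mulrDl lerD//.
  rewrite (le_trans (FK _ _ _ _)) ?Gs// -mulrA ler_wpM2l// -exprMn.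
  by rewrite ler_pXn2r ?nnegrE ?mulr_ge0 ?cabs_ge0 ?GM.
by rewrite cabsM -mulrA ler_pM ?cabs_ge0 ?GL// FB' ?Gs.
Qed.

Lemma holo_on_cexp r : 0 <= r -> holo_on r (@cexp R) (@cexp R).
Proof.
move=> r0; exists (expR r * (4 * expR (r + r))).
  by rewrite !mulr_ge0 ?expR_ge0.
move=> z w zr wr; have -> : cexp w - cexp z - cexp z * (w - z) =
    cexp z * (cexp (w - z) - 1 - (w - z)).
  by rewrite -{1}(subrKC z w) (cexpD z (w - z)); ring.
rewrite cabsM cabs_cexp -mulrA ler_pM ?expR_ge0 ?cabs_ge0//.
  by rewrite ler_expR (le_trans (ler_norm _))// (le_trans (ler_Re_cabs _)).
by rewrite cexp_quad0// (le_trans (ler_cabsB _ _))// lerD.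
Qed.

Lemma holo_on_cvg r F F' z : holo_on r F F' -> cabs z < r ->
  (h^-1 *: (F (h + z) - F z)) @[h --> (0 : C)^'] --> F' z.
Proof.
move=> [K K0 FK] zr; have PF := pdnbhsC_proper (0 : C).
apply/cvgC => e e0; apply/pdnbhsC.
have K1 : 0 < K + 1 by rewrite ltr_wpDl.
exists (Num.min (e / (K + 1)) (r - cabs z)).
  by rewrite lt_min divr_gt0// subr_gt0.
move=> h h0; rewrite subr0 lt_min => /andP[he hr].
have hz : cabs (h + z) <= r.
  by rewrite (le_trans (ler_cabsD _ _))// -lerBrDr ltW.
have -> : h^-1 *: (F (h + z) - F z) - F' z =
    h^-1 * (F (h + z) - F z - F' z * (h + z - z)).
  by rewrite addrK [RHS]mulrBr [F' z * h]mulrC mulKf.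
have c0 : 0 < cabs h by rewrite cabs_gt0.
rewrite cabsM cabsV ltr_pdivrMl//.
apply: le_lt_trans (FK _ _ (ltW zr) hz) _; rewrite addrK expr2 mulrA mulrC.
rewrite ltr_pM2l//; apply: le_lt_trans (_ : (K + 1) * cabs h < e).
  by rewrite ler_wpM2r ?cabs_ge0// lerDl.
by rewrite mulrC -ltr_pdivlMr.
Qed.

Lemma Chausdorff : hausdorff_space C.
Proof. exact: norm_hausdorff. Qed.

Lemma holo_on_derive1 r F F' z : holo_on r F F' -> cabs z < r ->
  derive1 F z = F' z.
Proof.
move=> FF zr; have PF := pdnbhsC_proper (0 : C).
by rewrite /derive1; apply: cvg_lim; [exact: Chausdorff|exact: holo_on_cvg FF zr].
Qed.

Lemma holo_analytic F F' : holo F F' -> analytic F.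
Proof.
move=> FF z /diskE z1; have r1 : (cabs z + 1) / 2 < 1.
  by rewrite ltr_pdivrMr// mul1r mulr2n ltrD2r.
have zr : cabs z < (cabs z + 1) / 2.
  by rewrite ltr_pdivlMr// mulr2n mulrDr mulr1 ltrD2l.
have r0 : 0 <= (cabs z + 1) / 2 by rewrite divr_ge0// addr_ge0 ?cabs_ge0.
rewrite /derivable; apply/cvg_ex; exists (F' z).
have -> : (fun h : C => h^-1 *: (F (h *: 1 + z) - F z)) =
   (fun h : C => h^-1 *: (F (h + z) - F z)).
  by apply/funext => h; rewrite [h *: 1]mulr1.
exact: holo_on_cvg (FF _ r0 r1) zr.
Qed.

Lemma holo_derive1 F F' z : holo F F' -> cabs z < 1 -> derive1 F z = F' z.
Proof.
move=> FF z1; have r1 : (cabs z + 1) / 2 < 1.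
  by rewrite ltr_pdivrMr// mul1r mulr2n ltrD2r.
have zr : cabs z < (cabs z + 1) / 2.
  by rewrite ltr_pdivlMr// mulr2n mulrDr mulr1 ltrD2l.
have r0 : 0 <= (cabs z + 1) / 2 by rewrite divr_ge0// addr_ge0 ?cabs_ge0.
exact: holo_on_derive1 (FF _ r0 r1) zr.
Qed.

End HoloOn.

(** * Means over the circle *)

Section AlmostEverywhere.
Variable R : realType.
Local Notation mu := (@lebesgue_measure R).

Lemma ae_imp (P Q : R -> Prop) : (forall x, P x -> Q x) ->
  {ae mu, forall x, P x} -> {ae mu, forall x, Q x}.
Proof.
move=> PQ [N [mN N0 PN]]; exists N; split => // x /= nQ; apply: PN => /= Px.
by apply: nQ; exact: PQ.
Qed.

Lemma ae_and (P Q : R -> Prop) : {ae mu, forall x, P x} -> {ae mu, forall x, Q x} ->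
  {ae mu, forall x, P x /\ Q x}.
Proof.
move=> nP nQ; apply: negligibleS (negligibleU nP nQ) => x /= nPQ.
have [Px|nPx] := pselect (P x); last by left.
by right=> /= Qx; apply: nPQ.
Qed.

Lemma ae_finite (s : seq R) : {ae mu, forall x, x \notin s}.
Proof.
elim: s => [|y s IH]; first exact: aeW.
have y1 : {ae mu, forall x, x <> y}.
  exists [set y]; split => //; first exact: lebesgue_measure_set1.
  by move=> x /= /contrapT.
apply: ae_imp (ae_and y1 IH) => x [/eqP xy xs].
by rewrite inE negb_or xy.
Qed.
End AlmostEverywhere.

(** * Normalized means, Lipschitz traces and angular derivatives *)

Section CircleMean.
Variable R : realType.
Local Notation C := R[i].
Local Notation mu := (@lebesgue_measure R).
Local Notation D := (`[0, 2 * pi]%classic : set R).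
Implicit Types (f g : R -> R) (u v : R -> C).

Definition rint f := mu.-integrable D (EFin \o f).
Definition rmean f := (2 * pi)^-1 * \int[mu]_(x in D) f x.
Definition cint u :=
  rint (fun x => complex.Re (u x)) /\ rint (fun x => complex.Im (u x)).
Definition cmean u : C :=
  rmean (fun x => complex.Re (u x)) +i* rmean (fun x => complex.Im (u x)).
Lemma twopi_gt0 : 0 < 2 * pi :> R.
Proof. by rewrite mulr_gt0// pi_gt0. Qed.

Lemma measurable_circle : measurable D.
Proof. exact: measurable_itv. Qed.
Local Notation mD := measurable_circle.

Lemma lebesgue_circle : mu D = (2 * pi)%:E.
Proof. by rewrite lebesgue_measure_itv/= lte_fin twopi_gt0 -EFinD subr0. Qed.

Lemma rint_measurable f : rint f -> measurable_fun D f.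
Proof. by move=> /measurable_int/measurable_EFinP. Qed.

Lemma measurable_EFin (A : set R) f :
  measurable_fun A f -> measurable_fun A (EFin \o f).
Proof. by move=> mf; exact/measurable_EFinP. Qed.

Lemma rint_le f g : measurable_fun D f -> rint g ->
  (forall x, D x -> `|f x| <= g x) -> rint f.
Proof.
move=> mf ig fg; apply: (@le_integrable _ _ R mu D mD _ _ _ _ ig).
  exact/measurable_EFinP.
by move=> x Dx /=; rewrite lee_fin (le_trans (fg x Dx))// ler_norm.
Qed.

Lemma rint_cst (c : R) : rint (fun=> c).
Proof.
apply: (@measurable_bounded_integrable _ _ R mu (fun=> c) D mD) => //.
  by rewrite [ltLHS](_ : _ = (2 * pi)%:E) ?ltry//; exact: lebesgue_circle.
by exists `|c|; split => // t ct x _; exact: ltW.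
Qed.

Lemma rint_bounded f (B : R) : measurable_fun D f ->
  (forall x, D x -> `|f x| <= B) -> rint f.
Proof. by move=> mf fB; apply: rint_le (rint_cst B) fB. Qed.

Lemma rintD f g : rint f -> rint g -> rint (fun x => f x + g x).
Proof. by move=> fi gi; exact: (@integrableD _ _ R mu D mD _ _ fi gi). Qed.

Lemma rintN f : rint f -> rint (fun x => - f x).
Proof. by move=> fi; exact: (@integrableN _ _ R mu D _ fi). Qed.

Lemma rintB f g : rint f -> rint g -> rint (fun x => f x - g x).
Proof. by move=> fi gi; apply: rintD => //; exact: rintN. Qed.

Lemma rintZ (k : R) f : rint f -> rint (fun x => k * f x).
Proof. by move=> fi; exact: (@integrableZl _ _ R mu D mD k _ fi). Qed.

Lemma rint_norm f : rint f -> rint (fun x => `|f x|).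
Proof. by move=> fi; exact: (@integrable_norm _ _ R mu D _ fi). Qed.

Lemma rmeanD f g : rint f -> rint g -> rmean (fun x => f x + g x) = rmean f + rmean g.
Proof. by move=> fi gi; rewrite /rmean RintegralD// mulrDr. Qed.

Lemma rmeanZ k f : rint f -> rmean (fun x => k * f x) = k * rmean f.
Proof. by move=> fi; rewrite /rmean RintegralZl// mulrCA. Qed.

Lemma rmeanN f : rint f -> rmean (fun x => - f x) = - rmean f.
Proof.
move=> fi; rewrite -mulN1r -rmeanZ//; congr rmean.
by apply/funext => x; rewrite mulN1r.
Qed.

Lemma rmeanB f g : rint f -> rint g -> rmean (fun x => f x - g x) = rmean f - rmean g.
Proof. by move=> fi gi; rewrite rmeanD ?rmeanN//; exact: rintN. Qed.

Lemma rmean_cst (c : R) : rmean (fun=> c) = c.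
Proof.
rewrite /rmean Rintegral_cst//.
rewrite [X in fine X](_ : _ = (2 * pi)%:E) /=; last exact: lebesgue_circle.
by rewrite mulrCA mulVf ?mulr1// gt_eqF// twopi_gt0.
Qed.

Lemma eq_rmean f g : (forall x, D x -> f x = g x) -> rmean f = rmean g.
Proof.
by move=> fg; congr (_ * _); apply: eq_Rintegral => x; rewrite inE; exact: fg.
Qed.

Lemma eq_cmean u v : (forall x, D x -> u x = v x) -> cmean u = cmean v.
Proof. by move=> uv; congr (_ +i* _); apply: eq_rmean => x /uv->. Qed.

Lemma ler_rmean f g : rint f -> rint g -> (forall x, D x -> f x <= g x) ->
  rmean f <= rmean g.
Proof.
move=> fi gi fg; rewrite ler_wpM2l ?invr_ge0 ?(ltW twopi_gt0)//.
exact: le_Rintegral.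
Qed.

Lemma rmean_ge0 f : (forall x, D x -> 0 <= f x) -> 0 <= rmean f.
Proof. by move=> f0; rewrite mulr_ge0 ?invr_ge0 ?(ltW twopi_gt0)// Rintegral_ge0. Qed.

Lemma funReD u v : (fun x => complex.Re (u x + v x)) =
  (fun x => complex.Re (u x) + complex.Re (v x)).
Proof. by apply/funext => x; rewrite ReD. Qed.

Lemma funImD u v : (fun x => complex.Im (u x + v x)) =
  (fun x => complex.Im (u x) + complex.Im (v x)).
Proof. by apply/funext => x; rewrite ImD. Qed.

Lemma funReM u v : (fun x => complex.Re (u x * v x)) = (fun x =>
  complex.Re (u x) * complex.Re (v x) - complex.Im (u x) * complex.Im (v x)).
Proof. by apply/funext => x; rewrite ReM. Qed.

Lemma funImM u v : (fun x => complex.Im (u x * v x)) = (fun x =>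
  complex.Re (u x) * complex.Im (v x) + complex.Im (u x) * complex.Re (v x)).
Proof. by apply/funext => x; rewrite ImM. Qed.

Definition cmeas u := measurable_fun D (fun x => complex.Re (u x)) /\
  measurable_fun D (fun x => complex.Im (u x)).

Lemma cint_meas u : cint u -> cmeas u.
Proof. by move=> [/rint_measurable ? /rint_measurable ?]. Qed.

Lemma cmeasD u v : cmeas u -> cmeas v -> cmeas (fun x => u x + v x).
Proof.
move=> [a b] [c d]; split.
  by rewrite funReD; exact: (measurable_funD a c).
by rewrite funImD; exact: (measurable_funD b d).
Qed.

Lemma cmeasM u v : cmeas u -> cmeas v -> cmeas (fun x => u x * v x).
Proof.
move=> [a b] [c d]; split.
  rewrite funReM.
  exact: (measurable_funB (measurable_funM a c) (measurable_funM b d)).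
rewrite funImM.
exact: (measurable_funD (measurable_funM a d) (measurable_funM b c)).
Qed.

Lemma cmeas_cst (c : C) : cmeas (fun=> c).
Proof. by split; exact: measurable_cst. Qed.

Lemma cmeas_cabs u : cmeas u -> measurable_fun D (fun x => cabs (u x)).
Proof.
move=> [a b]; rewrite [X in measurable_fun _ X](_ : _ =
    fun x => Num.sqrt (complex.Re (u x) ^+ 2 + complex.Im (u x) ^+ 2)); last first.
  by apply/funext => x; rewrite -cabs2 sqrtr_sqr ger0_norm ?cabs_ge0.
apply: (@measurableT_comp _ _ _ _ _ _ (@Num.sqrt R)).
  by apply: continuous_measurable_fun; exact: sqrt_continuous.
exact: (measurable_funD (measurable_funX 2 a) (measurable_funX 2 b)).
Qed.

Lemma cint_le u g : cmeas u -> rint g -> (forall x, D x -> cabs (u x) <= g x) -> cint u.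
Proof.
move=> [a b] gi ug; split; apply: rint_le gi _ => // x Dx.
  exact: le_trans (ler_Re_cabs _) (ug x Dx).
exact: le_trans (ler_Im_cabs _) (ug x Dx).
Qed.

Lemma cint_bounded u (B : R) : cmeas u -> (forall x, D x -> cabs (u x) <= B) -> cint u.
Proof. by move=> mu uB; apply: cint_le (rint_cst B) uB. Qed.

Lemma cint_cabs u : cint u -> rint (fun x => cabs (u x)).
Proof.
move=> [a b]; apply: rint_le (rintD (rint_norm a) (rint_norm b)) _.
  by apply: cmeas_cabs; exact: cint_meas.
by move=> x _; rewrite ger0_norm ?cabs_ge0 ?ler_cabs_ReIm.
Qed.

Lemma cintD u v : cint u -> cint v -> cint (fun x => u x + v x).
Proof.
move=> [a b] [c d]; split.
  by rewrite funReD; exact: rintD.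
by rewrite funImD; exact: rintD.
Qed.

Lemma cintM u v (B : R) : cint u -> cmeas v ->
  (forall x, D x -> cabs (v x) <= B) -> cint (fun x => u x * v x).
Proof.
move=> ui mv vB; apply: cint_le (rintZ B (cint_cabs ui)) _.
  by apply: cmeasM => //; exact: cint_meas.
by move=> x Dx; rewrite cabsM mulrC ler_wpM2r ?cabs_ge0 ?vB.
Qed.

Lemma cint_cst (c : C) : cint (fun=> c).
Proof. by split; exact: rint_cst. Qed.

Lemma cintZ (c : C) u : cint u -> cint (fun x => c * u x).
Proof.
move=> ui; rewrite (_ : (fun x => c * u x) = (fun x => u x * c)); last first.
  by apply/funext => x; rewrite mulrC.
by apply: (cintM ui (cmeas_cst c)) => x _; exact: lexx.
Qed.

Lemma cintN u : cint u -> cint (fun x => - u x).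
Proof.
move=> /(cintZ (-1)); rewrite (_ : (fun x => -1 * u x) = (fun x => - u x))//.
by apply/funext => x; rewrite mulN1r.
Qed.

Lemma cintB u v : cint u -> cint v -> cint (fun x => u x - v x).
Proof. by move=> ui /cintN; exact: cintD. Qed.

Lemma cmeanD u v : cint u -> cint v -> cmean (fun x => u x + v x) = cmean u + cmean v.
Proof.
move=> [a b] [c d]; apply/eqP; rewrite eq_complex ReD ImD /= -!rmeanD//.
by apply/andP; split; apply/eqP; apply: eq_rmean => x _; rewrite ?ReD ?ImD.
Qed.

Lemma cmeanZ (c : C) u : cint u -> cmean (fun x => c * u x) = c * cmean u.
Proof.
move=> [a b]; apply/eqP; rewrite eq_complex ReM ImM /=.
rewrite -!rmeanZ// -rmeanB -?rmeanD; try exact: rintZ.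
by apply/andP; split; apply/eqP; apply: eq_rmean => x _; rewrite ?ReM ?ImM.
Qed.

Lemma cmeanN u : cint u -> cmean (fun x => - u x) = - cmean u.
Proof.
by move=> ui; rewrite -mulN1r -cmeanZ//; apply: eq_cmean => x _; rewrite mulN1r.
Qed.

Lemma cmeanB u v : cint u -> cint v -> cmean (fun x => u x - v x) = cmean u - cmean v.
Proof. by move=> ui vi; rewrite cmeanD ?cmeanN//; exact: cintN. Qed.

Lemma cmean_cst (c : C) : cmean (fun=> c) = c.
Proof. by rewrite /cmean !rmean_cst; case: c. Qed.

(** Multiplying by the conjugate of the mean turns the estimate into one for a real part, so no
    constant is lost. *)
Lemma ler_cmean u g : cint u -> rint g -> (forall x, D x -> cabs (u x) <= g x) ->
  cabs (cmean u) <= rmean g.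
Proof.
move=> ui gi ug; set c := cmean u.
have [c0|c0] := eqVneq c 0.
  rewrite c0 cabs0; apply: rmean_ge0 => x Dx.
  by rewrite (le_trans (cabs_ge0 (u x)))// ug.
have c1 : 0 < cabs c by rewrite cabs_gt0.
rewrite -(ler_pM2l c1) -expr2.
have -> : cabs c ^+ 2 = rmean (fun x => complex.Re (c^*%C * u x)).
  have := cmeanZ c^*%C ui => /(congr1 (@complex.Re R)).
  by rewrite [X in X = _]/= -/c => ->; rewrite mulrC mul_conj.
rewrite -rmeanZ//; apply: ler_rmean; first by have [] := cintZ c^*%C ui.
  exact: rintZ.
move=> x Dx; rewrite (le_trans (ler_norm _))// (le_trans (ler_Re_cabs _))//.
by rewrite cabsM cabs_conj ler_wpM2l ?cabs_ge0 ?ug.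
Qed.

(* Traces of analytic functions on smaller circles are of this kind. *)
Definition clip u := exists L B : R, [/\ 0 <= L, 0 <= B,
  forall x y, cabs (u y - u x) <= L * `|y - x| & forall x, cabs (u x) <= B].

Lemma lipschitz_continuous f (L : R) : 0 <= L ->
  (forall x y, `|f y - f x| <= L * `|y - x|) -> continuous f.
Proof.
move=> L0 fL x; apply/cvgrPdist_lt => e e0; near=> y.
have -> : f x - f y = - (f y - f x) by rewrite opprB.
rewrite normrN (le_lt_trans (fL x y))//.
apply: (@le_lt_trans _ _ ((L + 1) * `|y - x|)); first by rewrite ler_wpM2r// lerDl.
rewrite mulrC -ltr_pdivlMr ?ltr_wpDl//.
have -> : y - x = - (x - y) by rewrite opprB.
rewrite normrN; near: y.
have e1 : 0 < e / (L + 1) by rewrite divr_gt0// ltr_wpDl.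
by have /cvgrPdist_lt/(_ _ e1) := @cvg_id _ (nbhs x).
Unshelve. all: by end_near. Qed.

Lemma lipschitz_measurable f (L : R) : 0 <= L ->
  (forall x y, `|f y - f x| <= L * `|y - x|) -> measurable_fun D f.
Proof.
move=> L0 fL; apply: measurable_funTS.
by apply: continuous_measurable_fun; exact: lipschitz_continuous fL.
Qed.

Lemma clip_meas u : clip u -> cmeas u.
Proof.
move=> [L [B [L0 B0 uL uB]]]; split; apply: (lipschitz_measurable L0) => x y.
  by rewrite -ReB (le_trans (ler_Re_cabs _)).
by rewrite -ImB (le_trans (ler_Im_cabs _)).
Qed.

Lemma clip_int u : clip u -> cint u.
Proof.
move=> uc; have := uc => -[L [B [L0 B0 uL uB]]].
by apply: (@cint_bounded _ B) => //; exact: clip_meas.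
Qed.

Lemma clip_cst (c : C) : clip (fun=> c).
Proof.
exists 0, (cabs c); split => //; first exact: cabs_ge0.
by move=> x y; rewrite subrr cabs0 mul0r.
Qed.

Lemma clip_cis : clip (@cis R).
Proof. by exists 2, 1; split => // [x y|x]; rewrite ?cis_lip ?cabs_cis. Qed.

Lemma clipD u v : clip u -> clip v -> clip (fun x => u x + v x).
Proof.
move=> [L [B [L0 B0 uL uB]]] [M [E [M0 E0 vM vE]]].
exists (L + M), (B + E); split; [by rewrite ?addr_ge0|by rewrite ?addr_ge0|move=> x y|move=> x].
  by rewrite opprD addrACA mulrDl (le_trans (ler_cabsD _ _))// lerD.
by rewrite (le_trans (ler_cabsD _ _))// lerD.
Qed.

Lemma clipM u v : clip u -> clip v -> clip (fun x => u x * v x).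
Proof.
move=> [L [B [L0 B0 uL uB]]] [M [E [M0 E0 vM vE]]].
exists (L * E + B * M), (B * E); split; [by rewrite ?addr_ge0 ?mulr_ge0|by rewrite ?addr_ge0 ?mulr_ge0|move=> x y|move=> x].
  have -> : u y * v y - u x * v x = (u y - u x) * v y + u x * (v y - v x) by ring.
  rewrite (le_trans (ler_cabsD _ _))// !cabsM mulrDl lerD//.
    by rewrite mulrAC ler_pM ?cabs_ge0.
  by rewrite -mulrA ler_pM ?cabs_ge0.
by rewrite cabsM ler_pM ?cabs_ge0.
Qed.

Lemma clipZ (c : C) u : clip u -> clip (fun x => c * u x).
Proof. exact: clipM (clip_cst c). Qed.

Lemma clipN u : clip u -> clip (fun x => - u x).
Proof.
move=> /(clipZ (-1)); rewrite (_ : (fun x => -1 * u x) = (fun x => - u x))//.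
by apply/funext => x; rewrite mulN1r.
Qed.

Lemma clipB u v : clip u -> clip v -> clip (fun x => u x - v x).
Proof. by move=> uc /clipN; exact: clipD. Qed.

Lemma clip_conj u : clip u -> clip (fun x => (u x)^*%C).
Proof.
move=> [L [B [L0 B0 uL uB]]]; exists L, B; split => // [x y|x].
  by rewrite -rmorphB /= cabs_conj.
by rewrite cabs_conj.
Qed.

Lemma clipV (c : R) u : 0 < c -> (forall x, c <= cabs (u x)) -> clip u ->
  clip (fun x => (u x)^-1).
Proof.
move=> c0 uc [L [B [L0 B0 uL uB]]].
have ug0 x : 0 < cabs (u x) by exact: lt_le_trans (uc x).
have u0 x : u x != 0 by rewrite -cabs_gt0.
exists (L / c ^+ 2), c^-1; split.
- by rewrite mulr_ge0 ?invr_ge0 ?exprn_ge0 ?(ltW c0).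
- by rewrite invr_ge0 (ltW c0).
- move=> x y; have -> : (u y)^-1 - (u x)^-1 = - ((u y - u x) / (u x * u y)).
    by field; rewrite !u0.
  rewrite cabsN cabsM mulrAC ler_pM ?cabs_ge0// cabsV cabsM.
  rewrite lef_pV2 ?posrE ?mulr_gt0// ?exprn_gt0//.
  by rewrite expr2 ler_pM// ltW.
- by move=> x; rewrite cabsV lef_pV2 ?posrE.
Qed.

Lemma clip_comp (r : R) F F' u : 0 <= r -> (forall x, cabs (u x) <= r) ->
  holo_on r F F' -> clip u -> clip (fun x => F (u x)).
Proof.
move=> r0 ur FF [L [B [L0 B0 uL uB]]].
have [M M0 FM] := holo_on_lip r0 FF; have [E E0 FE] := holo_on_bound r0 FF.
exists (M * L), E; split; [by rewrite ?mulr_ge0|by rewrite ?mulr_ge0|move=> x y|move=> x]; last exact: FE.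
by rewrite (le_trans (FM _ _ _ _))// -mulrA ler_wpM2l.
Qed.

Lemma clip_comp_deriv (r : R) F F' u : 0 <= r -> (forall x, cabs (u x) <= r) ->
  holo_on r F F' -> clip u -> clip (fun x => F' (u x)).
Proof.
move=> r0 ur FF [L [B [L0 B0 uL uB]]].
have [M M0 FM] := holo_on_derivB FF; have [E E0 FE] := holo_on_deriv_bound r0 FF.
exists (M * L), E; split; [by rewrite ?mulr_ge0|by rewrite ?mulr_ge0|move=> x y|move=> x]; last exact: FE.
by rewrite (le_trans (FM _ _ _ _))// -mulrA ler_wpM2l.
Qed.

(** The angular counterpart of [holo_on]. The uniform remainder gives differentiability in x, hence
    access to the fundamental theorem of calculus. *)
Definition rquad u u' := exists2 K : R, 0 <= K &
  forall x y, cabs (u y - u x - u' x * (y - x)%:C) <= K * (y - x) ^+ 2.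

Lemma rquad_cis : rquad (@cis R) (fun x => 'i%C * cis x).
Proof. by exists 2 => // x y; exact: cis_quad. Qed.

Lemma rquadM u u' v v' : clip u -> clip u' -> clip v -> rquad u u' -> rquad v v' ->
  rquad (fun x => u x * v x) (fun x => u' x * v x + u x * v' x).
Proof.
move=> [_ [B [_ B0 _ uB]]] [_ [E [_ E0 _ uE]]] [M [F [M0 F0 vM vF]]].
move=> [K K0 uK] [L L0 vL]; exists (K * F + E * M + B * L).
  by rewrite !addr_ge0// mulr_ge0.
move=> x y; set h := y - x.
have -> : u y * v y - u x * v x - (u' x * v x + u x * v' x) * h%:C =
  (u y - u x - u' x * h%:C) * v y + u' x * h%:C * (v y - v x)
   + u x * (v y - v x - v' x * h%:C) by ring.
rewrite (le_trans (ler_cabsD _ _))// [leRHS]mulrDl lerD//; last first.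
  by rewrite cabsM -mulrA ler_pM ?cabs_ge0 ?vL.
rewrite (le_trans (ler_cabsD _ _))// [leRHS]mulrDl lerD//.
  by rewrite cabsM mulrAC ler_pM ?cabs_ge0 ?uK.
have -> : E * M * h ^+ 2 = E * `|h| * (M * `|h|).
  by rewrite -[h ^+ 2]real_normK ?num_real//; ring.
by rewrite !cabsM cabs_real ler_pM ?mulr_ge0 ?cabs_ge0// ler_wpM2r.
Qed.

Lemma rquad_comp (r : R) F F' u u' : 0 <= r -> (forall x, cabs (u x) <= r) ->
  clip u -> holo_on r F F' -> rquad u u' ->
  rquad (fun x => F (u x)) (fun x => F' (u x) * u' x).
Proof.
move=> r0 ur [M [_ [M0 _ uM _]]] FF; have [E E0 FE] := holo_on_deriv_bound r0 FF.
case: FF => K K0 FK [L L0 uL]; exists (K * M ^+ 2 + E * L).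
  by rewrite addr_ge0// mulr_ge0// exprn_ge0.
move=> x y; set h := y - x.
have -> : F (u y) - F (u x) - F' (u x) * u' x * h%:C =
  (F (u y) - F (u x) - F' (u x) * (u y - u x)) +
  F' (u x) * (u y - u x - u' x * h%:C) by ring.
rewrite (le_trans (ler_cabsD _ _))// [leRHS]mulrDl lerD//.
  rewrite (le_trans (FK _ _ _ _))// -mulrA ler_wpM2l//.
  rewrite -[h ^+ 2]real_normK ?num_real// -exprMn.
  by rewrite ler_pXn2r ?nnegrE ?mulr_ge0 ?cabs_ge0.
by rewrite cabsM -mulrA ler_pM ?cabs_ge0 ?FE.
Qed.

Lemma rquad_conj u u' : rquad u u' -> rquad (fun x => (u x)^*%C) (fun x => (u' x)^*%C).
Proof.
move=> [K K0 uK]; exists K => // x y.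
have -> : (u y)^*%C - (u x)^*%C - (u' x)^*%C * (y - x)%:C =
    (u y - u x - u' x * (y - x)%:C)^*%C.
  rewrite [RHS]rmorphB [X in _ = X - _]rmorphB [X in _ = _ - X]rmorphM /=.
  by rewrite oppr0.
by rewrite cabs_conj.
Qed.

Lemma rmean_deriv f f' (K L : R) : 0 <= K -> 0 <= L ->
  (forall x y, `|f y - f x - f' x * (y - x)| <= K * (y - x) ^+ 2) ->
  (forall x y, `|f' y - f' x| <= L * `|y - x|) -> f 0 = f (2 * pi) -> rmean f' = 0.
Proof.
move=> K0 L0 fK f'L f0.
have fc : continuous f'.
  exact: lipschitz_continuous f'L.
have fd (x : R) : is_derive x 1 f (f' x).
  have E : (fun h : R => h^-1 *: ((f \o shift x) (h *: 1) - f x)) @ 0^' --> f' x.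
    have -> : (fun h : R => h^-1 *: ((f \o shift x) (h *: 1) - f x)) =
        (fun h : R => h^-1 *: (f (h + x) - f x)).
      by apply/funext => h /=; rewrite [h *: 1]mulr1.
    apply/cvgrPdist_le => e e0; near=> h.
    have h0 : h != 0 by near: h; exact: nbhs_dnbhs_neq.
    have -> : f' x - h^-1 *: (f (h + x) - f x) =
        - (h^-1 * (f (h + x) - f x - f' x * (h + x - x))).
      by rewrite addrK [in RHS]mulrBr [f' x * h]mulrC mulKf// opprB.
    rewrite normrN normrM normfV ler_pdivrMl ?normr_gt0//.
    rewrite (le_trans (fK _ _))// addrK -[h ^+ 2]real_normK ?num_real// expr2 mulrA.
    rewrite mulrC ler_wpM2l// (@le_trans _ _ ((K + 1) * `|h|)) ?ler_wpM2r ?lerDl//.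
    rewrite mulrC -ler_pdivlMr ?ltr_wpDl//.
    near: h; apply: dnbhs0_le; by rewrite divr_gt0// ltr_wpDl.
  apply: DeriveDef; last exact: cvg_lim E.
  by apply/cvg_ex; exists (f' x).
have fcont : continuous f.
  move=> x; apply: differentiable_continuous; apply/derivable1_diffP.
  by case: (fd x).
rewrite /rmean /Rintegral (@continuous_FTC2 _ f' f).
- by rewrite -f0 /= subrr mulr0.
- exact: twopi_gt0.
- exact: continuous_subspaceT.
- split.
  + by move=> x _; case: (fd x).
  + by apply: cvg_at_right_filter; exact: fcont.
  + by apply: cvg_at_left_filter; exact: fcont.
- by move=> x _; rewrite derive1E; exact: derive_val.
Unshelve. all: by end_near. Qed.

(** A primitive with equal values at 0 and 2 pi leaves nothing in the fundamental theorem of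
    calculus. Every vanishing of a contour integral below is reduced to this. *)
Lemma cmean_deriv u u' : rquad u u' -> clip u' -> u 0 = u (2 * pi) -> cmean u' = 0.
Proof.
move=> [K K0 uK] [L [_ [L0 _ uL _]]] u0; rewrite /cmean.
rewrite (@rmean_deriv (fun x => complex.Re (u x)) _ K L)//; last by rewrite u0.
- rewrite (@rmean_deriv (fun x => complex.Im (u x)) _ K L)//; last by rewrite u0.
  + move=> x y; apply: le_trans (uK x y); apply: le_trans (ler_Im_cabs _).
    by rewrite !ImB ImM /= mulr0 add0r.
  + by move=> x y; rewrite -ImB (le_trans (ler_Im_cabs _)).
- move=> x y; apply: le_trans (uK x y); apply: le_trans (ler_Re_cabs _).
  by rewrite !ReB ReM /= mulr0 subr0.
- by move=> x y; rewrite -ReB (le_trans (ler_Re_cabs _)).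
Qed.

(** On n + 1 equal pieces the quadratic errors add up to [K * d ^+ 2 / n.+1%:R], which tends to 0,
    while the linear parts add up to the right-hand side. It plays the role of the mean value
    inequality along a segment. *)
Lemma quadratic_increment (g : R -> C) (a b B K : R) : a <= b -> 0 <= K ->
  (forall s t, a <= s <= b -> a <= t <= b ->
    cabs (g t - g s) <= B * `|t - s| + K * (t - s) ^+ 2) ->
  cabs (g b - g a) <= B * (b - a).
Proof.
move=> ab K0 gK; apply/ler_addgt0Pr => e e0.
set d := b - a; have d0 : 0 <= d by rewrite subr_ge0.
have [n ne] : exists n, K * d ^+ 2 / n.+1%:R <= e.
  exists (Num.truncn (K * d ^+ 2 / e)).
  rewrite ler_pdivrMr// [e * _]mulrC -ler_pdivrMr//.
  by apply/ltW/truncnS_gt.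
apply: (@le_trans _ _ (B * d + K * d ^+ 2 / n.+1%:R)); last by rewrite lerD2l.
set p := fun k : nat => a + k%:R / n.+1%:R * d.
have n0 : (0 : R) < n.+1%:R by [].
have pab k : (k <= n.+1)%N -> a <= p k <= b.
  move=> kn; rewrite /p lerDl mulr_ge0 ?divr_ge0//=.
  rewrite -lerBrDl -/d ler_piMl// ler_pdivrMr// mul1r ler_nat//.
have pS k : p k.+1 - p k = d / n.+1%:R.
  by rewrite /p -addn1 natrD; field; rewrite gt_eqF.
have step k : (k <= n.+1)%N -> cabs (g (p k) - g a) <=
    k%:R * (B * (d / n.+1%:R) + K * (d / n.+1%:R) ^+ 2).
  elim: k => [|k IH] kn; first by rewrite /p !mul0r addr0 subrr cabs0.
  rewrite (le_trans (cabs_dist_triangle (g (p k)) _ _))//.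
  rewrite -[in leRHS]addn1 natrD [leRHS]mulrDl mul1r [leRHS]addrC lerD ?IH// 1?ltnW//.
  rewrite -(pS k) -[X in B * X]ger0_norm; last first.
    by rewrite pS divr_ge0.
  by rewrite gK ?pab// ltnW.
have := step n.+1 (leqnn _).
have -> : p n.+1 = b by rewrite /p divff ?gt_eqF// mul1r addrC subrK.
move=> /le_trans; apply.
rewrite le_eqVlt; apply/orP; left; apply/eqP; field; by rewrite gt_eqF.
Qed.

Lemma quadratic_const (g : R -> C) (a b K : R) : a <= b -> 0 <= K ->
  (forall s t, a <= s <= b -> a <= t <= b -> cabs (g t - g s) <= K * (t - s) ^+ 2) ->
  g a = g b.
Proof.
move=> ab K0 gK; apply/eqP; rewrite eq_sym -subr_eq0 -cabs_eq0.
rewrite eq_le cabs_ge0 andbT -[leRHS](mul0r (b - a)).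
by apply: (quadratic_increment ab K0) => s t sab tab; rewrite mul0r add0r gK.
Qed.

(* Stands for the homotopy invariance of contour integrals. *)
Lemma cmean_param_const (W V : R -> R -> C) (a b K : R) : a <= b -> 0 <= K ->
  (forall s, a <= s <= b -> cint (W s)) ->
  (forall s, a <= s <= b -> cint (V s)) ->
  (forall s, a <= s <= b -> cmean (V s) = 0) ->
  (forall s t x, a <= s <= b -> a <= t <= b -> D x ->
    cabs (W t x - W s x - (t - s)%:C * V s x) <= K * (t - s) ^+ 2) ->
  cmean (W a) = cmean (W b).
Proof.
move=> ab K0 iW iV V0 WV.
apply: (@quadratic_const (fun s => cmean (W s)) a b K) => // s t sab tab.
have iZ := cintZ (t - s)%:C (iV _ sab); have iB := cintB (iW _ tab) (iW _ sab).
have -> : cmean (W t) - cmean (W s) =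
    cmean (fun x => W t x - W s x - (t - s)%:C * V s x).
  rewrite (cmeanB iB iZ) (cmeanB (iW _ tab) (iW _ sab)) (cmeanZ _ (iV _ sab)).
  by rewrite V0// mulr0 subr0.
rewrite -[leRHS]rmean_cst; apply: ler_cmean.
- exact: cintB.
- exact: rint_cst.
- by move=> x; exact: WV.
Qed.

End CircleMean.

(** * The Cauchy and Poisson formulas *)

Section Cauchy.
Variable R : realType.
Local Notation C := R[i].
Local Notation D := (`[0, 2 * pi]%classic : set R).
Implicit Types (z w : C) (x r s : R) (F G : C -> C).

(** Cauchy's kernel e / (e - z) at e = [cis x], the conjugate of e being its inverse. The numerator
    absorbs de = i e dx, so that [cmean] against it is Cauchy's integral. *)
Definition ckernel z x : C := (1 - z * (cis x)^*%C)^-1.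

Lemma cis_mul_conj x : cis x * (cis x)^*%C = 1 :> C.
Proof. by rewrite mul_conj cabs_cis expr1n. Qed.

Lemma cabs_ckernel_den z x : 1 - cabs z <= cabs (1 - z * (cis x)^*%C).
Proof.
by rewrite (le_trans _ (ler_dist_cabs _ _))// cabs1 cabsM cabs_conj cabs_cis mulr1.
Qed.

Lemma ckernel_den_neq0 z x : cabs z < 1 -> 1 - z * (cis x)^*%C != 0.
Proof.
by move=> z1; rewrite -cabs_gt0 (lt_le_trans _ (cabs_ckernel_den z x))// subr_gt0.
Qed.

Lemma cabs_ckernel z x : cabs z < 1 -> cabs (ckernel z x) <= (1 - cabs z)^-1.
Proof.
move=> z1; rewrite cabsV lef_pV2 ?posrE ?cabs_ckernel_den// ?subr_gt0//.
by rewrite cabs_gt0 ckernel_den_neq0.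
Qed.

Lemma clip_ckernel z : cabs z < 1 -> clip (ckernel z).
Proof.
move=> z1; apply: (@clipV _ (1 - cabs z)); first by rewrite subr_gt0.
  by move=> x; exact: cabs_ckernel_den.
apply: clipB; first exact: clip_cst.
by apply: clipZ; apply: clip_conj; exact: clip_cis.
Qed.

Lemma cmean_cis : cmean (@cis R) = 0.
Proof.
have c0 : clip (fun x : R => 'i%C * cis x : C).
  by apply: clipZ; exact: clip_cis.
have := cmean_deriv (@rquad_cis R) c0.
rewrite cis0 cis2pi => /(_ erefl).
rewrite (cmeanZ 'i%C (clip_int (clip_cis R))) => /eqP; rewrite mulf_eq0.
by rewrite -cabs_eq0 cabs_i oner_eq0 => /eqP.
Qed.

Lemma holo_on_affineV z : cabs z < 1 ->
  holo_on 1 (fun w => (1 - z * w)^-1) (fun w => z / (1 - z * w) ^+ 2).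
Proof.
move=> z1; have h : holo_on 1 (fun w => 1 - z * w) (fun w => - z).
  apply: eq_holo_on (holo_onD (holo_on_cst 1 1) (holo_onZ (- z) ler01 (holo_on_id 1))).
    by move=> w _; rewrite mulNr.
  by move=> w _; rewrite mulr1 add0r.
apply: eq_holo_on (holo_onV ler01 (_ : 0 < 1 - cabs z) _ h) => //.
- by move=> w _; rewrite opprK.
- by rewrite subr_gt0.
move=> w w1; rewrite (le_trans _ (ler_dist_cabs _ _))// cabs1 cabsM lerB//.
by rewrite ler_piMr ?cabs_ge0.
Qed.

Lemma conj_iM w : ('i%C * w)^*%C = - 'i%C * w^*%C.
Proof.
case: w => a b; apply/eqP; rewrite eq_complex /=.
by apply/andP; split; apply/eqP; ring.
Qed.

Lemma conj_realM (a : R) w : (a%:C * w)^*%C = a%:C * w^*%C.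
Proof.
case: w => u v; apply/eqP; rewrite eq_complex /=.
by apply/andP; split; apply/eqP; ring.
Qed.

Lemma cmean_ckernel z : cabs z < 1 -> cmean (ckernel z) = 1.
Proof.
move=> z1; pose q x := (cis x)^*%C : C.
have q1 x : cabs (q x) = 1 by rewrite cabs_conj cabs_cis.
have qc : clip q by apply: clip_conj; exact: clip_cis.
have zs s : 0 <= s <= 1 -> cabs (s%:C * z) <= cabs z.
  move=> /andP[s0 s1]; rewrite cabsM cabs_real ger0_norm//.
  by rewrite ler_piMl ?cabs_ge0.
have zs1 s : 0 <= s <= 1 -> cabs (s%:C * z) < 1.
  by move=> /zs /le_lt_trans; apply.
(* The parameter moves 0 to z. [V s] is the derivative of [W s] in s, and its mean vanishes because
   it is also an angular derivative. *)
pose W s x := ckernel (s%:C * z) x; pose V s x := z * q x * ckernel (s%:C * z) x ^+ 2.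
have Wc s : 0 <= s <= 1 -> clip (W s).
  by move=> s01; apply: clip_ckernel; exact: zs1.
have Vc s : 0 <= s <= 1 -> clip (V s).
  move=> s01; apply: clipM; first by apply: clipM => //; exact: clip_cst.
  by apply: clipM; exact: Wc.
have -> : cmean (ckernel z) = cmean (W 1) by apply: eq_cmean => x _; rewrite /W mul1r.
rewrite -(@cmean_param_const _ W V 0 1 (((1 - cabs z)^-1) ^+ 3) ler01).
- have -> : cmean (W 0) = cmean (fun=> 1 : C).
    by apply: eq_cmean => x _; rewrite /W /ckernel !mul0r subr0 invr1.
  exact: cmean_cst.
- by rewrite exprn_ge0// invr_ge0 subr_ge0 ltW.
- by move=> s s01; apply: clip_int; exact: Wc.
- by move=> s s01; apply: clip_int; exact: Vc.
(* For s > 0, [H] is i / s times the increment of 1 / (1 - s z w) from w = 0; this form of the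
   primitive stays regular at s = 0. *)
- move=> s s01; pose H w : C := 'i%C * z * w * (1 - s%:C * z * w)^-1.
  have HH : holo_on 1 H (fun w => 'i%C * z / (1 - s%:C * z * w) ^+ 2).
    apply: eq_holo_on (holo_onM ler01 (holo_onZ ('i%C * z) ler01 (holo_on_id 1))
      (holo_on_affineV (zs1 _ s01))) => // w w1.
    have d0 : 1 - s%:C * z * w != 0.
      rewrite -cabs_gt0 (lt_le_trans _ (ler_dist_cabs _ _))// cabs1 subr_gt0.
      rewrite cabsM (le_lt_trans _ (zs1 _ s01))// ler_piMr ?cabs_ge0//.
    by field.
  have q' : rquad q (fun x => ('i%C * cis x)^*%C) by apply: rquad_conj; exact: rquad_cis.
  have VE : V s = fun x => 'i%C * z / (1 - s%:C * z * q x) ^+ 2 * ('i%C * cis x)^*%C.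
    apply/funext => x; rewrite /V /ckernel -/(q x) exprVn conj_iM -/(q x).
    have ii : 'i%C * - 'i%C = 1 :> C by rewrite mulrN -expr2 sqr_i opprK.
    by rewrite -[LHS]mul1r -ii; ring.
  rewrite VE; apply: (@cmean_deriv _ (fun x => H (q x))).
  + apply: (rquad_comp ler01 _ qc HH q') => x; by rewrite q1.
  + by rewrite -VE; exact: Vc.
  + by rewrite /q cis0 cis2pi.
- move=> s t x s01 t01 Dx.
  rewrite /W /V /ckernel -/(q x).
  have d0 a : 0 <= a <= 1 -> 1 - a%:C * z * q x != 0.
    by move=> a01; exact: ckernel_den_neq0 (zs1 _ a01).
  have ds := d0 s s01; have dt := d0 t t01.
  have -> : (1 - t%:C * z * q x)^-1 - (1 - s%:C * z * q x)^-1 - (t - s)%:C *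
      (z * q x * (1 - s%:C * z * q x)^-1 ^+ 2) = ((t - s)%:C * z * q x) ^+ 2 *
      ((1 - s%:C * z * q x)^-1 ^+ 2 * (1 - t%:C * z * q x)^-1).
    rewrite rmorphB /=; field; by rewrite ds dt.
  rewrite cabsM mulrC ler_pM ?cabs_ge0//.
    rewrite cabsM cabsX !cabsV [leRHS]exprSr ler_pM ?exprn_ge0 ?invr_ge0 ?cabs_ge0//.
      rewrite ler_pXn2r ?nnegrE ?invr_ge0 ?cabs_ge0 ?subr_ge0 ?(ltW z1)//.
      rewrite lef_pV2 ?posrE ?subr_gt0 ?cabs_gt0//.
      by rewrite (le_trans _ (cabs_ckernel_den _ _))// lerB// zs.
    rewrite lef_pV2 ?posrE ?subr_gt0 ?cabs_gt0//.
    by rewrite (le_trans _ (cabs_ckernel_den _ _))// lerB// zs.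
  rewrite cabsX !cabsM cabs_real q1 mulr1 -[leRHS]real_normK ?num_real//.
  rewrite ler_pXn2r ?nnegrE ?mulr_ge0 ?cabs_ge0//.
  by rewrite ler_piMr// ltW.
Qed.

Lemma cauchy_formula F F' z : holo_on 1 F F' -> cabs z < 1 ->
  cmean (fun x => F (cis x) * ckernel z x) = F z.
Proof.
move=> FF z1.
(* The circle is contracted to z along segments. Since [cis x - z] cancels the denominator of the
   kernel, the derivative [V] of the integrand in s has no singularity. *)
pose p s x : C := z + s%:C * (cis x - z).
have p1 s x : 0 <= s <= 1 -> cabs (p s x) <= 1.
  move=> /andP[s0 s1]; have -> : p s x = (1 - s)%:C * z + s%:C * cis x.
    by rewrite /p rmorphB /=; ring.
  rewrite (le_trans (ler_cabsD _ _))// !cabsM !cabs_real cabs_cis mulr1.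
  rewrite !ger0_norm ?subr_ge0// -lerBrDr ler_piMr ?subr_ge0//.
  exact: ltW.
have pc s : clip (p s).
  apply: clipD; first exact: clip_cst.
  by apply: clipZ; apply: clipB; [exact: clip_cis|exact: clip_cst].
have kc := clip_ckernel z1; have ek x : (cis x - z) * ckernel z x = cis x.
  have -> : cis x - z = cis x * (1 - z * (cis x)^*%C).
    by rewrite mulrBr mulr1 mulrCA cis_mul_conj mulr1.
  by rewrite mulfK// ckernel_den_neq0.
have cisc := clip_cis R.
pose W s x := F (p s x) * ckernel z x; pose V s x := F' (p s x) * cis x.
have Wc s : 0 <= s <= 1 -> clip (W s).
  by move=> s01; apply: clipM => //; apply: (clip_comp ler01 _ FF) => // x; exact: p1.
have Vc s : 0 <= s <= 1 -> clip (V s).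
  move=> s01; apply: clipM => //.
  by apply: (clip_comp_deriv ler01 _ FF) => // x; exact: p1.
have -> : cmean (fun x => F (cis x) * ckernel z x) = cmean (W 1).
  by apply: eq_cmean => x _; rewrite /W /p mul1r subrKC.
have [K K0 FK] := FF.
rewrite -(@cmean_param_const _ W V 0 1 (K * 4 * (1 - cabs z)^-1) ler01).
- have -> : cmean (W 0) = cmean (fun x => F z * ckernel z x).
    by apply: eq_cmean => x _; rewrite /W /p mul0r addr0.
  by rewrite (cmeanZ (F z) (clip_int kc)) cmean_ckernel// mulr1.
- by rewrite !mulr_ge0// invr_ge0 subr_ge0 ltW.
- by move=> s s01; apply: clip_int; exact: Wc.
- by move=> s s01; apply: clip_int; exact: Vc.
(* For s > 0, i s [V s] is the angular derivative of [F (p s x)]. At s = 0 this says nothing, but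
   there [V] is a multiple of [cis x]. *)
- move=> s s01; have [s0|s0] := eqVneq s 0.
    have -> : cmean (V s) = cmean (fun x => F' z * cis x).
      by apply: eq_cmean => x _; rewrite /V /p s0 mul0r addr0.
    by rewrite (cmeanZ (F' z) (clip_int cisc)) cmean_cis mulr0.
  have p' : rquad (p s) (fun x => s%:C * ('i%C * cis x)).
    have [L L0 cL] := rquad_cis R; exists (`|s| * L); first by rewrite mulr_ge0.
    move=> x y; have -> : p s y - p s x - s%:C * ('i%C * cis x) * (y - x)%:C =
      s%:C * (cis y - cis x - 'i%C * cis x * (y - x)%:C) by rewrite /p; ring.
    by rewrite cabsM cabs_real -[leRHS]mulrA ler_wpM2l.
  have := @cmean_deriv _ _ _ (rquad_comp ler01 (fun x => p1 s x s01) (pc s) FF p').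
  have -> : (fun x => F' (p s x) * (s%:C * ('i%C * cis x))) =
      (fun x => s%:C * 'i%C * V s x) by apply/funext => x; rewrite /V; ring.
  rewrite (cmeanZ (s%:C * 'i%C) (clip_int (Vc _ s01))) => H.
  have /eqP : s%:C * 'i%C * cmean (V s) = 0.
    by apply: H; [apply: clipZ; exact: Vc|rewrite /p cis0 cis2pi].
  by rewrite !mulf_eq0 -cabs_eq0 cabs_real normr_eq0 (negbTE s0)
    -cabs_eq0 cabs_i oner_eq0 => /eqP.
- move=> s t x s01 t01 _.
  have -> : W t x - W s x - (t - s)%:C * V s x =
      (F (p t x) - F (p s x) - F' (p s x) * (p t x - p s x)) * ckernel z x.
    by rewrite /W /V -(ek x) /p rmorphB /=; ring.
  rewrite cabsM mulrAC ler_pM ?cabs_ge0 ?cabs_ckernel//.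
  rewrite (le_trans (FK _ _ _ _)) ?p1// -mulrA ler_wpM2l//.
  have -> : p t x - p s x = (t - s)%:C * (cis x - z) by rewrite /p rmorphB /=; ring.
  rewrite cabsM exprMn cabs_real real_normK ?num_real// mulrC ler_wpM2r ?sqr_ge0//.
  have -> : 4 = 2 ^+ 2 :> R by rewrite -natrX.
  rewrite ler_pXn2r ?nnegrE ?cabs_ge0// (le_trans (ler_cabsB _ _))//.
  by rewrite cabs_cis [leRHS](_ : _ = 1 + 1)// lerD2l ltW.
Qed.

Definition pkernel z x : R := (1 - cabs z ^+ 2) / cabs (cis x - z) ^+ 2.

Lemma cabs_cisB z x : cabs (cis x - z) = cabs (1 - z * (cis x)^*%C).
Proof.
have -> : cis x - z = cis x * (1 - z * (cis x)^*%C).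
  by rewrite mulrBr mulr1 mulrCA cis_mul_conj mulr1.
by rewrite cabsM cabs_cis mul1r.
Qed.

(** The second summand is an analytic function of [cis x] that vanishes at the origin. Its product
    with an analytic function therefore has mean 0, and Poisson's formula follows from Cauchy's. *)
Lemma pkernelE z x : cabs z < 1 ->
  (pkernel z x)%:C = ckernel z x + z^*%C * cis x * (1 - z^*%C * cis x)^-1.
Proof.
move=> z1; set a := cis x; set b := (cis x)^*%C.
have ab : a * b = 1 := cis_mul_conj x.
have d1 : 1 - z * b != 0 by exact: ckernel_den_neq0.
have d2E : 1 - z^*%C * a = (1 - z * b)^*%C.
  by rewrite rmorphB rmorphM rmorph1 /= opprK.
have d2 : 1 - z^*%C * a != 0 by rewrite d2E -cabs_gt0 cabs_conj cabs_gt0.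
rewrite /pkernel cabs_cisB rmorphM /= fmorphV /= -mul_conj -d2E rmorphB rmorph1 /=.
rewrite -(mul_conj z) /ckernel -/b.
have -> : 1 - z * z^*%C = (1 - z^*%C * a) + z^*%C * a * (1 - z * b).
  by rewrite mulrBr mulr1 addrA subrK mulrACA [z^*%C * z]mulrC ab mulr1.
have -> : cos x -i* sin x = b by [].
by field; rewrite d1 d2.
Qed.

Lemma pkernel_ge0 z x : cabs z <= 1 -> 0 <= pkernel z x.
Proof. by move=> z1; rewrite divr_ge0 ?sqr_ge0// subr_ge0 expr_le1 ?cabs_ge0. Qed.

Lemma cabs_cisB_ge z x : 1 - cabs z <= cabs (cis x - z).
Proof. by rewrite cabs_cisB cabs_ckernel_den. Qed.

Lemma holo_on_affineM z : cabs z < 1 ->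
  holo_on 1 (fun w => z * w * (1 - z * w)^-1)
    (fun w => z * (1 - z * w)^-1 + z * w * (z / (1 - z * w) ^+ 2)).
Proof.
move=> z1; apply: eq_holo_on (holo_onM ler01 (holo_onZ z ler01 (holo_on_id 1))
  (holo_on_affineV z1)) => // w _.
by rewrite mulr1.
Qed.

Lemma clip_pkernel z : cabs z < 1 -> clip (fun x => (pkernel z x)%:C).
Proof.
move=> z1; have -> : (fun x => (pkernel z x)%:C) =
    (fun x => ckernel z x + z^*%C * cis x * (1 - z^*%C * cis x)^-1).
  by apply/funext => x; exact: pkernelE.
apply: clipD; first exact: clip_ckernel.
have z1' : cabs z^*%C < 1 by rewrite cabs_conj.
apply: (clip_comp ler01 _ (holo_on_affineM z1') (clip_cis R)) => x.
by rewrite cabs_cis.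
Qed.

Lemma poisson_formula F F' z : holo_on 1 F F' -> cabs z < 1 ->
  cmean (fun x => F (cis x) * (pkernel z x)%:C) = F z.
Proof.
move=> FF z1; have z1' : cabs z^*%C < 1 by rewrite cabs_conj.
have Fc : clip (fun x => F (cis x)).
  by apply: (clip_comp ler01 _ FF (clip_cis R)) => x; rewrite cabs_cis.
have hG := holo_onM ler01 FF (holo_on_affineM z1').
have Gc := clip_comp ler01 (fun x => _ : cabs (cis x) <= 1) hG (clip_cis R).
have G0 := cauchy_formula hG (_ : cabs 0 < 1).
have -> : cmean (fun x => F (cis x) * (pkernel z x)%:C) =
  cmean (fun x => F (cis x) * ckernel z x +
    F (cis x) * (z^*%C * cis x * (1 - z^*%C * cis x)^-1) * ckernel 0 x).
  apply: eq_cmean => x _; rewrite pkernelE// mulrDr.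
  by rewrite /ckernel mul0r subr0 invr1 mulr1.
have c0 : cabs (0 : C) < 1 by rewrite cabs0.
rewrite cmeanD; first by rewrite (cauchy_formula FF z1) G0 // mulr0 mul0r mulr0 addr0.
- by apply: clip_int; apply: clipM => //; exact: clip_ckernel.
- apply: clip_int; apply: clipM; last exact: clip_ckernel.
  by apply: Gc => x; rewrite cabs_cis.
Qed.

Lemma rint_pkernel z : cabs z < 1 -> rint (pkernel z).
Proof. by move=> z1; have [] := clip_int (clip_pkernel z1). Qed.

Lemma rmean_pkernel z : cabs z < 1 -> rmean (pkernel z) = 1.
Proof.
move=> z1; have := poisson_formula (holo_on_cst 1 (1 : C)) z1.
move=> /(congr1 (@complex.Re R)); rewrite [X in _ = X]/= => <- /=.
by apply: eq_rmean => x _; rewrite mul1r mul0r subr0.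
Qed.

End Cauchy.

(** * Boundary values of bounded analytic functions *)

Section Energy.
Variable R : realType.
Local Notation C := R[i].
Local Notation D := (`[0, 2 * pi]%classic : set R).
Implicit Types (z w : C) (x r s t c : R) (F G : C -> C).

Lemma cabs_rcis r x : 0 <= r -> cabs (r%:C * cis x) = r.
Proof. by move=> r0; rewrite cabsM cabs_cis mulr1 cabs_real ger0_norm. Qed.

Lemma holo_on_scale (rho : R) F F' : 0 <= rho -> holo_on rho F F' ->
  holo_on 1 (fun z => F (rho%:C * z)) (fun z => F' (rho%:C * z) * rho%:C).
Proof.
move=> r0 FF; have h : holo_on 1 (fun z => rho%:C * z) (fun=> rho%:C).
  apply: eq_holo_on (holo_onZ rho%:C ler01 (holo_on_id 1)) => // z _.
  by rewrite mulr1.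
apply: (holo_on_comp ler01 r0 _ FF h) => z z1.
by rewrite cabsM cabs_real ger0_norm// ler_piMr.
Qed.

Lemma quad_product (A A' a B B' b : C) (h K1 K2 E M N L : R) :
  cabs (A' - A - h%:C * a) <= K1 * h ^+ 2 ->
  cabs (B' - B - h%:C * b) <= K2 * h ^+ 2 -> cabs a <= E -> cabs B' <= M ->
  cabs A <= N -> cabs (B' - B) <= L * `|h| ->
  cabs (A' * B' - A * B - h%:C * (a * B + A * b)) <= (K1 * M + E * L + N * K2) * h ^+ 2.
Proof.
move=> HA HB aE BM AN BL.
have -> : A' * B' - A * B - h%:C * (a * B + A * b) =
  (A' - A - h%:C * a) * B' + h%:C * a * (B' - B) + A * (B' - B - h%:C * b) by ring.
rewrite (le_trans (ler_cabsD _ _))// [leRHS]mulrDl lerD//; last first.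
  by rewrite cabsM -mulrA ler_pM ?cabs_ge0.
rewrite (le_trans (ler_cabsD _ _))// [leRHS]mulrDl lerD//.
  by rewrite cabsM mulrAC ler_pM ?cabs_ge0.
have -> : E * L * h ^+ 2 = E * `|h| * (L * `|h|).
  by rewrite -[h ^+ 2]real_normK ?num_real//; ring.
rewrite !cabsM cabs_real ler_pM ?mulr_ge0 ?cabs_ge0//.
by rewrite mulrC ler_wpM2r.
Qed.

Lemma clip_circle (rho : R) F F' : 0 <= rho -> holo_on rho F F' ->
  clip (fun x => F (rho%:C * cis x)).
Proof.
move=> r0 FF; apply: (clip_comp r0 _ FF) => [x|]; first by rewrite cabs_rcis.
by apply: clipZ; exact: clip_cis.
Qed.

Lemma clip_circle_deriv (rho : R) F F' : 0 <= rho -> holo_on rho F F' ->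
  clip (fun x => F' (rho%:C * cis x)).
Proof.
move=> r0 FF; apply: (clip_comp_deriv r0 _ FF) => [x|]; first by rewrite cabs_rcis.
by apply: clipZ; exact: clip_cis.
Qed.

(* In terms of Taylor coefficients, both sides are sum |a_n|^2 c^(2n). *)
Lemma mean_energy F F' r c : 0 < c -> c <= r -> holo_on r F F' ->
  cmean (fun x => F (r%:C * cis x) * (F ((c ^+ 2 / r)%:C * cis x))^*%C) =
  cmean (fun x => F (c%:C * cis x) * (F (c%:C * cis x))^*%C).
Proof.
move=> c0 cr FF; have r0 : 0 < r := lt_le_trans c0 cr; have r0' := ltW r0.
pose U s x := F (s%:C * cis x); pose U1 s x := F' (s%:C * cis x) * cis x.
have Uc s : 0 <= s <= r -> clip (U s).
  by move=> /andP[s0 sr]; exact: clip_circle s0 (holo_onS sr FF).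
have U1c s : 0 <= s <= r -> clip (U1 s).
  move=> /andP[s0 sr]; apply: clipM; last exact: clip_cis.
  exact: clip_circle_deriv s0 (holo_onS sr FF).
have Uq s : 0 <= s <= r -> rquad (U s) (fun x => s%:C * 'i%C * U1 s x).
  move=> /andP[s0 sr].
  have q : rquad (fun x => s%:C * cis x) (fun x => s%:C * ('i%C * cis x) : C).
    have [L L0 cL] := rquad_cis R; exists (`|s| * L); first by rewrite mulr_ge0.
    move=> x y.
    have -> : s%:C * cis y - s%:C * cis x - s%:C * ('i%C * cis x) * (y - x)%:C =
      s%:C * (cis y - cis x - 'i%C * cis x * (y - x)%:C) by ring.
    by rewrite cabsM cabs_real -[leRHS]mulrA ler_wpM2l.
  have sc : clip (fun x => s%:C * cis x : C) by apply: clipZ; exact: clip_cis.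
  have := rquad_comp s0 (fun x => _) sc (holo_onS sr FF) q.
  have -> : (fun x => F' (s%:C * cis x) * (s%:C * ('i%C * cis x))) =
      (fun x => s%:C * 'i%C * U1 s x) by apply/funext => x; rewrite /U1; ring.
  by apply => x; rewrite cabs_rcis.
have [K K0 FK] := FF.
have [B0 B00 FB] := holo_on_bound r0' FF.
have [B1 B10 FB1] := holo_on_deriv_bound r0' FF.
have [L L0 FL] := holo_on_lip r0' FF.
have ur s x : 0 <= s <= r -> cabs (s%:C * cis x : C) <= r.
  by move=> /andP[s0 sr]; rewrite cabs_rcis.
have UK s t x : 0 <= s <= r -> 0 <= t <= r ->
    cabs (U t x - U s x - (t - s)%:C * U1 s x) <= K * (t - s) ^+ 2.
  move=> sr tr; have := FK _ _ (ur s x sr) (ur t x tr).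
  have -> : t%:C * cis x - s%:C * cis x = (t - s)%:C * cis x :> C.
    by rewrite rmorphB /= mulrBl.
  rewrite [cabs (_%:C * _)]cabsM cabs_cis mulr1 cabs_real real_normK ?num_real//.
  by rewrite /U /U1 [_%:C * (_ * _)]mulrCA.
have UL s t x : 0 <= s <= r -> 0 <= t <= r -> cabs (U t x - U s x) <= L * `|t - s|.
  move=> sr tr; have := FL _ _ (ur s x sr) (ur t x tr).
  by rewrite -mulrBl -rmorphB cabsM cabs_cis mulr1 cabs_real.
have UB s x : 0 <= s <= r -> cabs (U s x) <= B0 by move=> sr; rewrite FB ?ur.
have UB1 s x : 0 <= s <= r -> cabs (U1 s x) <= B1.
  by move=> sr; rewrite cabsM cabs_cis mulr1 FB1 ?ur.
pose p := c ^+ 2.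
have p0 : 0 < p by rewrite exprn_gt0.
have gt s : c <= s <= r -> 0 < s by move=> /andP[/(lt_le_trans c0)].
have sr s : c <= s <= r -> 0 <= s <= r.
  by move=> csr; rewrite ltW ?gt//=; case/andP: csr.
have psr s : c <= s <= r -> 0 <= p / s <= r.
  move=> csr; have s0 := gt _ csr; rewrite divr_ge0 ?(ltW p0) ?(ltW s0)//=.
  rewrite ler_pdivrMr// /p expr2.
  by case/andP: csr => cs _; rewrite ler_pM// ltW.
(* The two radii keep the product [c ^+ 2]. With [V] the derivative of [W] in s, the angular
   derivative of [W] is i s [V], which forces the mean of [V] to vanish. *)
pose W s x := U s x * (U (p / s) x)^*%C.
pose V s x := U1 s x * (U (p / s) x)^*%C + U s x * ((- (p / s ^+ 2))%:C * (U1 (p / s) x)^*%C).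
have Wc s : c <= s <= r -> clip (W s).
  by move=> csr; apply: clipM; [exact: Uc (sr _ _)|apply: clip_conj; exact: Uc (psr _ _)].
have Vc s : c <= s <= r -> clip (V s).
  move=> csr; apply: clipD; apply: clipM.
  - exact: U1c (sr _ _).
  - by apply: clip_conj; exact: Uc (psr _ _).
  - exact: Uc (sr _ _).
  - by apply: clipZ; apply: clip_conj; exact: U1c (psr _ _).
have -> : cmean (fun x => F (c%:C * cis x) * (F (c%:C * cis x))^*%C) = cmean (W c).
  apply: eq_cmean => x _; rewrite /W /U /p expr2 mulfK// gt_eqF//.
rewrite [LHS](_ : _ = cmean (W r))//.
rewrite -(@cmean_param_const _ W V c r (K * B0 + B1 * L + B0 * (K + B1 / c)) cr)//.
- by rewrite !addr_ge0 ?mulr_ge0 ?addr_ge0 ?divr_ge0// ltW.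
- by move=> s csr; apply: clip_int; exact: Wc.
- by move=> s csr; apply: clip_int; exact: Vc.
- move=> s csr; have s0 := gt _ csr.
  have h := rquadM (Uc _ (sr _ csr)) (clipZ _ (U1c _ (sr _ csr)))
    (clip_conj (Uc _ (psr _ csr))) (Uq _ (sr _ csr)) (rquad_conj (Uq _ (psr _ csr))).
  have E : (fun x => s%:C * 'i%C * U1 s x * (U (p / s) x)^*%C +
      U s x * ((p / s)%:C * 'i%C * U1 (p / s) x)^*%C) = (fun x => s%:C * 'i%C * V s x).
    apply/funext => x; have -> : ((p / s)%:C * 'i%C * U1 (p / s) x)^*%C =
        - (p / s)%:C * 'i%C * (U1 (p / s) x)^*%C.
      by rewrite -mulrA conj_realM conj_iM; ring.
    have -> : (p / s)%:C = s%:C * (p / s ^+ 2)%:C :> C.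
      by rewrite -rmorphM /=; congr _%:C; field; rewrite gt_eqF.
    rewrite /V rmorphN /=; ring.
  have := @cmean_deriv _ _ _ h; rewrite E => H.
  have /eqP : s%:C * 'i%C * cmean (V s) = 0.
    rewrite -(cmeanZ _ (clip_int (Vc _ csr))); apply: H.
      by apply: clipZ; exact: Vc.
    by rewrite /U cis0 cis2pi.
  by rewrite !mulf_eq0 -cabs_eq0 cabs_real normr_eq0 (gt_eqF s0)
    -cabs_eq0 cabs_i oner_eq0 => /eqP.
- move=> s t x csr ctr _; have s0 := gt _ csr; have t0 := gt _ ctr.
  have [cs ct] : c <= s /\ c <= t by case/andP: csr ctr => ? _ /andP[].
  have cst : c ^+ 2 <= s * t by rewrite expr2; exact: ler_pM (ltW c0) (ltW c0) cs ct.
  have pst : `|p / t - p / s| <= `|t - s|.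
    have -> : p / t - p / s = - (p / (s * t)) * (t - s).
      by field; rewrite !gt_eqF.
    rewrite normrM ler_piMl// normrN ger0_norm ?divr_ge0 ?mulr_ge0 ?(ltW c0) ?(ltW p0) ?(ltW s0) ?(ltW t0)//.
    by rewrite ler_pdivrMr ?mulr_gt0// mul1r.
  apply: quad_product.
  + by apply: UK; apply: sr.
  + have -> : (U (p / t) x)^*%C - (U (p / s) x)^*%C -
       (t - s)%:C * ((- (p / s ^+ 2))%:C * (U1 (p / s) x)^*%C) =
      ((U (p / t) x - U (p / s) x - (p / t - p / s)%:C * U1 (p / s) x) +
       (p / (s ^+ 2 * t) * (t - s) ^+ 2)%:C * U1 (p / s) x)^*%C.
      rewrite conjcD !conjcB !conj_realM.
      have -> : (p / (s ^+ 2 * t) * (t - s) ^+ 2)%:C =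
         (p / t - p / s)%:C - (t - s)%:C * (- (p / s ^+ 2))%:C :> C.
        by rewrite -rmorphM -rmorphB /=; congr _%:C; field; rewrite !gt_eqF.
      ring.
    rewrite cabs_conj (le_trans (ler_cabsD _ _))// mulrDl lerD//.
      rewrite (le_trans (UK _ _ _ _ _)) ?psr// ler_wpM2l//.
      by rewrite -real_normK ?num_real// -[leRHS]real_normK ?num_real// ler_pXn2r ?nnegrE.
    rewrite cabsM cabs_real normrM (ger0_norm (sqr_ge0 _)) mulrC mulrA.
    rewrite ler_wpM2r ?sqr_ge0// ler_pM ?cabs_ge0 ?UB1 ?psr//.
    have -> : p / (s ^+ 2 * t) = p / (s * t) * s^-1.
      by field; rewrite !gt_eqF.
    rewrite ger0_norm; last by rewrite !mulr_ge0 ?invr_ge0 ?mulr_ge0 ?ltW.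
    rewrite -[leRHS]mul1r ler_pM ?invr_ge0 ?divr_ge0 ?mulr_ge0 ?(ltW c0) ?(ltW p0) ?(ltW s0) ?(ltW t0)//.
      by rewrite ler_pdivrMr ?mulr_gt0// mul1r.
    by rewrite lef_pV2.
  + exact: UB1 (sr _ _).
  + by rewrite cabs_conj UB ?psr.
  + exact: UB (sr _ _).
  + rewrite -rmorphB cabs_conj (le_trans (UL _ _ _ _ _)) ?psr// ler_wpM2l//.
Qed.

End Energy.

(** * Energy on circles and convergent sequences of radii *)

Section RadialLimits.
Variable R : realType.
Local Notation C := R[i].
Local Notation mu := (@lebesgue_measure R).
Local Notation D := (`[0, 2 * pi]%classic : set R).
Implicit Types (z w : C) (x r s t c : R) (F G : C -> C).

Lemma cvg_complexP (T : Type) (A : set_system T) {FA : Filter A} (f : T -> C) (l : C) :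
  (f @ A --> l) <-> ((fun k => complex.Re (f k)) @ A --> complex.Re l) /\
                    ((fun k => complex.Im (f k)) @ A --> complex.Im l).
Proof.
split=> [/cvgC fl|[/cvgrPdist_lt rl /cvgrPdist_lt il]].
  split; apply/cvgrPdist_lt => e e0; apply: filterS (fl _ e0) => t; apply: le_lt_trans.
    by rewrite distrC -ReB ler_Re_cabs.
  by rewrite distrC -ImB ler_Im_cabs.
apply/cvgC => e e0; have e2 : 0 < e / 2 by rewrite divr_gt0.
apply: filterS2 (rl _ e2) (il _ e2) => t rt it.
rewrite (le_lt_trans (ler_cabs_ReIm _))// ReB ImB distrC [X in _ + X]distrC.
by rewrite (splitr e) ltrD.
Qed.

Lemma rmean_integral (f : R -> R) : rint f -> (\int[mu]_(x in D) (f x)%:E)%E = (2 * pi * rmean f)%:E.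
Proof.
move=> fi; rewrite /rmean mulrA divff ?gt_eqF ?twopi_gt0// mul1r /Rintegral fineK//.
exact: (@integrable_fin_num _ _ _ mu D _ _ fi).
Qed.

Lemma rmean_dct (f_ : nat -> R -> R) (f g : R -> R) : (forall n, measurable_fun D (f_ n)) ->
  measurable_fun D f -> rint g -> (forall n x, D x -> `|f_ n x| <= g x) ->
  {ae mu, forall x, D x -> f_ n x @[n --> \oo] --> f x} ->
  rint f /\ rmean (f_ n) @[n --> \oo] --> rmean f.
Proof.
move=> mf_ mf ig fg cf.
have [|||||] := @dominated_convergence _ _ R mu D (@measurable_circle R)
  (fun n => EFin \o f_ n) (EFin \o f) (EFin \o g).
- by move=> n; exact: measurable_EFin (mf_ n).
- exact: measurable_EFin mf.
- by apply: ae_imp cf => x fx Dx; apply: cvg_EFin; [exact: nearW|exact: fx].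
- exact: ig.
- by apply: aeW => x n Dx; rewrite /= lee_fin fg.
move=> fi _ h; split=> //.
have h2 := fine_cvg (_ : _ --> (fine (\int[mu]_(x in D) (f x)%:E))%:E).
apply: cvgM; first exact: cvg_cst.
apply: h2; rewrite fineK; first exact: h.
exact: (@integrable_fin_num _ _ _ mu D _ _ fi).
Qed.

Lemma cmean_dct (u_ : nat -> R -> C) (u : R -> C) (g : R -> R) : (forall n, cmeas (u_ n)) ->
  cmeas u -> rint g -> (forall n x, D x -> cabs (u_ n x) <= g x) ->
  {ae mu, forall x, D x -> u_ n x @[n --> \oo] --> u x} ->
  cint u /\ cmean (u_ n) @[n --> \oo] --> cmean u.
Proof.
move=> mu_ [mr mi] ig ug cu.
have [a b] := @rmean_dct (fun n x => complex.Re (u_ n x)) (fun x => complex.Re (u x)) g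
  (fun n => (mu_ n).1) mr ig (fun n x Dx => le_trans (ler_Re_cabs _) (ug n x Dx))
  (ae_imp (fun x h Dx => ((cvg_complexP _ _).1 (h Dx)).1) cu).
have [c d] := @rmean_dct (fun n x => complex.Im (u_ n x)) (fun x => complex.Im (u x)) g
  (fun n => (mu_ n).2) mi ig (fun n x Dx => le_trans (ler_Im_cabs _) (ug n x Dx))
  (ae_imp (fun x h Dx => ((cvg_complexP _ _).1 (h Dx)).2) cu).
by split=> //; apply/cvg_complexP.
Qed.

Definition bounded_by F (M : R) := forall z, cabs z < 1 -> cabs (F z) <= M.

Definition energy F r : R := rmean (fun x => cabs (F (r%:C * cis x)) ^+ 2).

Section Energy.
Variables (F F' : C -> C) (M : R).
Hypotheses (FF : holo F F') (FM : bounded_by F M).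

Let M0 : 0 <= M.
Proof. by rewrite (le_trans (cabs_ge0 (F 0)))// FM// cabs0. Qed.

Let Fc r : 0 < r < 1 -> clip (fun x => F (r%:C * cis x)).
Proof. by move=> /andP[/ltW r0 r1]; exact: clip_circle r0 (FF r0 r1). Qed.

Let Fr r x : 0 < r < 1 -> cabs (F (r%:C * cis x)) <= M.
Proof. by move=> /andP[/ltW r0 r1]; rewrite FM// cabs_rcis. Qed.

Let mFr r s : 0 < r < 1 -> 0 < s < 1 ->
  measurable_fun D (fun x => cabs (F (r%:C * cis x) - F (s%:C * cis x))).
Proof. by move=> r1 s1; exact: cmeas_cabs (clip_meas (clipB (Fc r1) (Fc s1))). Qed.

Let rint_sq r : 0 < r < 1 -> rint (fun x => cabs (F (r%:C * cis x)) ^+ 2).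
Proof.
move=> r1; apply: (@rint_bounded _ _ (M ^+ 2)).
  exact: measurable_funX (cmeas_cabs (clip_meas (Fc r1))).
by move=> x _; rewrite ger0_norm ?sqr_ge0// ler_pXn2r ?nnegrE ?cabs_ge0 ?Fr.
Qed.

Let energy_le r : 0 < r < 1 -> 0 <= energy F r <= M ^+ 2.
Proof.
move=> r1; rewrite rmean_ge0 => [|x _]; last exact: sqr_ge0.
rewrite -[leRHS]rmean_cst; apply: ler_rmean; [exact: rint_sq|exact: rint_cst|].
by move=> x _; rewrite ler_pXn2r ?nnegrE ?cabs_ge0 ?Fr.
Qed.

(** Expanding the square leaves a cross term, whose mean is the energy at the geometric mean [c] of
    the two radii. *)
Let energy_diff r c : 0 < c -> c <= r -> r < 1 ->
  rmean (fun x => cabs (F (r%:C * cis x) - F ((c ^+ 2 / r)%:C * cis x)) ^+ 2) =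
  energy F r + energy F (c ^+ 2 / r) - 2 * energy F c.
Proof.
move=> c0 cr r1; have r0 := lt_le_trans c0 cr.
have rr : 0 < r < 1 by rewrite r0.
have cc : 0 < c < 1 by rewrite c0 (le_lt_trans cr).
have ss : 0 < c ^+ 2 / r < 1.
  rewrite divr_gt0 ?exprn_gt0//= (le_lt_trans _ (le_lt_trans cr r1))//.
  by rewrite ler_pdivrMr// expr2 ler_pM2l.
set s := c ^+ 2 / r; have mE := mean_energy c0 cr (FF (ltW r0) r1).
pose u x := F (r%:C * cis x) * (F (s%:C * cis x))^*%C.
have uc : cint u := clip_int (clipM (Fc rr) (clip_conj (Fc ss))).
have E x : cabs (F (r%:C * cis x) - F (s%:C * cis x)) ^+ 2 =
  (cabs (F (r%:C * cis x)) ^+ 2 + cabs (F (s%:C * cis x)) ^+ 2) +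
   (- 2) * complex.Re (u x).
  rewrite /u; case: (F (r%:C * cis x)) (F (s%:C * cis x)) => a b [d e].
  by rewrite !cabs2 /=; ring.
rewrite (eq_rmean (fun x _ => E x)).
have i2 : rint (fun x => -2 * complex.Re (u x)) by apply: rintZ; case: uc.
rewrite (rmeanD (rintD (rint_sq rr) (rint_sq ss)) i2) (rmeanD (rint_sq rr) (rint_sq ss)).
rewrite (rmeanZ _ uc.1) mulNr -/(energy F r) -/(energy F s); congr (_ - 2 * _).
move: mE => /(congr1 (@complex.Re R)); rewrite [LHS]/= -/s => ->; rewrite /=.
by apply: eq_rmean => x _; rewrite mul_conj.
Qed.

Let energy_mid r c : 0 < c -> c <= r -> r < 1 ->
  2 * energy F c <= energy F r + energy F (c ^+ 2 / r).
Proof.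
move=> c0 cr r1; rewrite -subr_ge0 -energy_diff//.
by apply: rmean_ge0 => x _; exact: sqr_ge0.
Qed.

(* Midpoint convexity in log r together with boundedness forces monotonicity. *)
Lemma energy_mono r s : 0 < s -> s <= r -> r < 1 -> energy F s <= energy F r.
Proof.
move=> s0 sr r1; rewrite leNgt; apply/negP => rs.
set d := energy F s - energy F r; have d0 : 0 < d by rewrite subr_gt0.
have r0 := lt_le_trans s0 sr.
pose q := s / r; have q0 : 0 < q by rewrite divr_gt0.
have q1 : q <= 1 by rewrite ler_pdivrMr// mul1r.
(* Here [t 0 = r], [t 1 = s], and each radius is the geometric mean of its neighbours. By midpoint
   convexity the energy would grow by at least [d] at each step towards the centre and exceed
   [M ^+ 2]. *)
pose t k := r * q ^+ k.
have t0 k : 0 < t k by rewrite mulr_gt0// exprn_gt0.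
have t1 k : t k < 1 by rewrite (le_lt_trans _ r1)// ler_piMr ?(ltW r0)// exprn_ile1// ltW.
have t01 k : 0 < t k < 1 by rewrite t0 t1.
have tS k : t k.+1 <= t k by rewrite /t exprS mulrCA ler_piMl// ltW// t0.
have inc k : d <= energy F (t k.+1) - energy F (t k).
  elim: k => [|k IH]; first by rewrite /t expr0 expr1 mulr1 /q mulrCA divff ?gt_eqF ?mulr1.
  have := energy_mid (t0 k.+1) (tS k) (t1 k).
  have -> : t k.+1 ^+ 2 / t k = t k.+2.
    rewrite /t !exprS; field; rewrite (gt_eqF r0) expf_neq0 ?gt_eqF//.
  by move=> h; rewrite (le_trans IH)//; lra.
have lin k : k%:R * d <= energy F (t k).
  elim: k => [|k IH].
    by rewrite mul0r; have /andP[] := energy_le (t01 0).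
  rewrite -addn1 natrD mulrDl mul1r addn1; move: (inc k) IH; lra.
pose k := Num.truncn (M ^+ 2 / d).
have /andP[_] := energy_le (t01 k.+1); apply/negP; rewrite -ltNge (lt_le_trans _ (lin _))//.
by rewrite -ltr_pdivrMr// truncnS_gt.
Qed.

Lemma energy_diff_le r s : 0 < s -> s <= r -> r < 1 ->
  rmean (fun x => cabs (F (r%:C * cis x) - F (s%:C * cis x)) ^+ 2) <=
  energy F r - energy F s.
Proof.
move=> s0 sr r1; have r0 := lt_le_trans s0 sr.
(* With this [c] the radius [c ^+ 2 / r] is [s], and monotonicity replaces the energy at [c] by the
   one at [s]. *)
pose c := Num.sqrt (s * r).
have c2 : c ^+ 2 = s * r by rewrite sqr_sqrtr// mulr_ge0 ?ltW.
have c0 : 0 < c by rewrite sqrtr_gt0 mulr_gt0.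
have cr : c <= r.
  by rewrite -(ler_pXn2r (n := 2)) ?nnegrE ?(ltW c0) ?(ltW r0)// c2 expr2 ler_pM2r.
have sc : s <= c.
  by rewrite -(ler_pXn2r (n := 2)) ?nnegrE ?(ltW c0) ?(ltW s0)// c2 expr2 ler_pM2l.
have := energy_diff c0 cr r1; rewrite c2 mulfK ?gt_eqF// => ->.
have := energy_mono s0 sc (le_lt_trans cr r1); lra.
Qed.

(** The energy is bounded and nondecreasing, so radii whose energies lie within 4^-n of the supremum
    have increments of L2 norm at most 2^-n. Their L1 norms are then summable. *)
Lemma radial_sequence : exists rho : nat -> R,
  [/\ forall n, 0 < rho n < 1, forall n, 1 - n.+2%:R^-1 <= rho n &
   forall n, rmean (fun x => cabs (F ((rho n.+1)%:C * cis x) - F ((rho n)%:C * cis x)))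
     <= 2 * (2^-1) ^+ n].
Proof.
pose E := [set energy F r | r in [set r | 0 < r < 1]].
have h2 : 0 < (2^-1 : R) < 1 by rewrite invr_gt0 ltr0n invf_lt1 ?ltr0n ?ltr1n.
have hE : has_sup E.
  split; first by exists (energy F 2^-1); exists 2^-1.
  by exists (M ^+ 2) => _ [r /energy_le/andP[_ ?] <-].
have Esup r : 0 < r < 1 -> energy F r <= sup E.
  by move=> r1; apply: (ub_le_sup hE.2); exists r.
have /choice[rho rhoP] : forall n : nat, exists r : R,
    [/\ 0 < r < 1, 1 - n.+2%:R^-1 <= r & sup E - (4^-1) ^+ n < energy F r].
  move=> n.
  have e0 : 0 < (4^-1 : R) ^+ n by rewrite exprn_gt0// invr_gt0.
  have [_ [r /andP[r0 r1] <-] rE] := sup_adherent e0 hE.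
  (* Enlarging the radius keeps the energy close to the supremum and forces the radii to tend to
     1. *)
  exists (Num.max r (1 - n.+2%:R^-1)).
  have m0 : 0 < Num.max r (1 - n.+2%:R^-1) by rewrite lt_max r0.
  have m1 : Num.max r (1 - n.+2%:R^-1) < 1.
    by rewrite gt_max r1 ltrBlDr ltrDl invr_gt0 ltr0n.
  split; first by rewrite m0.
    by rewrite le_max lexx orbT.
  by rewrite (lt_le_trans rE)// energy_mono// le_max lexx.
exists rho; split=> [n|n|n]; [by case: (rhoP n)|by case: (rhoP n)|].
have [a1 _ a3] := rhoP n; have [b1 _ b3] := rhoP n.+1.
set f := fun x => cabs _.
have mf : measurable_fun D f by exact: mFr.
have f0 x : 0 <= f x by exact: cabs_ge0.
have fB x : f x <= M + M by rewrite (le_trans (ler_cabsB _ _))// lerD ?Fr.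
have fi : rint f by apply: (@rint_bounded _ _ (M + M)) => // x _; rewrite ger0_norm.
have f2i : rint (fun x => f x ^+ 2).
  apply: (@rint_bounded _ _ ((M + M) ^+ 2)); first exact: measurable_funX.
  by move=> x _; rewrite ger0_norm ?sqr_ge0// ler_pXn2r ?nnegrE ?addr_ge0.
have e4 k : (4^-1 : R) ^+ k = 2^-1 ^+ k * 2^-1 ^+ k.
  by rewrite -exprMn -invfM -natrM.
have f2 : rmean (fun x => f x ^+ 2) <= (4^-1) ^+ n.
  have Sa := Esup _ a1; have Sb := Esup _ b1.
  have p : (4^-1 : R) ^+ n.+1 <= (4^-1) ^+ n.
    by rewrite exprS ler_piMl ?exprn_ge0 ?invr_ge0// invf_le1 ?ler1n ?ltr0n.
  have /andP[a0 a1'] := a1; have /andP[b0 b1'] := b1.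
  have [rr|/ltW rr] := lerP (rho n) (rho n.+1).
    by rewrite (le_trans (energy_diff_le a0 rr b1'))//; lra.
  have -> : rmean (fun x => f x ^+ 2) = rmean (fun x =>
      cabs (F ((rho n)%:C * cis x) - F ((rho n.+1)%:C * cis x)) ^+ 2).
    by apply: eq_rmean => x _; rewrite /f cabsBC.
  by rewrite (le_trans (energy_diff_le b0 rr a1'))//; lra.
have p2 : 0 < (2 : R) ^+ n by rewrite exprn_gt0.
(* Either [f x] is at most 2^-n, or [2 ^+ n * f x] exceeds 1. This passes from squares to the
   function itself and takes the place of the Cauchy-Schwarz inequality. *)
have AM x : f x <= 2 ^+ n * f x ^+ 2 + 2^-1 ^+ n.
  have -> : 2^-1 ^+ n = (2 ^+ n)^-1 :> R by rewrite exprVn.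
  have := f0 x; move: (f x) => y y0.
  have [yn|yn] := lerP y (2 ^+ n)^-1.
    by rewrite (le_trans yn)// lerDr mulr_ge0 ?sqr_ge0// ltW.
  rewrite (@le_trans _ _ (2 ^+ n * y ^+ 2))//; last first.
    by rewrite lerDl invr_ge0 ltW.
  rewrite expr2 mulrA ler_peMl// mulrC -ler_pdivrMr// mul1r ltW//.
have iZ := rintZ (2 ^+ n) f2i; have ic := rint_cst ((2^-1 : R) ^+ n).
apply: le_trans (ler_rmean fi (rintD iZ ic) (fun x _ => AM x)) _.
rewrite (rmeanD iZ ic) (rmeanZ _ f2i) rmean_cst.
rewrite mulr2n mulrDl mul1r lerD2r (le_trans (ler_wpM2l (ltW p2) f2))//.
by rewrite e4 mulrA -exprMn divff// expr1n mul1r.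
Qed.

End Energy.

End RadialLimits.

(** * Boundary functions and their Poisson integrals *)

Section BoundaryFunction.
Variable R : realType.
Local Notation C := R[i].
Local Notation mu := (@lebesgue_measure R).
Local Notation D := (`[0, 2 * pi]%classic : set R).
Implicit Types (z w : C) (x r s t c : R).

Lemma bounded_variation_cvg (a : nat -> R) (B : R) :
  (forall n, \sum_(0 <= k < n) `|a k.+1 - a k| <= B) -> cvgn a.
Proof.
move=> aB; have h : cvgn [normed series (telescope a)].
  apply: nondecreasing_is_cvgn.
    by apply: nondecreasing_series => n _ _; exact: normr_ge0.
  by exists B => _ [n _ <-]; exact: aB.
have := normed_cvg h; rewrite telescopeK => c.
have -> : a = (fun n => (a n - a 0%N) + a 0%N) by apply/funext => n; rewrite subrK.
by apply: is_cvgD => //; exact: is_cvg_cst.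
Qed.

Lemma natSinv_cvg1 (rho : nat -> R) : (forall n, 0 < rho n < 1) ->
  (forall n, 1 - n.+2%:R^-1 <= rho n) ->
  forall e, 0 < e -> \forall n \near \oo, 1 - rho n < e.
Proof.
move=> r1 rn e e0; have := near_infty_natSinv_lt (PosNum e0).
apply: filterS => n /= ne; rewrite (le_lt_trans _ ne)// lerBlDr -lerBlDl.
rewrite (le_trans _ (rn n))// lerB// lef_pV2 ?posrE ?ltr0n//.
by rewrite ler_nat.
Qed.

(** By monotone convergence the sum of the series is integrable, its mean being at most 4, hence it
    is finite almost everywhere. *)
Lemma summable_means (f : nat -> R -> R) : (forall n, rint (f n)) ->
  (forall n x, 0 <= f n x) -> (forall n, rmean (f n) <= 2 * (2^-1) ^+ n) ->
  {ae mu, forall x, D x -> exists B, forall n, \sum_(0 <= k < n) f k x <= B}.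
Proof.
move=> fi f0 fm.
have mf n : measurable_fun D (EFin \o f n).
  by apply: measurable_EFin; exact: rint_measurable.
pose S x := (\sum_(n <oo) (f n x)%:E)%E.
have S0 x : (0 <= S x)%E by apply: nneseries_ge0 => n _ _; rewrite lee_fin.
have mS : measurable_fun D S.
  by apply: ge0_emeasurable_sum => [k x _ _|k _]; [rewrite lee_fin|exact: mf].
have geom n : \sum_(0 <= k < n) (2 * (2^-1) ^+ k : R) <= 4.
  have -> : \sum_(0 <= k < n) (2 * (2^-1) ^+ k : R) = 4 - 4 * 2^-1 ^+ n.
    elim: n => [|n IH]; first by rewrite big_geq// expr0 mulr1 subrr.
    by rewrite big_nat_recr//= IH exprS; field.
  by rewrite gerBl mulr_ge0// exprn_ge0// invr_ge0.
have SI : (\int[mu]_(x in D) S x < +oo)%E.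
  rewrite (@integral_nneseries _ _ R mu D (@measurable_circle R)
    (fun n x => (f n x)%:E)) => [|n|n x _].
  - apply: (@le_lt_trans _ _ ((2 * pi * 4)%:E)); last exact: ltry.
    apply: lime_le.
      apply: is_cvg_nneseries => n _ _; apply: integral_ge0 => x _.
      by rewrite lee_fin.
    apply: nearW => n; under eq_bigr do rewrite rmean_integral//.
    rewrite sumEFin lee_fin -mulr_sumr ler_wpM2l ?(ltW (twopi_gt0 R))//.
    by rewrite (le_trans _ (geom n))// ler_sum.
  - exact: mf.
  - by rewrite lee_fin.
have Sint : mu.-integrable D S.
  apply/integrableP; split => //.
  by under eq_integral do rewrite gee0_abs//.
have := @integrable_ae _ _ R mu D (@measurable_circle R) S Sint.
apply: (@ae_imp R) => x h Dx.
exists (fine (S x)) => n; rewrite -lee_fin fineK ?h// -sumEFin.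
by apply: nneseries_lim_ge => k _ _; rewrite lee_fin.
Qed.

Lemma boundary_function (F F' : C -> C) (M : R) : holo F F' -> bounded_by F M ->
  exists (u : R -> C) (rho : nat -> R), [/\ cint u,
    forall n, 0 < rho n < 1,
    forall e, 0 < e -> \forall n \near \oo, 1 - rho n < e,
    {ae mu, forall x, D x -> F ((rho n)%:C * cis x) @[n --> \oo] --> u x} &
    forall z, cabs z < 1 -> F z = cmean (fun x => u x * (pkernel z x)%:C)].
Proof.
move=> FF FM; have [rho [r1 rn rs]] := radial_sequence FF FM.
have rho1 := natSinv_cvg1 r1 rn.
have Fc n : clip (fun x => F ((rho n)%:C * cis x)).
  by have /andP[/ltW r0 r1'] := r1 n; exact: clip_circle r0 (FF _ r0 r1').
have FB n x : cabs (F ((rho n)%:C * cis x)) <= M.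
  by have /andP[/ltW r0 r1'] := r1 n; rewrite FM// cabs_rcis.
pose f n x := cabs (F ((rho n.+1)%:C * cis x) - F ((rho n)%:C * cis x)).
have fi n : rint (f n).
  by apply: cint_cabs; exact: clip_int (clipB (Fc _) (Fc _)).
have f0 n x : 0 <= f n x := cabs_ge0 _.
have sm := summable_means fi f0 rs.
pose a n x := complex.Re (F ((rho n)%:C * cis x)).
pose b n x := complex.Im (F ((rho n)%:C * cis x)).
(* The upper limits are measurable and defined for every x; they agree with the limits wherever
   these exist. *)
pose u x : C := limn_sup (a^~ x) +i* limn_sup (b^~ x).
have aB n x : `|a n x| <= M by rewrite (le_trans (ler_Re_cabs _)).
have bB n x : `|b n x| <= M by rewrite (le_trans (ler_Im_cabs _)).
have ub (g : nat -> R -> R) : (forall n x, `|g n x| <= M) -> forall x,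
    has_ubound (range (g^~ x)) /\ has_lbound (range (g^~ x)).
  move=> gM x; split; [exists M|exists (- M)] => _ [n _ <-].
    by have := gM n x; rewrite ler_norml => /andP[].
  by have := gM n x; rewrite ler_norml => /andP[].
have mFc n := clip_meas (Fc n).
have mu' : cmeas u.
  split; apply: measurable_fun_limn_sup.
  - by move=> x _; case: (ub a aB x).
  - by move=> x _; case: (ub a aB x).
  - by move=> n; case: (mFc n).
  - by move=> x _; case: (ub b bB x).
  - by move=> x _; case: (ub b bB x).
  - by move=> n; case: (mFc n).
have cu : {ae mu, forall x, D x -> F ((rho n)%:C * cis x) @[n --> \oo] --> u x}.
  apply: ae_imp sm => x h Dx; have [B SB] := h Dx.
  have ca : cvgn (a^~ x).
    apply: (@bounded_variation_cvg _ B) => n; apply: le_trans (SB n).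
    by apply: ler_sum => k _; rewrite /a -ReB ler_Re_cabs.
  have cb : cvgn (b^~ x).
    apply: (@bounded_variation_cvg _ B) => n; apply: le_trans (SB n).
    by apply: ler_sum => k _; rewrite /b -ImB ler_Im_cabs.
  apply/cvg_complexP; split => /=.
    by rewrite (cvg_limn_supE ca); exact: ca.
  by rewrite (cvg_limn_supE cb); exact: cb.
have [ui _] := cmean_dct mFc mu' (rint_cst M) (fun n x _ => FB n x) cu.
exists u, rho; split => // z z1.
have kc := clip_pkernel z1; have kg := rint_pkernel z1.
have ck : {ae mu, forall x, D x ->
    F ((rho n)%:C * cis x) * (pkernel z x)%:C @[n --> \oo] --> u x * (pkernel z x)%:C}.
  apply: ae_imp cu => x h Dx; apply/cvgC => e e0.
  have k0 : 0 < pkernel z x + 1.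
    by rewrite ltr_wpDl// pkernel_ge0// ltW.
  have /cvgC/(_ _ (divr_gt0 e0 k0)) := h Dx; apply: filterS => n.
  rewrite -mulrBl cabsM cabs_real ltr_pdivlMr//; apply: le_lt_trans.
  by rewrite ler_wpM2l ?cabs_ge0// ger0_norm ?pkernel_ge0 ?(ltW z1)// lerDl.
have kB n x : D x -> cabs (F ((rho n)%:C * cis x) * (pkernel z x)%:C) <= M * pkernel z x.
  move=> _; rewrite cabsM cabs_real ger0_norm ?pkernel_ge0 ?(ltW z1)//.
  by rewrite ler_wpM2r ?FB// pkernel_ge0// ltW.
have [_ cF] := cmean_dct (fun n => cmeasM (mFc n) (clip_meas kc))
  (cmeasM mu' (clip_meas kc)) (rintZ M kg) kB ck.
(* The dilations of F are analytic up to the circle, so Poisson's formula holds for them. Both of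
   its sides converge as the radii tend to 1. *)
have E : (fun n => cmean (fun x => F ((rho n)%:C * cis x) * (pkernel z x)%:C)) =
    (fun n => F ((rho n)%:C * z)).
  apply/funext => n; have /andP[/ltW r0 r1'] := r1 n.
  exact: poisson_formula (holo_on_scale r0 (FF _ r0 r1')) z1.
rewrite E in cF.
suff cz : (fun n => F ((rho n)%:C * z)) @ \oo --> F z.
  exact: (cvg_unique (@Chausdorff R) cz cF).
have [L L0 FL] := holo_on_lip (cabs_ge0 z) (FF _ (cabs_ge0 z) z1).
apply/cvgC => e e0; have L1 : 0 < L + 1 by rewrite ltr_wpDl.
apply: filterS (rho1 _ (divr_gt0 e0 L1)) => n re; have /andP[r0 r1'] := r1 n.
rewrite (le_lt_trans (FL _ _ _ _))//.
  by rewrite cabsM cabs_real gtr0_norm// ler_piMl ?cabs_ge0 ?ltW.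
have -> : (rho n)%:C * z - z = - ((1 - rho n)%:C * z) by rewrite rmorphB /=; ring.
rewrite cabsN cabsM cabs_real ger0_norm ?subr_ge0 ?ltW//.
rewrite ltr_pdivlMr// in re; apply: le_lt_trans re.
rewrite mulrCA ler_wpM2l ?subr_ge0 ?(ltW r1')//.
by rewrite (@le_trans _ _ L) ?lerDl// ler_piMr// ltW.
Qed.

End BoundaryFunction.

(** * Lebesgue points and nontangential limits of Poisson integrals *)

Section LebesguePoints.
Variable R : realType.
Local Notation C := R[i].
Local Notation mu := (@lebesgue_measure R).
Local Notation D := (`[0, 2 * pi]%classic : set R).
Implicit Types (z w : C) (x y r s t c : R).

Lemma rint_patch (f : R -> R) (A : set R) : measurable A -> rint f -> rint (f \_ A).
Proof.
move=> mA fi; apply: rint_le (rint_norm fi) _.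
  apply: (measurable_restrict _ mA (@measurable_circle R)).1.
  by apply: measurable_funS (rint_measurable fi); [exact: measurable_circle|move=> x []].
by move=> x _; rewrite patchE; case: ifP => // _; rewrite normr0.
Qed.

(** Lebesgue's condition in terms of [rmean]: the integral over the ball is compared with [t]
    instead of being divided by the length of the ball. *)
Definition lebesgue_mean_at (h : R -> R) x := forall e : R, 0 < e ->
  exists2 eta : R, 0 < eta & forall t, 0 < t -> t < eta ->
    rmean (h \_ (ball x t)) <= e * t.

Lemma lebesgue_mean_real (f : R -> R) : rint f ->
  {ae mu, forall x, D x -> lebesgue_mean_at (fun y => `|f y - f x|) x}.
Proof.
move=> fi; have := lebesgue_differentiation
  (integrable_locally_restrict (@measurable_circle R) fi).
apply: ae_imp => x h Dx e e0.
(* An average of e pi over a ball of length 2 t contributes e t once divided by 2 pi. *)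
have /fine_cvgP[hf /cvgrPdist_lt/(_ _ (mulr_gt0 e0 (pi_gt0 R)))] := h.
move=> hd; have [eta /= eta0 H] := (nbhs_ballP _ _).1 (filterI hf hd).
exists eta => // t t0 teta.
have [] := H t _ t0; first by rewrite /ball /= sub0r normrN gtr0_norm.
set d := davg _ _ _ => df; rewrite sub0r normrN => dlt.
have d0 : (0 <= d)%E by exact: davg_ge0.
have dE : (d <= (e * pi)%:E)%E.
  by rewrite -(fineK df) lee_fin; apply/ltW/(le_lt_trans (ler_norm _)).
have mball : measurable (ball x t) by exact: measurable_ball.
have muball : mu (ball x t) = (t *+ 2)%:E by exact: (lebesgue_measure_ball _ (ltW t0)).
pose g y := `|f y - f x|.
have gi : rint g by apply: rint_norm; apply: rintB => //; exact: rint_cst.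
have gpi := rint_patch mball gi.
have I : (\int[mu]_(y in D) ((g \_ (ball x t)) y)%:E <= (t *+ 2 * (e * pi))%:E)%E.
  have -> : (\int[mu]_(y in D) ((g \_ (ball x t)) y)%:E =
     \int[mu]_(y in D `&` ball x t) (g y)%:E)%E.
    rewrite [RHS]integral_mkcondr; apply: eq_integral => y _.
    by rewrite restrict_EFin.
  pose G y := `|(f \_ D) y - (f \_ D) x|.
  have gG y : D y -> g y = G y.
    by move=> Dy; rewrite /g /G !patchE !mem_set.
  have mG : measurable_fun setT G.
    apply: measurableT_comp => //; apply: measurable_funB => //.
    have := integrable_locally_restrict (@measurable_circle R) fi.
    by case.
  apply: (@le_trans _ _ (\int[mu]_(y in ball x t) (G y)%:E)%E).
    have -> : (\int[mu]_(y in D `&` ball x t) (g y)%:E =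
       \int[mu]_(y in D `&` ball x t) (G y)%:E)%E.
      by apply: eq_integral => y; rewrite inE => -[Dy _]; rewrite gG.
    apply: ge0_subset_integral => //.
    - by apply: measurableI => //; exact: measurable_circle.
    - exact: measurable_EFin (measurable_funTS mG).
    - by move=> y _; rewrite lee_fin; exact: normr_ge0.
  have -> : (\int[mu]_(y in ball x t) (G y)%:E = (t *+ 2)%:E * d)%E.
    rewrite /d /davg /iavg muball muleA.
    have t2 : t *+ 2 != 0 by rewrite mulrn_eq0/= gt_eqF.
    by rewrite inver (negbTE t2) -EFinM divff// mul1e.
  by rewrite EFinM lee_wpmul2l// lee_fin mulrn_wge0// ltW.
have := I; rewrite rmean_integral// lee_fin => I'.
rewrite -(ler_pM2l (twopi_gt0 R)) (le_trans I')//.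
rewrite le_eqVlt; apply/orP; left; apply/eqP; rewrite mulr2n; ring.
Qed.

Lemma lebesgue_mean_complex (u : R -> C) : cint u ->
  {ae mu, forall x, D x -> lebesgue_mean_at (fun y => cabs (u y - u x)) x}.
Proof.
move=> [ui vi]; apply: ae_imp (ae_and (lebesgue_mean_real ui) (lebesgue_mean_real vi)).
move=> x [hu hv] Dx e e0; have e2 : 0 < e / 2 by rewrite divr_gt0.
have [a a0 ha] := hu Dx _ e2; have [b b0 hb] := hv Dx _ e2.
exists (Num.min a b) => [|t t0]; first by rewrite lt_min a0.
rewrite lt_min => /andP[ta tb].
have mball : measurable (ball x t) by exact: measurable_ball.
have i1 := rint_patch mball (rint_norm (rintB ui (rint_cst (complex.Re (u x))))).
have i2 := rint_patch mball (rint_norm (rintB vi (rint_cst (complex.Im (u x))))).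
have i3 := rint_patch mball (cint_cabs (cintB (conj ui vi) (cint_cst (u x)))).
apply: le_trans (ler_rmean i3 (rintD i1 i2) _) _.
  move=> y _; rewrite !patchE; case: ifP => _; last by rewrite addr0.
  by rewrite (le_trans (ler_cabs_ReIm _))// ReB ImB.
by rewrite (rmeanD i1 i2) (splitr e) mulrDl lerD ?ha ?hb.
Qed.

Lemma cabs_cis_dist x y : cabs (cis y - cis x : C) ^+ 2 = 2 - 2 * cos (y - x).
Proof.
rewrite cabs2 /= cosB; have := cos2Dsin2 x; have := cos2Dsin2 y.
set a := cos x; set b := sin x; set c := cos y; set d := sin y => h1 h2.
have -> : (c - a) ^+ 2 + (d - b) ^+ 2 =
  (c ^+ 2 + d ^+ 2) + (a ^+ 2 + b ^+ 2) - 2 * (c * a + d * b) by ring.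
by rewrite h1 h2.
Qed.

(** The parameters 0 and 2 pi give the same point of the circle. The bounds on [eta] keep [|x - y|]
    at most 2 pi - eta, so y cannot approach x across that point. *)
Lemma chord_far x (eta : R) : 0 < eta -> eta <= x -> eta <= 2 * pi - x ->
  exists2 k : R, 0 < k & forall y, D y -> eta <= `|x - y| -> k <= cabs (cis y - cis x : C).
Proof.
move=> e0 ex ex2.
have epi : eta <= pi by lra.
have c1 : cos eta < 1.
  rewrite -[ltRHS](cos0 R) ltr_cos// in_itv/= ?lexx ?pi_ge0//.
  by rewrite ltW.
have k0 : 0 < 2 - 2 * cos eta by lra.
exists (Num.sqrt (2 - 2 * cos eta)); first by rewrite sqrtr_gt0.
move=> y; rewrite /= in_itv/= => /andP[y0 y2] xy.
rewrite -(ler_pXn2r (n := 2)) ?nnegrE ?cabs_ge0 ?sqrtr_ge0// sqr_sqrtr ?(ltW k0)//.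
rewrite cabs_cis_dist lerB// ler_pM2l//.
have -> : cos (y - x) = cos `|x - y|.
  have [h|h] := lerP 0 (x - y); first by rewrite (ger0_norm h) -cosN opprB.
  by rewrite (ltr0_norm h) opprB.
set s := `|x - y| in xy *.
have s2 : s <= 2 * pi - eta by rewrite ler_norml; apply/andP; split; lra.
have [spi|spi] := lerP s pi.
  rewrite leNgt ltr_cos ?in_itv/= ?epi ?(ltW e0)// ?spi ?(le_trans (ltW e0))//.
  by rewrite -leNgt.
have -> : cos s = cos (2 * pi - s).
  by rewrite -[in RHS]cosN opprB mulr_natl -[RHS](cosD2pi (s - pi *+ 2)) subrK.
rewrite leNgt ltr_cos ?in_itv/= ?epi ?(ltW e0)//.
  by rewrite -leNgt; lra.
by apply/andP; split; lra.
Qed.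

(** The sine of s is within s^2 of s, and s^2 is at most |s| / 2 on this range. *)
Lemma chord_near x y : `|x - y| <= 2^-1 -> `|x - y| / 2 <= cabs (cis y - cis x : C).
Proof.
move=> xy; have -> : cabs (cis y - cis x : C) = cabs (cis (y - x) - 1 : C).
  have -> : cis y - cis x = cis x * (cis (y - x) - 1) :> C.
    by rewrite -{1}(subrKC x y) (cisD x (y - x)); ring.
  by rewrite cabsM cabs_cis mul1r.
apply: le_trans (ler_Im_cabs _); rewrite /= subr0 distrC in xy *.
set s := y - x in xy *.
have h := ler_sinB s; have h2 : s ^+ 2 <= `|s| / 2.
  by rewrite -real_normK ?num_real// expr2 ler_wpM2l.
have := ler_normB (sin s) (sin s - s); rewrite opprB addrC subrK => h3.
lra.
Qed.

(** Serves to split the Poisson integral: s lies either below [d] or in a dyadic shell between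
    [2 ^+ j * d / 2] and [2 ^+ j * d]. *)
Lemma dyadic_scale (d s : R) J : 0 < d -> 0 <= s -> s < 2 ^+ J * d ->
  exists2 j, (j <= J)%N & s < 2 ^+ j * d /\ (j = 0%N \/ 2 ^+ j * d <= 2 * s).
Proof.
move=> d0 s0; elim: J => [|J IH] sJ; first by exists 0%N => //; split => //; left.
have [sj|sj] := ltP s (2 ^+ J * d).
  by have [j jJ h] := IH sj; exists j => //; exact: leqW.
by exists J.+1 => //; split => //; right; rewrite exprS -mulrA ler_pM2l.
Qed.

Lemma rmean_sum (n : nat) (a : nat -> R) (q : nat -> R -> R) :
  (forall j, rint (q j)) ->
  rint (fun y => \sum_(0 <= j < n) a j * q j y) /\
  rmean (fun y => \sum_(0 <= j < n) a j * q j y) = \sum_(0 <= j < n) a j * rmean (q j).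
Proof.
move=> qi; elim: n => [|n [i1 i2]].
  have -> : (fun y => \sum_(0 <= j < 0) a j * q j y) = fun=> 0.
    by apply/funext => y; rewrite big_geq.
  by rewrite rmean_cst big_geq//; split => //; exact: rint_cst.
have -> : (fun y => \sum_(0 <= j < n.+1) a j * q j y) =
    (fun y => \sum_(0 <= j < n) a j * q j y + a n * q n y).
  by apply/funext => y; rewrite big_nat_recr.
have i3 := rintZ (a n) (qi n); split; first exact: rintD.
by rewrite (rmeanD i1 i3) i2 rmeanZ// big_nat_recr.
Qed.

Lemma nontangential_filter (t : C) : Filter (nontangential t).
Proof.
split=> [M|A B hA hB M|A B AB hA M].
- exact: filterT.
- have := filterI (hA M) (hB M); exact.
- have /nbhsC[e e0 H] := hA M; apply/nbhsC; exists e => // w we ws.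
  by apply: AB; exact: H.
Qed.

Lemma stolz_near (t : C) (e : R) : cabs t = 1 -> 0 < e ->
  exists2 z, stolz t 1 z & cabs (z - t) < e.
Proof.
move=> t1 e0.
pose r : R := 1 - Num.min (e / 2) 2^-1.
have m0 : 0 < Num.min (e / 2) 2^-1 :> R by rewrite lt_min divr_gt0// invr_gt0 ltr0n.
have m1 : Num.min (e / 2) 2^-1 <= 2^-1 :> R by rewrite ge_min lexx orbT.
have me : Num.min (e / 2) 2^-1 < e.
  by rewrite gt_min [X in X || _](_ : _ = true)//; lra.
have r01 : 0 <= r by rewrite /r; lra.
have rt : cabs (r%:C * t) = r by rewrite cabsM t1 mulr1 cabs_real ger0_norm.
have rtt : cabs (r%:C * t - t) = 1 - r.
  have E (a : R) : a%:C * t - t = - ((1 - a)%:C * t) by rewrite rmorphB /=; ring.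
  by rewrite E cabsN cabsM t1 mulr1 cabs_real ger0_norm//; rewrite /r; lra.
exists (r%:C * t); last by rewrite rtt /r; lra.
by split; [apply/diskE; rewrite rt /r; lra|rewrite mul1r rtt rt].
Qed.

Lemma nontangential_proper (t : C) : cabs t = 1 -> ProperFilter (nontangential t).
Proof.
move=> t1; have FF := nontangential_filter t.
apply: Build_ProperFilter_ex => A /(_ 1)/nbhsC[e e0 hA].
by have [z z1 z2] := stolz_near t1 e0; exists z; exact: hA.
Qed.

Lemma pkernel_le z y : cabs z < 1 ->
  pkernel z y <= 2 * (1 - cabs z) / cabs (cis y - z) ^+ 2.
Proof.
move=> z1; rewrite ler_wpM2r ?invr_ge0 ?sqr_ge0//.
by have := cabs_ge0 z; nra.
Qed.

(** Let d = 1 - |z|. Away from x0 the kernel is O(d). Near x0 it is O(4^-j / d) on the shell of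
    radius 2^j d, while the Lebesgue condition makes the mean of |u - u x0| over that ball a small
    multiple of 2^j d; the products form a geometric series. *)
Lemma nontangential_poisson (u : R -> C) (F : C -> C) x0 : cint u ->
  (forall z, cabs z < 1 -> F z = cmean (fun x => u x * (pkernel z x)%:C)) ->
  0 < x0 -> x0 < 2 * pi -> lebesgue_mean_at (fun y => cabs (u y - u x0)) x0 ->
  F @ nontangential (cis x0) --> u x0.
Proof.
move=> ui FE x00 x02 hL; have NF := nontangential_filter (cis x0).
apply/cvgC => e e0 M'.
pose M := `|M'|; have M0 : 0 <= M by exact: normr_ge0.
pose K : R := 8 * (1 + M) ^+ 2.
have K1 : 8 <= K by rewrite /K; nra.
pose h y := cabs (u y - u x0).
have h0 y : 0 <= h y by exact: cabs_ge0.
have hi : rint h by apply: cint_cabs; apply: cintB => //; exact: cint_cst.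
(* A shell contributes at most (4 K / d) 4^-j times (e / (16 K)) 2^j d, that is (e / 4) 2^-j; all
   shells together give e / 2. *)
have e1 : 0 < e / (16 * K) by rewrite divr_gt0//; lra.
have [eta0 eta00 hE] := hL _ e1.
(* The largest ball may have radius 2 eta, which must stay below eta0; the bound 1/2 serves
   [chord_near], the last two serve [chord_far]. *)
pose eta := Num.min (Num.min (eta0 / 4) 2^-1) (Num.min x0 (2 * pi - x0)).
have eta_gt0 : 0 < eta.
  by rewrite /eta !lt_min divr_gt0// invr_gt0 ltr0n x00 subr_gt0 x02.
have eta4 : eta <= eta0 / 4 by rewrite /eta !ge_min lexx.
have eta2 : eta <= 2^-1 by rewrite /eta !ge_min lexx orbT.
have etax : eta <= x0 by rewrite /eta !ge_min lexx !orbT.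
have etax2 : eta <= 2 * pi - x0 by rewrite /eta !ge_min lexx !orbT.
have [k k0 hk] := chord_far eta_gt0 etax etax2.
pose A : R := 2 * (1 + M) ^+ 2 / k ^+ 2.
have A0 : 0 <= A by apply: divr_ge0; [apply: mulr_ge0|]; rewrite ?sqr_ge0.
have rh0 : 0 <= rmean h by exact: rmean_ge0.
pose d0 := Num.min eta (e / (2 * (A * rmean h + 1))).
have d00 : 0 < d0.
  by rewrite /d0 lt_min eta_gt0 divr_gt0// mulr_gt0// ltr_wpDl// mulr_ge0.
apply/nbhsC; exists d0 => // z zd [/diskE z1 zM].
set d := 1 - cabs z.
have dp : 0 < d by rewrite subr_gt0.
have dz : d < d0.
  rewrite (le_lt_trans _ zd)// cabsBC (le_trans _ (ler_dist_cabs _ _))//.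
  by rewrite cabs_cis.
have deta : d < eta by move: dz; rewrite lt_min => /andP[].
have dA : d * (A * rmean h) < e / 2.
  have : d < e / (2 * (A * rmean h + 1)) by move: dz; rewrite lt_min => /andP[].
  have B0 : 0 <= A * rmean h by rewrite mulr_ge0.
  rewrite ltr_pdivlMr; last by lra.
  by move=> hd; rewrite ltr_pdivlMr//; nra.
have zM2 : cabs (z - cis x0) <= M * d.
  by rewrite (le_trans zM)// ler_wpM2r ?(ltW dp)// ler_norm.
have ez y : d <= cabs (cis y - z) by exact: cabs_cisB_ge.
(* In the Stolz region |z - cis x0| is at most M d, and d is at most |cis y - z|. Chords from the
   boundary point thus bound the distances to z from below. *)
have chord y : cabs (cis y - cis x0) <= (1 + M) * cabs (cis y - z).
  rewrite (le_trans (cabs_dist_triangle z _ _))// mulrDl mul1r lerD2l.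
  by rewrite (le_trans zM2)// ler_wpM2l.
have pk0 y : 0 <= pkernel z y by rewrite pkernel_ge0// ltW.
have pkb y (b : R) : 0 < b -> b <= (1 + M) * cabs (cis y - z) ->
    pkernel z y <= 2 * (1 + M) ^+ 2 * d / b ^+ 2.
  move=> b0 bz; apply: le_trans (pkernel_le y z1) _; rewrite -/d.
  have c0 : 0 < cabs (cis y - z) := lt_le_trans dp (ez y).
  rewrite ler_pdivrMr ?exprn_gt0// mulrAC ler_pdivlMr ?exprn_gt0//.
  have -> : 2 * (1 + M) ^+ 2 * d * cabs (cis y - z) ^+ 2 =
    2 * d * ((1 + M) * cabs (cis y - z)) ^+ 2 by ring.
  rewrite ler_pM2l ?mulr_gt0// ler_pXn2r ?nnegrE ?(ltW b0)//.
  by rewrite mulr_ge0 ?cabs_ge0// addr_ge0.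
have [J Jeta Jle] : exists2 J, eta <= 2 ^+ J * d &
    forall j, (j <= J)%N -> 2 ^+ j * d < eta0.
  have ex : exists J, eta <= 2 ^+ J * d.
    exists (Num.truncn (eta / d)).+1.
    rewrite -ler_pdivrMr// (le_trans (ltW (truncnS_gt _)))//.
    by rewrite -natrX ler_nat ltnW// ltn_expl.
  have [J JP Jmin] := ex_minnP ex; exists J => // j jJ.
  have : 2 ^+ J * d <= 2 * eta.
    case: J JP Jmin jJ => [|J] JP Jmin jJ; first by rewrite expr0 mul1r; lra.
    rewrite exprS -mulrA ler_pM2l// leNgt; apply/negP => hJ.
    by have := Jmin _ (ltW hJ); rewrite ltnn.
  have : 2 ^+ j * d <= 2 ^+ J * d by rewrite ler_pM2r// ler_weXn2l// ler1n.
  by move=> a b; lra.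
pose q j := h \_ (ball x0 (2 ^+ j * d)).
pose a j : R := 4 * K / d * (4^-1) ^+ j.
have qi j : rint (q j) by apply: rint_patch => //; exact: measurable_ball.
have a0 j : 0 <= a j.
  by rewrite mulr_ge0 ?exprn_ge0 ?invr_ge0// divr_ge0 ?(ltW dp)//; lra.
have q0 j y : 0 <= q j y by rewrite /q patchE; case: ifP.
have [Si Sm] := rmean_sum J.+1 a qi.
set S := fun y : R => _ in Si Sm.
have pt y : D y -> h y * pkernel z y <= A * d * h y + S y.
  move=> Dy; have Sy0 : 0 <= S y.
    by apply: sumr_ge0 => j _; rewrite mulr_ge0.
  have [far|near] := lerP eta `|x0 - y|.
    rewrite (@le_trans _ _ (A * d * h y)) ?lerDl// mulrC ler_wpM2r//.
    have -> : A * d = 2 * (1 + M) ^+ 2 * d / k ^+ 2 by rewrite /A; ring.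
    by apply: pkb => //; rewrite (le_trans (hk y Dy far)).
  have [j jJ [sj jcase]] := dyadic_scale dp (normr_ge0 (x0 - y)) (lt_le_trans near Jeta).
  rewrite (@le_trans _ _ (a j * q j y))//; last first.
    rewrite (@le_trans _ _ (S y))//; last first.
      by rewrite lerDr (mulr_ge0 (mulr_ge0 A0 (ltW dp)) (h0 y)).
    rewrite /S (big_cat_nat (n := j))//=; last exact: leqW.
    rewrite (big_cat_nat (m := j) (n := j.+1))//= big_nat1 addrCA lerDl.
    by rewrite addr_ge0// sumr_ge0// => i _; rewrite mulr_ge0.
  have -> : q j y = h y by rewrite /q patchE mem_set.
  rewrite mulrC ler_wpM2r//.
  have d2 : d <= (1 + M) * cabs (cis y - z).
    by rewrite (le_trans (ez y))// ler_peMl ?cabs_ge0// lerDl.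
  case: jcase => [j0|jcase].
    rewrite (le_trans (pkb _ _ dp d2))// /a j0 expr0 mulr1.
    rewrite ler_pdivrMr ?exprn_gt0//.
    have -> : 4 * K / d * d ^+ 2 = 4 * K * d by field; rewrite gt_eqF.
    by rewrite ler_pM2r// /K; have := sqr_ge0 (1 + M); lra.
  have s0 : 0 < `|x0 - y|.
    by rewrite -(pmulr_rgt0 _ (ltr0n R 2)) (lt_le_trans _ jcase)// mulr_gt0 ?exprn_gt0.
  (* One factor 1/2 comes from the inner radius of the shell, the other from [chord_near]. *)
  have b0 : 0 < 2 ^+ j * d / 4 by rewrite divr_gt0// mulr_gt0 ?exprn_gt0.
  have bz : 2 ^+ j * d / 4 <= (1 + M) * cabs (cis y - z).
    rewrite (le_trans _ (chord y))// (le_trans _ (chord_near (_ : `|x0 - y| <= _)))//.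
      by lra.
    by rewrite (le_trans (ltW near)).
  rewrite (le_trans (pkb _ _ b0 bz))// /a /K.
  rewrite le_eqVlt; apply/orP; left; apply/eqP.
  have -> : (4^-1 : R) ^+ j = ((2 ^+ j) ^-1) ^+ 2.
    by rewrite -exprVn -exprM mulnC exprM exprVn -natrX.
  by field; rewrite (gt_eqF dp) expf_neq0.
have ki := clip_pkernel z1; have rki := rint_pkernel z1.
have uk : cint (fun y => u y * (pkernel z y)%:C).
  have [L [B [_ _ _ kB]]] := ki.
  exact: cintM ui (clip_meas ki) (fun y _ => kB y).
have ck : cint (fun y => u x0 * (pkernel z y)%:C) by apply: cintZ; exact: clip_int.
have -> : F z - u x0 = cmean (fun y => u y * (pkernel z y)%:C - u x0 * (pkernel z y)%:C).
  rewrite (cmeanB uk ck) -FE// (cmeanZ _ (clip_int ki)); congr (_ - _).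
  have -> : cmean (fun y => (pkernel z y)%:C) = 1.
    by rewrite /cmean /= rmean_pkernel// rmean_cst.
  by rewrite mulr1.
have Ai := rintZ (A * d) hi.
apply: le_lt_trans (ler_cmean (cintB uk ck) (rintD Ai Si) _) _.
  move=> y Dy; rewrite -mulrBl cabsM cabs_real ger0_norm//; exact: pt.
rewrite (rmeanD Ai Si) (rmeanZ _ hi) Sm.
have Sle : \sum_(0 <= j < J.+1) a j * rmean (q j) <= e / 2.
  have -> : e / 2 = \sum_(0 <= j < J.+1) (e / 4) * 2^-1 ^+ j + e / 2 * 2^-1 ^+ J.+1.
    elim: (J.+1) => [|n IH]; first by rewrite big_geq// add0r expr0 mulr1.
    by rewrite big_nat_recr//= {1}IH -addrA; congr (_ + _); rewrite exprS; field.
  rewrite (@le_trans _ _ (\sum_(0 <= j < J.+1) (e / 4) * 2^-1 ^+ j))//; last first.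
    by rewrite lerDl mulr_ge0 ?exprn_ge0 ?invr_ge0// divr_ge0// ltW.
  rewrite !big_mkord; apply: ler_sum => j _.
  have jJ : (j <= J)%N by rewrite -ltnS.
  have t0 : 0 < 2 ^+ j * d by rewrite mulr_gt0// exprn_gt0.
  rewrite (le_trans (ler_wpM2l (a0 j) (hE _ t0 (Jle _ jJ))))// /a.
  have -> : (4^-1 : R) ^+ j = (2 ^+ j) ^-1 * (2 ^+ j)^-1.
    by rewrite -invfM -exprMn -natrM exprVn.
  rewrite exprVn le_eqVlt; apply/orP; left; apply/eqP.
  have K0 : K != 0 by rewrite gt_eqF//; lra.
  by field; rewrite (gt_eqF dp) expf_neq0// K0.
have : A * d * rmean h < e / 2 by rewrite mulrAC mulrC.
by move: Sle; lra.
Qed.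

End LebesguePoints.

(** * Unordered sums *)

Section UnorderedSums.
Variable R : realType.
Variable I : choiceType.
Local Notation C := R[i].
Implicit Types (u v : I -> C) (G : set I) (A B : {fset I}).
Local Open Scope fset_scope.
Local Open Scope ring_scope.

Definition fincl A G := forall i, i \in A -> G i.

Definition hsum G u (l : C) := summability.partial_sum (u \_ G) @ summability.totally --> l.

Lemma partial_sumE u A : summability.partial_sum u A = \sum_(i <- A) u i.
Proof. by rewrite /summability.partial_sum big_seq_fsetE. Qed.

(** Off G the restricted function vanishes, so every finite set may be replaced by its intersection
    with G. *)
Lemma hsumP G u l : hsum G u l <-> forall e : R, 0 < e ->
  exists2 A, fincl A G & forall B, fincl B G -> A `<=` B ->
    cabs (\sum_(i <- B) u i - l) < e.
Proof.
have restr B : \sum_(i <- B) (u \_ G) i = \sum_(i <- [fset i in B | i \in G]) u i.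
  rewrite (big_fsetID +%R (fun i => i \in G)) /= [X in _ + X]big1_fset ?addr0.
    by apply: eq_fbigr => i; rewrite !finmap.inE /= => /andP[_ iG]; rewrite patchE iG.
  by move=> i; rewrite !finmap.inE /= => /andP[_ iG] _; rewrite patchE (negbTE iG).
have sub B : fincl [fset i in B | i \in G] G.
  by move=> i /=; rewrite !finmap.inE /= => /andP[_ /set_mem].
have PF := @summability.totally_filter I.
split=> [/cvgC h e e0|h].
  have [A _ AB] := h e e0; exists [fset i in A | i \in G]; first exact: sub.
  move=> B BG sAB.
  have := AB (A `|` B) (fsubsetUl _ _); rewrite /= partial_sumE restr.
  have -> : [fset i in A `|` B | i \in G] = B => //.
  apply/fsetP => i; rewrite !finmap.inE /=; apply/andP/idP => [[/orP[iA|//] iG]|iB].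
    by apply: (fsubsetP sAB); rewrite !finmap.inE /= iA.
  by rewrite iB orbT; split => //; apply/mem_set/BG.
apply/cvgC => e e0; have [A AG AB] := h e e0; exists A => // B /= sAB.
rewrite partial_sumE restr; apply: AB; first exact: sub.
apply/fsubsetP => i iA; rewrite !finmap.inE /= (fsubsetP sAB)//=.
by apply/mem_set/AG.
Qed.

Lemma hsum_lim G u l : hsum G u l -> summability.sum (u \_ G) = l.
Proof.
move=> h; have PF := @summability.totally_filter I.
by apply: cvg_lim h; exact: Chausdorff.
Qed.

Lemma hsum_reindex G u l (s t : I -> I) : (forall i, G i -> G (s i)) ->
  (forall i, G i -> G (t i)) -> (forall i, G i -> t (s i) = i) ->
  (forall i, G i -> s (t i) = i) -> hsum G u l -> hsum G (fun i => u (s i)) l.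
Proof.
move=> sG tG ts st /hsumP h; apply/hsumP => e e0.
have [A AG AB] := h e e0; exists [fset t i | i in A].
  by move=> _ /imfsetP[i /= iA ->]; apply: tG; exact: AG.
move=> B BG sAB; have -> : \sum_(i <- B) u (s i) = \sum_(i <- [fset s i | i in B]) u i.
  rewrite big_imfset//= => i j iB jB sij.
  by rewrite -(ts i) ?sij ?ts//; exact: BG.
apply: AB.
  by move=> _ /imfsetP[i /= iB ->]; apply: sG; exact: BG.
apply/fsubsetP => i iA; apply/imfsetP; exists (t i) => /=; last by rewrite st//; exact: AG.
by apply: (fsubsetP sAB); apply/imfsetP; exists i.
Qed.

(** Finite sums that avoid [a] control everything but one term. With [a] the identity this isolates
    the leading term of a series over the group. *)
Lemma hsum_dist G u l (a : I) (E : R) : hsum G u l -> G a ->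
  (forall B, fincl B (G `\ a)%classic -> \sum_(i <- B) cabs (u i) <= E) ->
  cabs (l - u a) <= E.
Proof.
move=> /hsumP h Ga hE; apply/ler_addgt0Pr => e e0.
have [A AG AB] := h e e0.
have BG : fincl (a |` A) G.
  by move=> i /=; rewrite !finmap.inE => /orP[/eqP->|/AG].
have := AB (a |` A) BG (fsubsetUr _ _).
rewrite (big_fsetD1 a) ?finmap.inE ?eqxx//=; set s := \sum_(i <- _) u i => hs.
have sE : cabs s <= E.
  apply: le_trans (hE ((a |` A) `\ a) _).
    rewrite /s; elim/big_ind2 : _ => [|x b y c xb yc|i _]; rewrite ?cabs0//.
    by rewrite (le_trans (ler_cabsD _ _))// lerD.
  move=> i /=; rewrite !finmap.inE => /andP[/eqP ia iA]; split => //.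
  by apply: BG => /=; rewrite !finmap.inE.
have -> : l - u a = s - (u a + s - l) by ring.
by rewrite (le_trans (ler_cabsB _ _))// lerD// ltW.
Qed.

Section Exhaustion.
Variables (G : set I) (w : I -> R) (F : nat -> {fset I}) (W : R).
Hypothesis w0 : forall i, 0 <= w i.
Hypothesis wW : forall B, fincl B G -> \sum_(i <- B) w i <= W.

(** Finite sets with rapidly decreasing tails turn limits along the filter of finite sets into
    limits of sequences, to which dominated convergence and bounded variation apply. *)
Definition exhausts := [/\ forall n, fincl (F n) G, forall n, F n `<=` F n.+1 &
  forall n B, (forall i, i \in B -> G i /\ i \notin F n) ->
    \sum_(i <- B) w i <= (2^-1) ^+ n].

Hypothesis FG : exhausts.

Definition dominated u (K : R) := forall i, G i -> cabs (u i) <= K * w i.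

Lemma dominated_tail u K B n : 0 <= K -> dominated u K -> fincl B G ->
  F n `<=` B -> cabs (\sum_(i <- B) u i - \sum_(i <- F n) u i) <= K * (2^-1) ^+ n.
Proof.
move=> K0 uK BG FB; case: FG => _ _ Ft.
rewrite (big_fsetID +%R (fun i => i \in F n)) /=.
have -> : [fset x in B | x \in F n] = F n.
  apply/fsetP => i; rewrite !finmap.inE /=; apply/andP/idP => [[]//|iF].
  by split=> //; exact: (fsubsetP FB).
rewrite addrAC subrr add0r; set B' := [fset x in B | _].
have hB' i : i \in B' -> G i /\ i \notin F n.
  by rewrite !finmap.inE /= => /andP[iB iF]; split => //; exact: BG.
apply: (@le_trans _ _ (\sum_(i <- B') K * w i)).
  rewrite big_seq [leRHS]big_seq.
  elim/big_ind2 : _ => [|x b y c xb yc|i iB']; rewrite ?cabs0//.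
    by rewrite (le_trans (ler_cabsD _ _))// lerD.
  by apply: uK; case: (hB' i iB').
by rewrite -mulr_sumr ler_wpM2l// Ft.
Qed.

Lemma dominated_hsum u K : 0 <= K -> dominated u K -> exists l, hsum G u l.
Proof.
move=> K0 uK; have [FGn FS Ft] := FG.
pose s n := \sum_(i <- F n) u i.
have sS n : cabs (s n.+1 - s n) <= K * (2^-1) ^+ n.
  by apply: dominated_tail => //; exact: FS.
have geom n : \sum_(0 <= k < n) (K * (2^-1) ^+ k) <= K * 2.
  rewrite -mulr_sumr ler_wpM2l//.
  have -> : \sum_(0 <= k < n) ((2^-1) ^+ k : R) = 2 - 2 * 2^-1 ^+ n.
    elim: n => [|n IH]; first by rewrite big_geq// expr0 mulr1 subrr.
    by rewrite big_nat_recr//= IH exprS; field.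
  by rewrite gerBl mulr_ge0// exprn_ge0// invr_ge0.
have cRe : cvgn (fun n => complex.Re (s n)).
  apply: (@bounded_variation_cvg _ _ (K * 2)) => n; apply: le_trans (geom n).
  apply: ler_sum => k _; apply: le_trans (sS k).
  by rewrite -ReB ler_Re_cabs.
have cIm : cvgn (fun n => complex.Im (s n)).
  apply: (@bounded_variation_cvg _ _ (K * 2)) => n; apply: le_trans (geom n).
  apply: ler_sum => k _; apply: le_trans (sS k).
  by rewrite -ImB ler_Im_cabs.
pose l : C := limn (fun n => complex.Re (s n)) +i* limn (fun n => complex.Im (s n)).
have sl : s @ \oo --> l by apply/cvg_complexP.
exists l; apply/hsumP => e e0.
have e2 : 0 < e / 2 by rewrite divr_gt0.
have h1 : \forall n \near \oo, cabs (s n - l) < e / 2 by move/cvgC : sl; apply.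
have h2 : \forall n \near \oo, K * (2^-1) ^+ n < e / 2.
  have : (fun n => K * (2^-1) ^+ n) @ \oo --> K * 0.
    apply: cvgM; first exact: cvg_cst.
    by apply: cvg_expr; rewrite ger0_norm ?invr_ge0// invf_lt1 ?ltr0n ?ltr1n.
  rewrite mulr0 => /cvgrPdist_lt/(_ _ e2); apply: filterS => n.
  by rewrite sub0r normrN; apply: le_lt_trans; exact: ler_norm.
have [n [n1 n2]] := filter_ex (filterI h1 h2).
exists (F n); first exact: FGn.
move=> B BG FB; rewrite (splitr e) (le_lt_trans (cabs_dist_triangle (s n) _ _))//.
by rewrite ltrD// (le_lt_trans _ n2)// dominated_tail.
Qed.

Lemma dominated_cvg u K l : 0 <= K -> dominated u K -> hsum G u l ->
  (fun n => \sum_(i <- F n) u i) @ \oo --> l.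
Proof.
move=> K0 uK /hsumP h; apply/cvgC => e e0; have [FGn FS Ft] := FG.
have e2 : 0 < e / 2 by rewrite divr_gt0.
have [A AG AB] := h _ e2.
have h2 : \forall n \near \oo, K * (2^-1) ^+ n < e / 2.
  have : (fun n => K * (2^-1) ^+ n) @ \oo --> K * 0.
    apply: cvgM; first exact: cvg_cst.
    by apply: cvg_expr; rewrite ger0_norm ?invr_ge0// invf_lt1 ?ltr0n ?ltr1n.
  rewrite mulr0 => /cvgrPdist_lt/(_ _ e2); apply: filterS => n.
  by rewrite sub0r normrN; apply: le_lt_trans; exact: ler_norm.
apply: filterS h2 => n n2.
have BG : fincl (A `|` F n) G.
  by move=> i /=; rewrite finmap.inE => /orP[/AG|/FGn].
rewrite (splitr e) (le_lt_trans (cabs_dist_triangle (\sum_(i <- A `|` F n) u i) _ _))//.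
rewrite ltrD//; last by apply: AB => //; exact: fsubsetUl.
by rewrite (le_lt_trans _ n2)// cabsBC dominated_tail// fsubsetUr.
Qed.

Lemma gsum_hsum u K : 0 <= K -> dominated u K -> hsum G u (summability.sum (u \_ G)).
Proof.
by move=> K0 /(dominated_hsum K0)[l ul]; rewrite (hsum_lim ul).
Qed.

Lemma gsum_cvg u K : 0 <= K -> dominated u K ->
  (fun n => \sum_(i <- F n) u i) @ \oo --> summability.sum (u \_ G).
Proof. by move=> K0 uK; exact: dominated_cvg K0 uK (gsum_hsum K0 uK). Qed.

Lemma gsum_eq u K l : 0 <= K -> dominated u K ->
  (fun n => \sum_(i <- F n) u i) @ \oo --> l -> summability.sum (u \_ G) = l.
Proof.
by move=> K0 uK ul; exact: (cvg_unique (@Chausdorff R) (gsum_cvg K0 uK) ul).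
Qed.

Lemma cvg_cabs_le (s : nat -> C) l (E : R) : (forall n, cabs (s n) <= E) ->
  s @ \oo --> l -> cabs l <= E.
Proof.
move=> sE /cvgC sl; apply/ler_addgt0Pr => e e0.
have [n hn] := filter_ex (sl e e0).
rewrite -(subrK (s n) l) (le_trans (ler_cabsD _ _))// addrC lerD//.
by rewrite cabsBC ltW.
Qed.

Lemma gsum_le u K : 0 <= K -> dominated u K -> cabs (summability.sum (u \_ G)) <= K * W.
Proof.
move=> K0 uK; have [FGn _ _] := FG; apply: cvg_cabs_le (gsum_cvg K0 uK) => n.
apply: (@le_trans _ _ (\sum_(i <- F n) K * w i)).
  rewrite big_seq [leRHS]big_seq.
  elim/big_ind2 : _ => [|x b y c xb yc|i iB']; rewrite ?cabs0//.
    by rewrite (le_trans (ler_cabsD _ _))// lerD.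
  exact: uK (FGn n i iB').
by rewrite -mulr_sumr ler_wpM2l// wW//; exact: (FGn n).
Qed.

Lemma gsum_scale u K (c : C) : 0 <= K -> dominated u K ->
  summability.sum ((fun i => c * u i) \_ G) = c * summability.sum (u \_ G).
Proof.
move=> K0 uK; apply: (@gsum_eq _ (cabs c * K)); first by rewrite mulr_ge0 ?cabs_ge0.
  by move=> i Gi; rewrite cabsM -mulrA ler_wpM2l ?cabs_ge0 ?uK.
have -> : (fun n => \sum_(i <- F n) c * u i) = (fun n => c * \sum_(i <- F n) u i).
  by apply/funext => n; rewrite mulr_sumr.
apply/cvgC => e e0; have c0 : 0 < cabs c + 1 by rewrite ltr_wpDl ?cabs_ge0.
have /cvgC/(_ _ (divr_gt0 e0 c0)) := gsum_cvg K0 uK; apply: filterS => n.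
rewrite -mulrBr cabsM ltr_pdivlMr// mulrC; apply: le_lt_trans.
by rewrite ler_wpM2r ?cabs_ge0// lerDl.
Qed.

Lemma gsumB u v K L : 0 <= K -> 0 <= L -> dominated u K -> dominated v L ->
  summability.sum ((fun i => u i - v i) \_ G) =
    summability.sum (u \_ G) - summability.sum (v \_ G).
Proof.
move=> K0 L0 uK vL; apply: (@gsum_eq _ (K + L)); first exact: addr_ge0.
  move=> i Gi; rewrite mulrDl (le_trans (ler_cabsB _ _))// lerD ?uK ?vL//.
have -> : (fun n => \sum_(i <- F n) (u i - v i)) =
    (fun n => \sum_(i <- F n) u i - \sum_(i <- F n) v i).
  by apply/funext => n; rewrite sumrB.
apply/cvgC => e e0; have e2 : 0 < e / 2 by rewrite divr_gt0.
have /cvgC/(_ _ e2) h1 := gsum_cvg K0 uK; have /cvgC/(_ _ e2) := gsum_cvg L0 vL.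
apply: filterS2 h1 => n h1 h2.
set a := \sum_(i <- F n) u i; set b := \sum_(i <- F n) v i.
have -> : a - b - (summability.sum (u \_ G) - summability.sum (v \_ G)) =
   (a - summability.sum (u \_ G)) - (b - summability.sum (v \_ G)) by ring.
by rewrite (splitr e) (le_lt_trans (ler_cabsB _ _))// ltrD.
Qed.

(** Remainders bounded by multiples of [w i] can be summed, so analyticity of the sum comes together
    with termwise differentiation. *)
Lemma holo_on_gsum (r K : R) (f f' : I -> C -> C) : 0 <= K ->
  (forall z, cabs z <= r -> dominated (f^~ z) K) ->
  (forall z, cabs z <= r -> dominated (f'^~ z) K) ->
  (forall z y, cabs z <= r -> cabs y <= r -> forall i, G i ->
    cabs (f i y - f i z - f' i z * (y - z)) <= K * cabs (y - z) ^+ 2 * w i) ->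
  holo_on r (fun z => summability.sum ((f^~ z) \_ G))
            (fun z => summability.sum ((f'^~ z) \_ G)).
Proof.
move=> K0 fK fK' fQ.
have W0 : 0 <= W.
  by have := @wW fset0; rewrite big_seq_fset0; apply => i.
exists (K * W); first exact: mulr_ge0.
move=> z y zr yr; set h := y - z.
have Kh : 0 <= K * cabs h ^+ 2 by rewrite mulr_ge0// sqr_ge0.
rewrite mulrC -(gsum_scale _ K0 (fK' z zr)) -(gsumB K0 K0 (fK y yr) (fK z zr)).
have d1 : dominated (fun i => f i y - f i z) (K + K).
  by move=> i Gi; rewrite mulrDl (le_trans (ler_cabsB _ _))// lerD ?fK.
have d2 : dominated (fun i => h * f' i z) (cabs h * K).
  by move=> i Gi; rewrite cabsM -mulrA ler_wpM2l ?cabs_ge0 ?fK'.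
rewrite -(gsumB _ _ d1 d2) ?addr_ge0 ?mulr_ge0 ?cabs_ge0// mulrAC.
apply: gsum_le => // i Gi; rewrite [h * _]mulrC; exact: fQ.
Qed.

End Exhaustion.

(** Take unions of finite sets whose weights come within 2^-n of the supremum: a disjoint finite set
    can add at most the remaining gap. *)
Lemma exhaustion (G : set I) (w : I -> R) (W : R) : (forall i, 0 <= w i) ->
  (forall B, fincl B G -> \sum_(i <- B) w i <= W) ->
  exists F, exhausts G w F.
Proof.
move=> w0 wW; pose E := [set \sum_(i <- B) w i | B in [set B : {fset I} | fincl B G]].
have hE : has_sup E.
  split; last by exists W => _ [B BG <-]; exact: wW.
  by exists 0; exists fset0; [by move=> i|rewrite big_seq_fset0].
have /choice[A hA] : forall n : nat, exists A : {fset I},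
    fincl A G /\ sup E - (2^-1) ^+ n < \sum_(i <- A) w i.
  move=> n; have e0 : 0 < (2^-1 : R) ^+ n by rewrite exprn_gt0// invr_gt0.
  by have [_ [B BG <-] BE] := sup_adherent e0 hE; exists B.
pose F := fix F n := if n is m.+1 then F m `|` A m.+1 else A 0%N.
have FG n : fincl (F n) G.
  elim: n => [|n IH] i /=; first by have [h _] := hA 0%N; exact: h.
  by rewrite finmap.inE => /orP[/IH//|]; have [h _] := hA n.+1; exact: h.
have AF n : A n `<=` F n by case: n => [|n]; [exact: fsubset_refl|exact: fsubsetUr].
exists F; split => // [n|n B BF]; first exact: fsubsetUl.
have BG : fincl (B `|` F n) G.
  by move=> i /=; rewrite finmap.inE => /orP[/BF[]//|/FG].
have hB : \sum_(i <- B) w i + \sum_(i <- F n) w i <= sup E.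
  have -> : \sum_(i <- B) w i + \sum_(i <- F n) w i = \sum_(i <- B `|` F n) w i.
    rewrite [RHS](big_fsetID +%R (fun i => i \in B)) /=; congr (_ + _).
      apply: eq_fbigl => i; rewrite !finmap.inE /=.
      by apply/idP/andP => [iB|[]//]; rewrite iB.
    apply: eq_fbigl => i; rewrite !finmap.inE /=.
    apply/idP/andP => [iF|[/orP[->|]//]]; rewrite iF orbT; split => //.
    by apply/negP => /BF[_]; rewrite iF.
  by apply: (ub_le_sup hE.2); exists (B `|` F n).
have AFs : \sum_(i <- A n) w i <= \sum_(i <- F n) w i.
  rewrite [leRHS](big_fsetID +%R (fun i => i \in A n)) /=.
  have -> : [fset x in F n | x \in A n] = A n.
    apply/fsetP => i; rewrite !finmap.inE /=; apply/andP/idP => [[]//|iA].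
    by split=> //; exact: (fsubsetP (AF n)).
  by rewrite lerDl sumr_ge0.
have [_ hn] := hA n; lra.
Qed.

End UnorderedSums.

(** * Moebius transformations *)

Section Moebius.
Variable R : realType.
Local Notation C := R[i].
Implicit Types (z w t a b : C) (f g h : C -> C).

Lemma mobiusE a b z : mobius a b z = (a * z + b) / (b^*%C * z + a^*%C).
Proof. by []. Qed.

Lemma SU11_det a b : SU11 (a, b) -> a * a^*%C - b * b^*%C = 1.
Proof. by rewrite /SU11 /= !sqr_normc. Qed.

Lemma SU11_cabs a b : SU11 (a, b) -> cabs a ^+ 2 - cabs b ^+ 2 = 1.
Proof.
by move=> /SU11_det h; apply/(@complexI R); rewrite rmorphB /= -!mul_conj.
Qed.

Lemma SU11_lt a b : SU11 (a, b) -> cabs b < cabs a.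
Proof.
move=> /SU11_cabs h; rewrite -(ltr_pXn2r (n := 2)) ?nnegrE ?cabs_ge0//.
by rewrite -subr_gt0 h.
Qed.

Definition mden a b z := b^*%C * z + a^*%C.

Lemma mden_neq0 a b z : SU11 (a, b) -> cabs z <= 1 -> mden a b z != 0.
Proof.
move=> /SU11_lt ab z1; rewrite -cabs_gt0 /mden addrC -[_ * z]opprK.
rewrite (lt_le_trans _ (ler_dist_cabs _ _))// cabsN cabsM !cabs_conj subr_gt0.
by rewrite (le_lt_trans _ ab)// ler_piMr ?cabs_ge0.
Qed.

Lemma mobiusB a b z w : SU11 (a, b) -> cabs z <= 1 -> cabs w <= 1 ->
  mobius a b z - mobius a b w = (z - w) / (mden a b z * mden a b w).
Proof.
move=> ab z1 w1; have dz := mden_neq0 ab z1; have dw := mden_neq0 ab w1.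
have -> : z - w = (a * a^*%C - b * b^*%C) * (z - w) by rewrite (SU11_det ab) mul1r.
rewrite !mobiusE -/(mden a b z) -/(mden a b w).
have -> : (a * a^*%C - b * b^*%C) * (z - w) =
   (a * z + b) * mden a b w - (a * w + b) * mden a b z by rewrite /mden; ring.
by field; rewrite dz dw.
Qed.

(** Derivatives will be evaluated at points of the circle, which calls for a radius beyond 1; the
    room comes from |b| < |a|. *)
Lemma mobius_holo a b : SU11 (a, b) -> exists2 r : R, 1 < r &
  holo_on r (mobius a b) (fun z => (mden a b z)^-1 ^+ 2).
Proof.
move=> ab; have hab := SU11_lt ab; set A := cabs a in hab; set B := cabs b in hab.
have B0 : 0 <= B := cabs_ge0 _.
(* This radius gives up at most half of the gap |a| - |b|, so the modulus of the denominator stays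
   at least the other half. *)
pose r := 1 + (A - B) / (2 * (B + 1)).
have r1 : 1 < r by rewrite ltrDl divr_gt0 ?subr_gt0// mulr_gt0// ltr_wpDl.
have r0 : 0 <= r by lra.
have Br : B * r <= B + (A - B) / 2.
  rewrite /r mulrDr mulr1 lerD2l mulrCA ler_wpM2l ?subr_ge0 ?(ltW hab)//.
  rewrite invfM mulrCA ler_piMr ?invr_ge0// ler_pdivrMr ?mul1r ?lerDl//.
  by rewrite ltr_wpDl.
have c0 : 0 < (A - B) / 2 by rewrite divr_gt0// subr_gt0.
have dc z : cabs z <= r -> (A - B) / 2 <= cabs (mden a b z).
  move=> zr; rewrite /mden [X in cabs X]addrC -[_ * z]opprK (le_trans _ (ler_dist_cabs _ _))//.
  rewrite cabsN cabsM !cabs_conj -/A -/B.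
  have : B * cabs z <= B * r by rewrite ler_wpM2l.
  lra.
have hd : holo_on r (mden a b) (fun=> b^*%C).
  apply: eq_holo_on (holo_onD (holo_onZ b^*%C r0 (holo_on_id r)) (holo_on_cst r a^*%C)) => //.
  by move=> z _; rewrite mulr1 addr0.
have hn : holo_on r (fun z => a * z + b) (fun=> a).
  apply: eq_holo_on (holo_onD (holo_onZ a r0 (holo_on_id r)) (holo_on_cst r b)) => //.
  by move=> z _; rewrite mulr1 addr0.
exists r => //; apply: eq_holo_on (holo_onM r0 hn (holo_onV r0 c0 dc hd)) => // z zr.
have d0 : mden a b z != 0 by rewrite -cabs_gt0 (lt_le_trans c0)// dc.
have -> : (mden a b z)^-1 ^+ 2 = (a * a^*%C - b * b^*%C) * (mden a b z)^-1 ^+ 2.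
  by rewrite (SU11_det ab) mul1r.
have -> : a * a^*%C - b * b^*%C = a * mden a b z - (a * z + b) * b^*%C.
  by rewrite /mden; ring.
by field.
Qed.

Lemma mobius_derive1 a b z : SU11 (a, b) -> cabs z <= 1 ->
  derive1 (mobius a b) z = (mden a b z)^-1 ^+ 2.
Proof.
move=> ab z1; have [r r1 hr] := mobius_holo ab.
by rewrite (holo_on_derive1 hr)// (le_lt_trans z1).
Qed.

(** The value at 0 fixes b over the conjugate of a, and the increments from 0 to e and to -e fix the
    square of that conjugate. The remaining sign does not change the map. *)
Lemma mobius_ext a b c d : SU11 (a, b) -> SU11 (c, d) ->
  (forall z, cabs z < 1 -> mobius a b z = mobius c d z) -> mobius a b = mobius c d.
Proof.
move=> ab cd E; have z0 : cabs (0 : C) < 1 by rewrite cabs0.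
have z0' := ltW z0.
pose e : C := (2^-1)%:C; have e1 : cabs e < 1.
  by rewrite cabs_real ger0_norm ?invr_ge0// invf_lt1 ?ltr0n ?ltr1n.
have e0 : e != 0 by rewrite -cabs_eq0 cabs_real normr_eq0 invr_eq0.
have me : cabs (- e) < 1 by rewrite cabsN.
have a0 := mden_neq0 ab z0'; have c0 := mden_neq0 cd z0'.
have H z : cabs z < 1 -> z != 0 -> mden a b z * mden a b 0 = mden c d z * mden c d 0.
  move=> z1 zn0; have := mobiusB ab (ltW z1) z0'; rewrite !E// (mobiusB cd (ltW z1) z0').
  rewrite subr0 => /(mulfI zn0)/invr_inj//.
have h1 := H e e1 e0; have h2 := H _ me (_ : - e != 0).
have a00 : mden a b 0 = a^*%C by rewrite /mden mulr0 add0r.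
have c00 : mden c d 0 = c^*%C by rewrite /mden mulr0 add0r.
have sq : a^*%C ^+ 2 = c^*%C ^+ 2.
  have two : 2 != 0 :> C by rewrite pnatr_eq0.
  apply: (mulfI two); rewrite oppr_eq0 in h2; move: h1 (h2 e0).
  rewrite a00 c00 /mden => {}h1 {}h2.
  have -> : 2 * a^*%C ^+ 2 = (b^*%C * e + a^*%C) * a^*%C + (b^*%C * - e + a^*%C) * a^*%C by ring.
  by rewrite h1 h2; ring.
have b0 : b / a^*%C = d / c^*%C.
  by have := E 0 z0; rewrite !mobiusE !mulr0 !add0r.
move: sq => /eqP; rewrite eqf_sqr => /orP[/eqP ac|/eqP ac].
  have bd : b = d.
    by move: b0; rewrite ac => /(mulIf _) -> //; rewrite invr_eq0 -c00.
  have -> : a = c by rewrite -[a]conjcK ac conjcK.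
  by rewrite bd.
have bd : b = - d.
  move: b0; rewrite ac invrN mulrN => /eqP; rewrite eqr_oppLR -mulNr => /eqP.
  by apply: mulIf; rewrite invr_eq0 -c00.
have -> : a = - c by rewrite -[a]conjcK ac -[RHS]conjcK; congr (_^*%C); rewrite [RHS]raddfN.
apply/funext => z; rewrite bd !mobiusE.
have -> : (- d)^*%C = - d^*%C by exact: raddfN.
have -> : (- c)^*%C = - c^*%C by exact: raddfN.
by rewrite !mulNr -!opprD invrN mulrNN.
Qed.

(** [mden] is the automorphy factor of the action, and its multiplicativity gives the chain rule up
    to the circle. *)
Lemma mobius_comp a b c d z : SU11 (a, b) -> SU11 (c, d) -> cabs z <= 1 ->
  [/\ cabs (mobius c d z) <= 1,
    SU11 (a * c + b * d^*%C, a * d + b * c^*%C),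
    mobius a b (mobius c d z) = mobius (a * c + b * d^*%C) (a * d + b * c^*%C) z &
    mden (a * c + b * d^*%C) (a * d + b * c^*%C) z = mden a b (mobius c d z) * mden c d z].
Proof.
move=> ab cd z1; have dz := mden_neq0 cd z1.
have g1 : cabs (mobius c d z) <= 1.
  rewrite mobiusE -/(mden c d z) cabsM cabsV ler_pdivrMr ?cabs_gt0// mul1r.
  rewrite -(ler_pXn2r (n := 2)) ?nnegrE ?cabs_ge0// -subr_ge0.
  have -> : cabs (mden c d z) ^+ 2 - cabs (c * z + d) ^+ 2 = 1 - cabs z ^+ 2.
    apply/(@complexI R); rewrite !rmorphB rmorph1 /= -!mul_conj /mden.
    rewrite !conjcD !conjcM !conjcK.
    have -> : (d^*%C * z + c^*%C) * (d * z^*%C + c) - (c * z + d) * (c^*%C * z^*%C + d^*%C) =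
       (c * c^*%C - d * d^*%C) * (1 - z * z^*%C) by ring.
    by rewrite (SU11_det cd) mul1r.
  by rewrite subr_ge0 expr_le1 ?cabs_ge0.
have su : SU11 (a * c + b * d^*%C, a * d + b * c^*%C).
  rewrite /SU11 /= !sqr_normc !conjcD !conjcM !conjcK.
  have -> : (a * c + b * d^*%C) * (a^*%C * c^*%C + b^*%C * d) -
     (a * d + b * c^*%C) * (a^*%C * d^*%C + b^*%C * c) =
    (a * a^*%C - b * b^*%C) * (c * c^*%C - d * d^*%C) by ring.
  by rewrite (SU11_det ab) (SU11_det cd) mulr1.
have de : mden (a * c + b * d^*%C) (a * d + b * c^*%C) z = mden a b (mobius c d z) * mden c d z.
  rewrite /mden mobiusE !conjcD !conjcM !conjcK -/(mden c d z) [RHS]mulrDl.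
  by rewrite [X in _ = X * _ + _]mulrA mulfVK// /mden; ring.
split => //.
have d1 := mden_neq0 ab g1.
have num : (a * c + b * d^*%C) * z + (a * d + b * c^*%C) =
    (a * mobius c d z + b) * mden c d z.
  rewrite mobiusE -/(mden c d z) [RHS]mulrDl [X in _ = X * _ + _]mulrA mulfVK//.
  by rewrite /mden; ring.
rewrite [RHS]mobiusE -/(mden _ _ z) de num [LHS]mobiusE -/(mden a b _).
by field; rewrite d1 dz.
Qed.

Definition is_mob g := exists2 p, SU11 p & g = mobius p.1 p.2.

Lemma mob_cabs_lt g z : is_mob g -> cabs z < 1 -> cabs (g z) < 1.
Proof.
move=> [[c d] /= cd ->] z1; have dz := mden_neq0 cd (ltW z1).
rewrite mobiusE -/(mden c d z) cabsM cabsV ltr_pdivrMr ?cabs_gt0// mul1r.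
rewrite -(ltr_pXn2r (n := 2)) ?nnegrE ?cabs_ge0// -subr_gt0.
have -> : cabs (mden c d z) ^+ 2 - cabs (c * z + d) ^+ 2 = 1 - cabs z ^+ 2.
  apply/(@complexI R); rewrite !rmorphB rmorph1 /= -!mul_conj /mden.
  rewrite !conjcD !conjcM !conjcK.
  have -> : (d^*%C * z + c^*%C) * (d * z^*%C + c) - (c * z + d) * (c^*%C * z^*%C + d^*%C) =
     (c * c^*%C - d * d^*%C) * (1 - z * z^*%C) by ring.
  by rewrite (SU11_det cd) mul1r.
by rewrite subr_gt0 expr_lt1 ?cabs_ge0.
Qed.

(** 1 - |g z|^2 is (1 - |z|^2) / |mden|^2, and |mden| is at most |c| + |d|. Composition of [holo]
    functions needs a smaller disk to be mapped into a smaller disk. *)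
Lemma mob_cabs_le (r : R) g : is_mob g -> 0 <= r -> r < 1 ->
  exists s : R, [/\ 0 <= s, s < 1 & forall z, cabs z <= r -> cabs (g z) <= s].
Proof.
move=> [[c d] /= cd ->] r0 r1.
pose m := (cabs c + cabs d) ^+ 2.
have m1 : 1 <= m.
  have := SU11_cabs cd; have := cabs_ge0 c; have := cabs_ge0 d; rewrite /m; nra.
have m0 : 0 < m by lra.
pose k := (1 - r ^+ 2) / m.
have k0 : 0 < k by rewrite divr_gt0// subr_gt0 expr_lt1.
have k1 : 0 <= 1 - k.
  by rewrite subr_ge0 ler_pdivrMr// mul1r (le_trans _ m1)// gerBl sqr_ge0.
exists (Num.sqrt (1 - k)); split; first exact: sqrtr_ge0.
  rewrite -(ltr_pXn2r (n := 2)) ?nnegrE ?sqrtr_ge0// sqr_sqrtr// expr1n.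
  by rewrite ltrBlDr ltrDl.
move=> z zr; have z1 : cabs z <= 1 by lra.
have dz := mden_neq0 cd z1.
rewrite -(ler_pXn2r (n := 2)) ?nnegrE ?sqrtr_ge0 ?cabs_ge0// sqr_sqrtr//.
have dz0 : 0 < cabs (mden c d z) ^+ 2 by rewrite exprn_gt0// cabs_gt0.
have E : 1 - cabs (mobius c d z) ^+ 2 = (1 - cabs z ^+ 2) / cabs (mden c d z) ^+ 2.
  have dz1 : cabs (mden c d z) ^+ 2 != 0 by rewrite gt_eqF.
  apply: (mulIf dz1); rewrite mulfVK ?gt_eqF// mulrBl mul1r -exprMn.
  rewrite -cabsM mobiusE -/(mden c d z) mulfVK//.
  apply/(@complexI R); rewrite !rmorphB rmorph1 /= -!mul_conj /mden.
  rewrite !conjcD !conjcM !conjcK.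
  have -> : (d^*%C * z + c^*%C) * (d * z^*%C + c) - (c * z + d) * (c^*%C * z^*%C + d^*%C) =
     (c * c^*%C - d * d^*%C) * (1 - z * z^*%C) by ring.
  by rewrite (SU11_det cd) mul1r.
have : k <= 1 - cabs (mobius c d z) ^+ 2.
  rewrite E /k ler_pM ?invr_ge0 ?(ltW m0) ?(ltW dz0)//.
  - by rewrite subr_ge0 expr_le1// ltW.
  - by rewrite lerB// ler_pXn2r ?nnegrE ?cabs_ge0.
  rewrite lef_pV2 ?posrE// /m ler_pXn2r ?nnegrE ?cabs_ge0 ?addr_ge0 ?cabs_ge0//.
  rewrite (le_trans (ler_cabsD _ _))// cabsM !cabs_conj addrC lerD2l.
  by rewrite ler_piMr ?cabs_ge0.
lra.
Qed.

Lemma mob_cabs1 g t : is_mob g -> cabs t = 1 -> cabs (g t) = 1.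
Proof.
move=> [[c d] /= cd ->] t1; have dz := mden_neq0 cd (_ : cabs t <= 1).
have {}dz : mden c d t != 0 by apply: dz; rewrite t1.
have tt : t * t^*%C = 1 by rewrite mul_conj t1 expr1n.
rewrite mobiusE -/(mden c d t) cabsM cabsV.
have -> : cabs (c * t + d) = cabs (mden c d t).
  have -> : c * t + d = t * (mden c d t)^*%C.
    rewrite /mden conjcD !conjcM !conjcK mulrDr mulrCA tt mulr1 addrC; congr (_ + _).
    by rewrite mulrC.
  by rewrite cabsM t1 mul1r cabs_conj.
by rewrite divff// gt_eqF// cabs_gt0.
Qed.

Lemma mob_holo g : is_mob g -> holo g (derive1 g).
Proof.
move=> [[a b] /= ab ->] r r0 r1; have [s s1 hs] := mobius_holo ab.
apply: eq_holo_on (holo_onS (ltW (lt_trans r1 s1)) hs) => // z zr.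
by rewrite mobius_derive1// (le_trans zr)// ltW.
Qed.

Lemma mob_derive1_neq0 g z : is_mob g -> cabs z <= 1 -> derive1 g z != 0.
Proof.
move=> [[a b] /= ab ->] z1; rewrite mobius_derive1// expf_neq0// invr_eq0.
exact: mden_neq0.
Qed.

Lemma mob_sqr_dist g z w : is_mob g -> cabs z <= 1 -> cabs w <= 1 ->
  (g z - g w) ^+ 2 = derive1 g z * derive1 g w * (z - w) ^+ 2.
Proof.
move=> [[a b] /= ab ->] z1 w1; rewrite mobiusB// !mobius_derive1//.
by have := mden_neq0 ab z1; have := mden_neq0 ab w1 => d1 d2; field; rewrite d1 d2.
Qed.

(** On the circle t g'(t) / g(t) is the derivative of the argument, which is positive, hence equal
    to |g'(t)|. This relates the moduli in the Martin function to the derivatives in D. *)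
Lemma mob_derive1_circle g t : is_mob g -> cabs t = 1 ->
  g t * (cabs (derive1 g t))%:C = t * derive1 g t.
Proof.
move=> [[c d] /= cd ->] t1; have t1' : cabs t <= 1 by rewrite t1.
have dz := mden_neq0 cd t1'.
have tt : t * t^*%C = 1 by rewrite mul_conj t1 expr1n.
rewrite mobius_derive1// mobiusE -/(mden c d t).
have -> : (cabs ((mden c d t)^-1 ^+ 2))%:C = (mden c d t * (mden c d t)^*%C)^-1.
  by rewrite cabsX cabsV mul_conj exprVn fmorphV.
have -> : c * t + d = t * (mden c d t)^*%C.
  rewrite /mden conjcD !conjcM !conjcK mulrDr mulrCA tt mulr1 addrC; congr (_ + _).
  by rewrite mulrC.
have dc : (mden c d t)^*%C != 0 by rewrite -cabs_gt0 cabs_conj cabs_gt0.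
by field; rewrite dz dc.
Qed.

Lemma mob_ext f g : is_mob f -> is_mob g -> (forall z, cabs z < 1 -> f z = g z) -> f = g.
Proof. by move=> [[a b] /= ab ->] [[c d] /= cd ->]; exact: mobius_ext. Qed.

(** The group law is given on the open disk; its extension to the closed disk makes it available at
    [t0]. *)
Lemma mob_comp f g h z : is_mob f -> is_mob g -> is_mob h ->
  (forall z, cabs z < 1 -> h z = f (g z)) -> cabs z <= 1 ->
  h z = f (g z) /\ derive1 h z = derive1 f (g z) * derive1 g z.
Proof.
move=> [[a b] /= ab ->] [[c d] /= cd ->] [[p q] /= pq ->] E z1.
have [g1 su c1 c2] := mobius_comp ab cd z1.
have -> : mobius p q = mobius (a * c + b * d^*%C) (a * d + b * c^*%C).
  apply: mobius_ext => // w w1; rewrite E//.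
  by have [_ _ -> _] := mobius_comp ab cd (ltW w1).
by rewrite !mobius_derive1// c1 c2 invfM exprMn.
Qed.

End Moebius.

(** * The maximum principle and outer functions *)

Section BoundedAnalytic.
Variable R : realType.
Local Notation C := R[i].
Local Notation mu := (@lebesgue_measure R).
Local Notation D := (`[0, 2 * pi]%classic : set R).
Implicit Types (z w : C) (x y r s t c : R).

(** On a smaller disk the kernel and its remainder are bounded, so integrability of [u] suffices. It
    applies to logarithms of outer functions and to limits of analytic functions. *)
Lemma holo_on_cauchy_transform (u : R -> C) r : cint u -> 0 <= r -> r < 1 ->
  holo_on r (fun z => cmean (fun x => u x * ckernel z x))
    (fun z => cmean (fun x => u x * ((cis x)^*%C * ckernel z x ^+ 2))).
Proof.
move=> ui r0 r1; pose c := (1 - r)^-1.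
have c0 : 0 < c by rewrite invr_gt0 subr_gt0.
have um := cint_cabs ui; have um0 : 0 <= rmean (fun x => cabs (u x)).
  by apply: rmean_ge0 => x _; exact: cabs_ge0.
have kc z x : cabs z <= r -> cabs (ckernel z x) <= c.
  move=> zr; rewrite (le_trans (cabs_ckernel _ _)) ?(le_lt_trans zr)//.
  by rewrite lef_pV2 ?posrE ?subr_gt0 ?(le_lt_trans zr)// lerB.
have kl z : cabs z <= r -> clip (ckernel z).
  by move=> zr; apply: clip_ckernel; exact: le_lt_trans r1.
have kl2 z : cabs z <= r -> clip (fun x => (cis x)^*%C * ckernel z x ^+ 2).
  move=> zr; apply: clipM; first by apply: clip_conj; exact: clip_cis.
  by apply: clipM; exact: kl.
have uk v : clip v -> cint (fun x => u x * v x).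
  move=> vc; have [L [B [_ _ _ vB]]] := vc.
  exact: cintM ui (clip_meas vc) (fun x _ => vB x).
exists (c ^+ 3 * rmean (fun x => cabs (u x))).
  by rewrite mulr_ge0// exprn_ge0// ltW.
move=> z w zr wr; set h := w - z.
have i1 := uk _ (kl w wr); have i2 := uk _ (kl z zr); have i3 := uk _ (kl2 z zr).
rewrite -(cmeanB i1 i2) mulrC -(cmeanZ h i3) -(cmeanB (cintB i1 i2) (cintZ h i3)).
apply: le_trans (ler_cmean _ (rintZ (c ^+ 3 * cabs h ^+ 2) um) _) _.
- by apply: cintB; [exact: cintB|exact: cintZ].
- move=> x _; set q := (cis x)^*%C.
  have q1 : cabs q = 1 by rewrite cabs_conj cabs_cis.
  have dz : 1 - z * q != 0 by exact: ckernel_den_neq0 (le_lt_trans zr r1).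
  have dw : 1 - w * q != 0 by exact: ckernel_den_neq0 (le_lt_trans wr r1).
  have -> : u x * ckernel w x - u x * ckernel z x - h * (u x * (q * ckernel z x ^+ 2)) =
     (h * q) ^+ 2 * (ckernel z x ^+ 2 * ckernel w x) * u x.
    by rewrite /ckernel -/q /h; field; rewrite dz dw.
  have -> : cabs ((h * q) ^+ 2 * (ckernel z x ^+ 2 * ckernel w x) * u x) =
      cabs (ckernel z x) ^+ 2 * cabs (ckernel w x) * cabs h ^+ 2 * cabs (u x).
    rewrite [LHS]cabsM [X in X * _ = _]cabsM (cabsX _ 2) [cabs (h * q)]cabsM q1 mulr1.
    by rewrite [cabs (_ * ckernel w x)]cabsM (cabsX _ 2) [in LHS]mulrC; ring.
  rewrite ler_wpM2r ?cabs_ge0//.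
  rewrite ler_wpM2r ?sqr_ge0// [leRHS]exprSr ler_pM ?sqr_ge0 ?cabs_ge0 ?kc//.
  by rewrite ler_pXn2r ?nnegrE ?cabs_ge0 ?kc// ltW.
rewrite (rmeanZ _ um) le_eqVlt; apply/orP; left; apply/eqP; ring.
Qed.

Lemma circle_CintegralE (F : C -> C) : cint (fun x => F (cis x)) ->
  circle_Cintegral F = cmean (fun x => F (cis x)).
Proof.
move=> [a b]; rewrite /circle_Cintegral /cmean /circle_integral.
have h f : rint f -> fine ((2 * pi)^-1%:E * \int[mu]_(x in D) (f x)%:E)%E = rmean f.
  by move=> fi; rewrite rmean_integral// -EFinM /= mulKf// gt_eqF// twopi_gt0.
by rewrite (h _ a) (h _ b).
Qed.

(** (e + z) / (e - z) is twice the Cauchy kernel minus 1, so the exponent is built from a Cauchy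
    transform of ln k; an exponential has no zeros. *)
Lemma outer_holo (phi : C -> C) : outer phi -> exists2 psi : C -> C,
  (exists psi', holo psi psi') &
  forall z, cabs z < 1 -> phi z = psi z /\ psi z != 0.
Proof.
move=> [c [k [c1 k0 ki phiE]]].
pose L x : C := (ln (k (cis x)))%:C.
have Li : cint L.
  split; first exact: ki.
  by apply: (rint_cst 0).
have kl z : cabs z < 1 -> clip (ckernel z) by exact: clip_ckernel.
pose G z := cmean (fun x => L x * ckernel z x); pose m := cmean L.
have GE z : cabs z < 1 -> circle_Cintegral (fun e : C => (e + z) / (e - z) * (ln (k e))%:C) =
    2 * G z - m.
  move=> z1; have e x : (cis x + z) / (cis x - z) * L x = 2 * (L x * ckernel z x) - L x.
    have d := ckernel_den_neq0 x z1; have ez : cis x - z = cis x * (1 - z * (cis x)^*%C).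
      by rewrite mulrBr mulr1 mulrCA cis_mul_conj mulr1.
    have -> : cis x + z = (cis x - z) + 2 * z by ring.
    have ne : cis x - z != 0 by rewrite ez mulf_neq0 ?cis_neq0.
    have -> : ckernel z x = cis x / (cis x - z).
      by rewrite /ckernel ez invfM mulrA mulfV ?cis_neq0 ?mul1r.
    by field.
  have i1 : cint (fun x => L x * ckernel z x).
    have [B1 [B [_ _ _ vB]]] := kl z z1.
    exact: cintM Li (clip_meas (kl z z1)) (fun x _ => vB x).
  have -> : circle_Cintegral (fun e : C => (e + z) / (e - z) * (ln (k e))%:C) =
      cmean (fun x => 2 * (L x * ckernel z x) - L x).
    rewrite circle_CintegralE; first by apply: eq_cmean => x _; rewrite -e.
    rewrite (_ : (fun x => _) = (fun x => 2 * (L x * ckernel z x) - L x)).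
      by apply: cintB => //; exact: cintZ.
    by apply/funext => x; rewrite -e.
  by rewrite (cmeanB (cintZ 2 i1) Li) (cmeanZ 2 i1).
exists (fun z => c * cexp (2 * G z - m)); last first.
  move=> z z1; split; first by rewrite phiE ?GE//; exact/diskE.
  rewrite mulf_neq0 ?cexp_neq0// -cabs_gt0 c1//.
pose G' z := cmean (fun x => L x * ((cis x)^*%C * ckernel z x ^+ 2)).
exists (fun z => c * (cexp (2 * G z - m) * (2 * G' z + 0))) => r r0 r1.
have hG : holo_on r (fun z => 2 * G z - m) (fun z => 2 * G' z + 0).
  apply: holo_onD; last exact: holo_on_cst.
  by apply: holo_onZ => //; exact: holo_on_cauchy_transform.
have [B B0 GB] := holo_on_bound r0 hG.
by apply: holo_onZ => //; exact: holo_on_comp (holo_on_cexp B0) hG.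
Qed.

Lemma ae_eq_rmean (f g : R -> R) : rint f -> rint g ->
  {ae mu, forall x, D x -> f x = g x} -> rmean f = rmean g.
Proof.
move=> fi gi fg; congr (_ * fine _).
apply: (@ae_eq_integral _ _ R mu D (EFin \o g) (EFin \o f) (@measurable_circle R)).
- exact: measurable_EFin (rint_measurable fi).
- exact: measurable_EFin (rint_measurable gi).
- by apply: ae_imp fg => x h Dx /=; rewrite h.
Qed.

Lemma ae_ler_rmean (f g : R -> R) : rint f -> rint g ->
  {ae mu, forall x, D x -> f x <= g x} -> rmean f <= rmean g.
Proof.
move=> fi gi fg; pose h x := Num.min (f x) (g x).
have hi : rint h.
  apply: rint_le (rintD (rint_norm fi) (rint_norm gi)) _.
    by apply: measurable_minr; exact: rint_measurable.
  move=> x _; rewrite /h; have [_|_] := lerP (f x) (g x).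
    by rewrite lerDl.
  by rewrite lerDr.
rewrite (ae_eq_rmean fi hi); last first.
  by apply: ae_imp fg => x k Dx; rewrite /h min_l ?k.
by apply: ler_rmean => // x _; rewrite /h ge_min lexx orbT.
Qed.

(** On [0, 2 pi] each point of the circle is met once, except for the common image of the end
    points; removing at most three parameters is enough. *)
Lemma ae_cis_neq (s : C) : {ae mu, forall x, D x -> cis x <> s}.
Proof.
have [[x1 [x10 x12 xs]]|nx] := pselect (exists x1, [/\ 0 < x1, x1 < 2 * pi & cis x1 = s]).
  apply: ae_imp (ae_finite [:: 0; 2 * pi; x1]) => x; rewrite !inE !negb_or.
  move=> /and3P[_ _ xx1] Dx cx.
  have d0 : 0 < `|x1 - x| by rewrite normr_gt0 subr_eq0 eq_sym.
  pose eta := Num.min `|x1 - x| (Num.min x1 (2 * pi - x1)).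
  have eta0 : 0 < eta by rewrite /eta !lt_min d0 x10 subr_gt0 x12.
  have [||k k0 hk] := @chord_far R x1 eta eta0.
  - by rewrite /eta !ge_min lexx !orbT.
  - by rewrite /eta !ge_min lexx !orbT.
  have h : k <= cabs (cis x - cis x1 : C) by apply: hk => //; rewrite /eta ge_min lexx.
  by move: h; rewrite cx xs subrr cabs0 leNgt k0.
apply: ae_imp (ae_finite [:: 0; 2 * pi]) => x; rewrite !inE !negb_or.
move=> /andP[x0 x2]; rewrite /= in_itv /= => /andP[x0' x2'] cx; apply: nx.
by exists x; split => //; rewrite lt_neqAle ?x0' ?x2' ?x2// eq_sym x0.
Qed.

Lemma stolz_radial (r : R) x : 0 <= r -> r < 1 -> stolz (cis x : C) 1 (r%:C * cis x).
Proof.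
move=> r0 r1; split; first by apply/diskE; rewrite cabs_rcis.
have -> : r%:C * cis x - cis x = - ((1 - r)%:C * cis x) :> C by rewrite rmorphB /=; ring.
by rewrite cabsN !cabs_rcis ?subr_ge0 ?mul1r// ltW.
Qed.

Lemma nontangential_radial (F : C -> C) (l : C) x : F @ nontangential (cis x) --> l ->
  forall e, 0 < e -> exists2 d, 0 < d & forall r, 0 <= r -> r < 1 -> 1 - r < d ->
    cabs (F (r%:C * cis x) - l) < e.
Proof.
move=> h e e0; have NF := nontangential_filter (cis x : C).
have /cvgC/(_ _ e0)/(_ 1)/nbhsC[d d0 H] := h.
exists d => // r r0 r1 rd; apply: H; last exact: stolz_radial.
have -> : r%:C * cis x - cis x = - ((1 - r)%:C * cis x) :> C by rewrite rmorphB /=; ring.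
by rewrite cabsN cabs_rcis// subr_ge0 ltW.
Qed.

Theorem fatou_nontangential (F F' : C -> C) (M : R) : holo F F' -> bounded_by F M ->
  exists u : R -> C, [/\ cint u,
    forall z, cabs z < 1 -> F z = cmean (fun x => u x * (pkernel z x)%:C) &
    {ae mu, forall x, D x -> F @ nontangential (cis x) --> u x}].
Proof.
move=> FF FM; have [u [rho [ui _ _ _ FE]]] := boundary_function FF FM.
exists u; split => //.
(* The end points are discarded because balls around them leave the interval of integration. *)
apply: ae_imp (ae_and (lebesgue_mean_complex ui) (ae_finite [:: 0; 2 * pi])) => x [h].
rewrite !inE negb_or => /andP[x0 x2] Dx; have := Dx; rewrite /= in_itv /= => /andP[x0' x2'].
apply: nontangential_poisson => //; last exact: h.
- by rewrite lt_neqAle eq_sym x0.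
- by rewrite lt_neqAle x2.
Qed.

Lemma cabs_boundary_le (F : C -> C) (l : C) x (m : R) :
  F @ nontangential (cis x) --> l ->
  (forall e d, 0 < e -> 0 < d -> exists r,
    [/\ 0 <= r, r < 1, 1 - r < d & cabs (F (r%:C * cis x)) <= m + e]) -> cabs l <= m.
Proof.
move=> h hF; apply/ler_addgt0Pr => e e0; have e2 : 0 < e / 2 by rewrite divr_gt0.
have [d d0 H] := nontangential_radial h e2.
have [r [r0 r1 rd Fr]] := hF _ _ e2 d0.
rewrite -(subrK (F (r%:C * cis x)) l) (le_trans (ler_cabsD _ _))//.
by rewrite cabsBC; have := H _ r0 r1 rd; lra.
Qed.

(** The boundary limit exists almost everywhere, so it can be bounded along radii that depend on the
    point and tend to 1; Poisson's formula carries the bound inside. *)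
Lemma maximum_principle (F F' : C -> C) (M : R) : holo F F' -> bounded_by F M ->
  {ae mu, forall x, D x -> forall e d, 0 < e -> 0 < d -> exists r,
    [/\ 0 <= r, r < 1, 1 - r < d & cabs (F (r%:C * cis x)) <= 1 + e]} ->
  bounded_by F 1.
Proof.
move=> FF FM hF; have [u [ui FE cu]] := fatou_nontangential FF FM.
have u1 : {ae mu, forall x, D x -> cabs (u x) <= 1}.
  apply: ae_imp (ae_and cu hF) => x [h1 h2] Dx.
  exact: cabs_boundary_le (h1 Dx) (h2 Dx).
move=> z z1; rewrite FE//.
have ki := clip_pkernel z1; have rki := rint_pkernel z1.
have uk : cint (fun y => u y * (pkernel z y)%:C).
  have [L [B [_ _ _ kB]]] := ki.
  exact: cintM ui (clip_meas ki) (fun y _ => kB y).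
rewrite (le_trans (ler_cmean uk (cint_cabs uk) (fun x _ => lexx _)))//.
rewrite -(rmean_pkernel z1); apply: ae_ler_rmean (cint_cabs uk) rki _.
apply: ae_imp u1 => x h Dx; have pk0 := pkernel_ge0 x (ltW z1).
by rewrite cabsM cabs_real ger0_norm// ler_piMl// h.
Qed.

End BoundedAnalytic.

(** * Sums over a Fuchsian group *)

Section GroupSums.
Variable R : realType.
Local Notation C := R[i].
Local Notation mu := (@lebesgue_measure R).
Local Notation D := (`[0, 2 * pi]%classic : set R).
Variables (Gamma : set (C -> C)) (t0 : C).
Hypothesis GF : fuchsian Gamma.
Hypothesis t01 : cabs t0 = 1.
Implicit Types (f g h : C -> C) (z : C).

(* The required element is unique, a Moebius map being determined by its values
   on the disk; off Gamma these are junk values. *)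
Definition ginv g : C -> C :=
  get [set h | Gamma h /\ forall z, cabs z < 1 -> h (g z) = z].
Definition gcomp f g : C -> C :=
  get [set h | Gamma h /\ forall z, cabs z < 1 -> h z = f (g z)].

Lemma fuchsian_mob g : Gamma g -> is_mob g.
Proof. exact: fuchsian_mobius. Qed.
Local Notation mobG := fuchsian_mob.

Lemma cabs_nat2 : cabs (2 : C) = 2.
Proof. by rewrite (_ : 2 = (2 : R)%:C) ?cabs_real ?ger0_norm// rmorph_nat. Qed.

Lemma derive1_idfun z : derive1 (idfun : C -> C) z = 1.
Proof.
have r0 : cabs z < cabs z + 1 by rewrite ltrDl.
exact: holo_on_derive1 (holo_on_id _) r0.
Qed.

Lemma gcompP f g : Gamma f -> Gamma g -> Gamma (gcomp f g) /\
  forall z, cabs z <= 1 -> gcomp f g z = f (g z) /\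
    derive1 (gcomp f g) z = derive1 f (g z) * derive1 g z.
Proof.
move=> Gf Gg; have [h Gh hE] := fuchsian_comp GF Gf Gg.
have [G1 E1] : Gamma (gcomp f g) /\ forall z, cabs z < 1 -> gcomp f g z = f (g z).
  have hE' : [set h | Gamma h /\ forall z, cabs z < 1 -> h z = f (g z)] h.
    by split => // z z1; apply: hE; exact/diskE.
  exact: getPex (ex_intro _ h hE').
by split => // z; apply: mob_comp => //; exact: mobG.
Qed.

Lemma ginv_subproof g : Gamma g -> Gamma (ginv g) /\
  forall z, cabs z <= 1 -> ginv g (g z) = z /\
    derive1 (ginv g) (g z) * derive1 g z = 1.
Proof.
move=> Gg; have [h Gh hE] := fuchsian_inv GF Gg.
have [G1 E1] : Gamma (ginv g) /\ forall z, cabs z < 1 -> ginv g (g z) = z.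
  have hE' : [set h | Gamma h /\ forall z, cabs z < 1 -> h (g z) = z] h.
    by split => // z z1; rewrite -hE//; exact/diskE.
  exact: getPex (ex_intro _ h hE').
split => // z z1.
have E2 : forall y, cabs y < 1 -> (idfun : C -> C) y = ginv g (g y).
  by move=> y y1; rewrite E1.
have [e1 e2] := mob_comp (mobG G1) (mobG Gg) (mobG (fuchsian_id GF)) E2 z1.
by rewrite -e2 derive1_idfun -e1.
Qed.

Lemma ginvG g : Gamma g -> Gamma (ginv g).
Proof. by case/ginv_subproof. Qed.

Lemma ginvl g z : Gamma g -> cabs z <= 1 -> ginv g (g z) = z.
Proof. by case/ginv_subproof => _ h /h[]. Qed.

Lemma ginvK g : Gamma g -> ginv (ginv g) = g.
Proof.
move=> Gg; apply: mob_ext.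
- exact/mobG/ginvG/ginvG.
- exact: mobG.
move=> z z1; rewrite -{1}(ginvl Gg (ltW z1)) ginvl//; first exact: ginvG.
by apply/ltW/mob_cabs_lt => //; exact: mobG.
Qed.

Lemma ginvr g z : Gamma g -> cabs z <= 1 -> g (ginv g z) = z.
Proof. by move=> Gg z1; rewrite -{1}(ginvK Gg) ginvl//; exact: ginvG. Qed.

Lemma ginv_derive1 g z : Gamma g -> cabs z <= 1 ->
  derive1 g (ginv g z) * derive1 (ginv g) z = 1.
Proof.
move=> Gg z1; have [_ h] := ginv_subproof (ginvG Gg).
by have [_] := h z z1; rewrite ginvK.
Qed.

Lemma ginv_id : ginv idfun = idfun.
Proof.
have Gi := fuchsian_id GF.
apply: mob_ext; [exact/mobG/ginvG|exact/mobG|].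
by move=> z z1; exact: (ginvl (fuchsian_id GF) (ltW z1)).
Qed.

(* Terms of the two expressions of the denominator of the theta series;
   [ttermE] exchanges them through g |-> g^-1. *)
Definition mterm g z := derive1 g t0 / (g t0 - z) ^+ 2.
Definition tterm g z := derive1 g z / (g z - t0) ^+ 2.
Definition weight g : R := cabs (derive1 g t0).

Lemma weight_ge0 g : 0 <= weight g. Proof. exact: cabs_ge0. Qed.

Lemma weight_gt0 g : Gamma g -> 0 < weight g.
Proof.
by move=> Gg; rewrite cabs_gt0 mob_derive1_neq0//; [exact: mobG|rewrite t01].
Qed.

Lemma orbit_cabs g : Gamma g -> cabs (g t0) = 1.
Proof. by move=> /mobG gm; exact: mob_cabs1. Qed.

Lemma orbitB_ge g z : Gamma g -> 1 - cabs z <= cabs (g t0 - z).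
Proof. by move=> Gg; rewrite (le_trans _ (ler_dist_cabs _ _))// orbit_cabs. Qed.

Lemma orbitB_neq0 g z : Gamma g -> cabs z < 1 -> g t0 - z != 0.
Proof.
by move=> Gg z1; rewrite -cabs_gt0 (lt_le_trans _ (orbitB_ge z Gg))// subr_gt0.
Qed.

(** With s = g^-1 t0, the identity (g z - g s)^2 = g'(z) g'(s) (z - s)^2 cancels the factor
    g'(z). *)
Lemma ttermE g z : Gamma g -> cabs z < 1 -> tterm g z = mterm (ginv g) z.
Proof.
move=> Gg z1; have t1 : cabs t0 <= 1 by rewrite t01.
have Gi := ginvG Gg; set s := ginv g t0.
have s1 : cabs s <= 1 by rewrite /s orbit_cabs.
have gs : g s = t0 by exact: ginvr.
have ds := ginv_derive1 Gg t1; rewrite -/s in ds.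
have sz : s - z != 0 := orbitB_neq0 Gi z1.
have d1 := mob_derive1_neq0 (mobG Gg) (ltW z1).
have d2 := mob_derive1_neq0 (mobG Gg) s1.
rewrite /tterm /mterm -/s -{1}gs (mob_sqr_dist (mobG Gg) (ltW z1) s1).
have -> : derive1 (ginv g) t0 = (derive1 g s)^-1.
  by apply: (mulfI d2); rewrite ds mulfV.
have -> : (z - s) ^+ 2 = (s - z) ^+ 2 by ring.
move: d1 d2 (sz); move: (derive1 g z) (derive1 g s) (s - z) => a b d a0 b0 d0.
by field; rewrite d0 a0 b0.
Qed.

Lemma hsumZ (c : C) (u : (C -> C) -> C) l : hsum Gamma u l -> hsum Gamma (fun i => c * u i) (c * l).
Proof.
move=> /hsumP h; apply/hsumP => e e0.
have c0 : 0 < cabs c + 1 by rewrite ltr_wpDl ?cabs_ge0.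
have [A AG AB] := h _ (divr_gt0 e0 c0); exists A => // B BG sAB.
rewrite -mulr_sumr -mulrBr cabsM; have := AB B BG sAB.
rewrite ltr_pdivlMr// mulrC; apply: le_lt_trans.
by rewrite ler_wpM2r ?cabs_ge0// lerDl.
Qed.

Lemma eq_hsum (u v : (C -> C) -> C) l : (forall g, Gamma g -> u g = v g) -> hsum Gamma u l -> hsum Gamma v l.
Proof.
move=> uv; rewrite /hsum; have -> // : u \_ Gamma = v \_ Gamma.
by apply/funext => g; rewrite !patchE; case: ifPn => // /set_mem/uv.
Qed.

Lemma hsum_unique (u : (C -> C) -> C) l l' : hsum Gamma u l -> hsum Gamma u l' -> l = l'.
Proof. by move=> /hsum_lim <- /hsum_lim <-. Qed.

Lemma hsum_ginv (u : (C -> C) -> C) l : hsum Gamma u l -> hsum Gamma (fun g => u (ginv g)) l.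
Proof. by apply: hsum_reindex; [exact: ginvG|exact: ginvG|exact: ginvK|exact: ginvK]. Qed.

Lemma hsum_gcomp (u : (C -> C) -> C) g l : Gamma g ->
  hsum Gamma u l -> hsum Gamma (fun f => u (gcomp f g)) l.
Proof.
move=> Gg; have Gi := ginvG Gg; have mi := mobG Gi; have mg := mobG Gg.
have K f k k' : Gamma f -> Gamma k -> Gamma k' -> (forall z, cabs z < 1 -> k (k' z) = z) ->
    gcomp (gcomp f k) k' = f.
  move=> Gf Gk Gk' kk; have [G1 E1] := gcompP Gf Gk; have [G2 E2] := gcompP G1 Gk'.
  apply: mob_ext; [exact: mobG|exact: mobG|] => z z1.
  have k1 : cabs (k' z) <= 1 by apply/ltW/mob_cabs_lt => //; exact: mobG.
  by rewrite (E2 z (ltW z1)).1 (E1 _ k1).1 kk.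
apply: (@hsum_reindex _ _ _ _ _ (fun f => gcomp f g) (fun f => gcomp f (ginv g))) => f Gf.
- by case: (gcompP Gf Gg).
- by case: (gcompP Gf Gi).
- by apply: K => // z z1; apply: ginvr => //; exact: ltW.
- by apply: K => // z z1; apply: ginvl => //; exact: ltW.
Qed.

Variables (F : nat -> {fset C -> C}) (W : R).
Hypothesis wW : forall B, fincl B Gamma -> \sum_(g <- B) weight g <= W.
Hypothesis FG : exhausts Gamma weight F.

Definition Dsum z := summability.sum ((mterm^~ z) \_ Gamma).

Lemma mterm_dominated (r : R) z : r < 1 -> cabs z <= r ->
  dominated Gamma weight (mterm^~ z) ((1 - r)^-1 ^+ 2).
Proof.
move=> r1 zr g Gg; rewrite /mterm cabsM mulrC ler_wpM2r ?cabs_ge0//.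
have r0 : 0 < 1 - r by rewrite subr_gt0.
have h : 1 - r <= cabs (g t0 - z) by rewrite (le_trans _ (orbitB_ge z Gg))// lerB.
rewrite cabsV cabsX -exprVn ler_pXn2r ?nnegrE ?invr_ge0 ?cabs_ge0 ?(ltW r0)//.
by rewrite lef_pV2// posrE// (lt_le_trans r0).
Qed.

Lemma Dsum_hsum z : cabs z < 1 -> hsum Gamma (mterm^~ z) (Dsum z).
Proof.
move=> z1; apply: (gsum_hsum FG _ (mterm_dominated z1 (lexx _))).
exact: sqr_ge0.
Qed.

Lemma tterm_hsum z : cabs z < 1 -> hsum Gamma (tterm^~ z) (Dsum z).
Proof.
move=> z1; apply: eq_hsum (hsum_ginv (Dsum_hsum z1)) => g Gg.
by rewrite ttermE.
Qed.

Lemma theta_denE z : cabs z < 1 -> theta_den Gamma t0 z = Dsum z.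
Proof. by move=> z1; exact: hsum_lim (tterm_hsum z1). Qed.

(** Right translation by [g] permutes the terms of the series, and the chain rule produces the
    factor. *)
Lemma Dsum_equivariant g z : Gamma g -> cabs z < 1 -> Dsum (g z) * derive1 g z = Dsum z.
Proof.
move=> Gg z1; have gz1 : cabs (g z) < 1 by apply: mob_cabs_lt => //; exact: mobG.
rewrite mulrC; have h := hsum_gcomp Gg (tterm_hsum z1); apply: (hsum_unique _ h).
apply: eq_hsum (hsumZ (tterm_hsum gz1)) => f Gf.
have [_ /(_ z (ltW z1))[E1 E2]] := gcompP Gf Gg.
rewrite /tterm E1 E2; set d := derive1 g z; set d' := derive1 f (g z).
by rewrite [d' * d]mulrC -mulrA.
Qed.

Lemma orbit_inv_le (r : R) g z : Gamma g -> r < 1 -> cabs z <= r ->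
  cabs (g t0 - z)^-1 <= (1 - r)^-1.
Proof.
move=> Gg r1 zr; have r0 : 0 < 1 - r by rewrite subr_gt0.
have h : 1 - r <= cabs (g t0 - z) by rewrite (le_trans _ (orbitB_ge z Gg))// lerB.
by rewrite cabsV lef_pV2// posrE// (lt_le_trans r0).
Qed.

Lemma Dsum_holo : exists D', holo Dsum D'.
Proof.
exists (fun z => summability.sum
  ((fun g => 2 * derive1 g t0 / (g t0 - z) ^+ 3) \_ Gamma)) => r r0 r1.
pose c := (1 - r)^-1; have c1 : 1 <= c by rewrite invf_ge1 ?subr_gt0// gerBl.
have c0 : 0 <= c by lra.
have cX m n : (m <= n)%N -> c ^+ m <= c ^+ n by move=> mn; exact: ler_weXn2l.
have p3 (a b d : C) : cabs a <= c -> cabs b <= c -> cabs d <= c -> cabs (a * b * d) <= c ^+ 3.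
  move=> ac bc dc; rewrite !cabsM exprSr expr2.
  by rewrite !ler_pM ?mulr_ge0 ?cabs_ge0.
have wg g := weight_ge0 g.
(* The remainder is a product of three inverse distances and a factor at most 3 c; as [c] is at
   least 1, the same constant bounds the terms and their derivatives. *)
apply: (holo_on_gsum wW FG (K := 3 * c ^+ 4)).
- by rewrite mulr_ge0 ?exprn_ge0.
- move=> z zr g Gg; rewrite (le_trans (mterm_dominated r1 zr Gg))// ler_wpM2r//.
  by rewrite -/c (le_trans (cX 2 4 isT))// ler_peMl ?exprn_ge0//; lra.
- move=> z zr g Gg; rewrite mulrAC cabsM ler_wpM2r ?cabs_ge0//.
  have oz := orbit_inv_le Gg r1 zr.
  have -> : 2 / (g t0 - z) ^+ 3 = 2 * ((g t0 - z)^-1 * (g t0 - z)^-1 * (g t0 - z)^-1).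
    have := orbitB_neq0 Gg (le_lt_trans zr r1); set s := g t0 - z => s0.
    by field.
  have h := p3 _ _ _ oz oz oz; rewrite cabsM cabs_nat2; have := cX 3 4 isT.
  have : 0 <= c ^+ 3 by rewrite exprn_ge0.
  lra.
- move=> z y zr yr g Gg; rewrite /mterm.
  have sz := orbitB_neq0 Gg (le_lt_trans zr r1); have sy := orbitB_neq0 Gg (le_lt_trans yr r1).
  have oz := orbit_inv_le Gg r1 zr; have oy := orbit_inv_le Gg r1 yr.
  set s := g t0 in sz sy oz oy *.
  have -> : derive1 g t0 / (s - y) ^+ 2 - derive1 g t0 / (s - z) ^+ 2 -
      2 * derive1 g t0 / (s - z) ^+ 3 * (y - z) =
    ((s - z)^-1 * (s - z)^-1 * (s - y)^-1) * ((s - y)^-1 + 2 * (s - z)^-1) *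
      (y - z) ^+ 2 * derive1 g t0.
    by move: (derive1 g t0) => d; field; rewrite sz sy.
  rewrite [leLHS]cabsM ler_wpM2r ?cabs_ge0// cabsM (cabsX _ 2) ler_wpM2r ?sqr_ge0//.
  rewrite cabsM (_ : 3 * c ^+ 4 = c ^+ 3 * (3 * c)); last by ring.
  rewrite ler_pM ?cabs_ge0 ?p3//.
  rewrite (le_trans (ler_cabsD _ _))// cabsM cabs_nat2; rewrite -/c in oy oz; lra.
Qed.

(** Termwise differentiation yields i g(t0) |g'(t0)| / (g t0 - z)^2, and g(t0) |g'(t0)| equals t0
    g'(t0). *)
Lemma martin_holo_subproof : holo (martin Gamma t0) (fun z => 'i%C * t0 * Dsum z).
Proof.
move=> r r0 r1.
pose fm g z := (g t0 + z) / (g t0 - z) * (weight g)%:C.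
pose fm' g z := 2 * t0 * mterm g z.
pose c := (1 - r)^-1; have c1 : 1 <= c by rewrite invf_ge1 ?subr_gt0// gerBl.
have c0 : 0 <= c by lra.
have c2 : c <= c ^+ 2 by rewrite expr2 ler_peMl.
have c3 : c ^+ 2 <= c ^+ 3 by rewrite [leRHS]exprS ler_peMl// sqr_ge0.
have two := cabs_nat2.
have circ g : Gamma g -> g t0 * (weight g)%:C = t0 * derive1 g t0.
  by move=> Gg; exact: mob_derive1_circle (mobG Gg) t01.
have dm z : cabs z <= r -> dominated Gamma weight (mterm^~ z) (c ^+ 2).
  exact: mterm_dominated.
have df : forall z, cabs z <= r -> dominated Gamma weight (fm'^~ z) (2 * c ^+ 3).
  move=> z zr g Gg; rewrite /fm' !cabsM t01 mulr1 two -mulrA ler_wpM2l//.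
  rewrite (le_trans _ (ler_wpM2r (weight_ge0 g) c3))//.
  by rewrite -cabsM; exact: dm.
have h : holo_on r (fun z => summability.sum ((fm^~ z) \_ Gamma))
    (fun z => summability.sum ((fm'^~ z) \_ Gamma)).
  apply: (holo_on_gsum wW FG (K := 2 * c ^+ 3)).
  - by rewrite mulr_ge0 ?exprn_ge0.
  - move=> z zr g Gg; rewrite /fm cabsM cabs_real ger0_norm ?weight_ge0//.
    rewrite ler_wpM2r ?weight_ge0// cabsM (@le_trans _ _ (2 * c))//.
      rewrite ler_pM ?cabs_ge0 ?orbit_inv_le//.
      by rewrite (le_trans (ler_cabsD _ _))// orbit_cabs//; lra.
    by rewrite ler_pM2l// (le_trans c2).
  - exact: df.
  - move=> z y zr yr g Gg; rewrite /fm /fm' /mterm.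
    have sz := orbitB_neq0 Gg (le_lt_trans zr r1); have sy := orbitB_neq0 Gg (le_lt_trans yr r1).
    have oz := orbit_inv_le Gg r1 zr; have oy := orbit_inv_le Gg r1 yr.
    have s1 := orbit_cabs Gg; have cg := circ g Gg.
    set s := g t0 in sz sy oz oy s1 cg *.
    have -> : (s + y) / (s - y) * (weight g)%:C - (s + z) / (s - z) * (weight g)%:C -
        2 * t0 * (derive1 g t0 / (s - z) ^+ 2) * (y - z) =
      2 * ((s - z)^-1 * (s - z)^-1 * (s - y)^-1) * (y - z) ^+ 2 * (s * (weight g)%:C).
      have -> : 2 * t0 * (derive1 g t0 / (s - z) ^+ 2) * (y - z) =
        2 * (t0 * derive1 g t0) / (s - z) ^+ 2 * (y - z).
        by move: (derive1 g t0) => d; ring.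
      by rewrite -cg; move: (weight g)%:C => d; field; rewrite sz sy.
    rewrite [leLHS]cabsM [cabs (s * _)]cabsM s1 mul1r cabs_real ger0_norm ?weight_ge0//.
    rewrite ler_wpM2r ?weight_ge0// cabsM (cabsX _ 2) ler_wpM2r ?sqr_ge0//.
    rewrite cabsM two ler_wpM2l// !cabsM exprSr expr2.
    by rewrite !ler_pM ?mulr_ge0 ?cabs_ge0.
have r2 : 0 <= 2 * c ^+ 3 by rewrite mulr_ge0// exprn_ge0.
apply: eq_holo_on (holo_onZ ('i%C / 2) r0 h) => z zr.
  rewrite /martin /gsum; suff -> : fm^~ z =
    (fun g => (g t0 + z) / (g t0 - z) * `|derive1 g t0|) by [].
  by apply/funext => g; rewrite /fm /weight cabsE.
have -> : fm'^~ z = (fun g => 2 * t0 * mterm g z) by [].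
rewrite (gsum_scale FG _ (sqr_ge0 c) (dm z zr)) -/(Dsum z).
by rewrite !mulrA mulfVK// pnatr_eq0.
Qed.

Lemma martin_derive1 z : cabs z < 1 -> derive1 (martin Gamma t0) z = 'i%C * t0 * Dsum z.
Proof. exact: holo_derive1 martin_holo_subproof. Qed.

End GroupSums.

(** * Boundary behaviour of the Martin function *)

Section MartinBoundary.
Variable R : realType.
Local Notation C := R[i].
Local Notation mu := (@lebesgue_measure R).
Local Notation D := (`[0, 2 * pi]%classic : set R).

Lemma mean_value_property (r : R) (F F' : C -> C) : 0 <= r -> holo_on r F F' ->
  cmean (fun x => F (r%:C * cis x)) = F 0.
Proof.
move=> r0 FF; have z0 : cabs (0 : C) < 1 by rewrite cabs0.
have := cauchy_formula (holo_on_scale r0 FF) z0; rewrite mulr0 => <-.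
by apply: eq_cmean => x _; rewrite /ckernel mul0r subr0 invr1 mulr1.
Qed.

Lemma holo_on_sum (I : eqType) (s : seq I) (r : R) (f f' : I -> C -> C) : 0 <= r ->
  (forall i, i \in s -> holo_on r (f i) (f' i)) ->
  holo_on r (fun z => \sum_(i <- s) f i z) (fun z => \sum_(i <- s) f' i z).
Proof.
move=> r0; elim: s => [|a s IH] h.
  by apply: eq_holo_on (holo_on_cst r 0) => z _; rewrite big_nil.
have h1 := h a (mem_head _ _).
have h2 : holo_on r (fun z => \sum_(i <- s) f i z) (fun z => \sum_(i <- s) f' i z).
  by apply: IH => i si; apply: h; rewrite in_cons si orbT.
by apply: eq_holo_on (holo_onD h1 h2) => z _; rewrite big_cons.
Qed.

Lemma ae_seq (I : eqType) (s : seq I) (P : I -> R -> Prop) :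
  (forall i, i \in s -> {ae mu, forall x, P i x}) ->
  {ae mu, forall x, forall i, i \in s -> P i x}.
Proof.
elim: s => [|a s IH] h; first exact: aeW.
have h1 := h a (mem_head _ _).
have h2 : {ae mu, forall x, forall i, i \in s -> P i x}.
  by apply: IH => i si; apply: h; rewrite in_cons si orbT.
apply: ae_imp (ae_and h1 h2) => x [Pa Ps] i.
by rewrite in_cons => /orP[/eqP->//|]; exact: Ps.
Qed.

Lemma series_terms_cvg0 (a : nat -> R) (B : R) : (forall n, 0 <= a n) ->
  (forall n, \sum_(0 <= k < n) a k <= B) ->
  forall e, 0 < e -> \forall n \near \oo, a n < e.
Proof.
move=> a0 aB e e0; have c : cvgn (series a).
  apply: nondecreasing_is_cvgn; first by apply: nondecreasing_series => n _ _.
  by exists B => _ [n _ <-]; exact: aB.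
have /cvgrPdist_lt/(_ _ e0) := cvg_series_cvg_0 c; apply: filterS => n.
by rewrite sub0r normrN ger0_norm.
Qed.

Variables (Gamma : set (C -> C)) (t0 : C).
Hypothesis GF : fuchsian Gamma.
Hypothesis t01 : cabs t0 = 1.
Variables (F : nat -> {fset C -> C}) (W : R).
Hypothesis wW : forall B, fincl B Gamma -> \sum_(g <- B) weight t0 g <= W.
Hypothesis FG : exhausts Gamma (weight t0) F.
Implicit Types (B : {fset C -> C}).

Let mobG g : Gamma g -> is_mob g. Proof. exact: fuchsian_mob. Qed.
Let w0 : forall g, 0 <= weight t0 g. Proof. exact: weight_ge0. Qed.

Definition martin_term (g : C -> C) z : C :=
  'i%C / 2 * ((g t0 + z) / (g t0 - z) * (weight t0 g)%:C).

Definition Msum (B : {fset C -> C}) z : R :=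
  \sum_(g <- B) weight t0 g / cabs (g t0 - z) ^+ 2.

Definition martin_fin B z := \sum_(g <- B) martin_term g z.

(** This is half the Poisson kernel of the orbit point times the mass |g'(t0)|. Positivity of the
    terms makes finite parts lower bounds for Im m. *)
Lemma Im_martin_term g z : Gamma g -> cabs z < 1 ->
  complex.Im (martin_term g z) =
    (1 - cabs z ^+ 2) / 2 * (weight t0 g / cabs (g t0 - z) ^+ 2).
Proof.
move=> Gg z1; have s1 := orbit_cabs GF t01 Gg; have sz := orbitB_neq0 GF t01 Gg z1.
rewrite /martin_term; set s := g t0 in s1 sz *.
have sz0 : cabs (s - z) ^+ 2 != 0 by rewrite expf_neq0// cabs_eq0.
have -> : (s + z) / (s - z) = (cabs (s - z) ^- 2)%:C * ((s + z) * (s - z)^*%C).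
  rewrite fmorphV /= -mul_conj.
  have szc : (s - z)^*%C != 0 by rewrite -cabs_eq0 cabs_conj cabs_eq0.
  by move: szc; move: (s - z)^*%C => d d0; field; rewrite sz d0.
have -> : 'i%C / 2 * ((cabs (s - z) ^- 2)%:C * ((s + z) * (s - z)^*%C) * (weight t0 g)%:C) =
   (cabs (s - z) ^- 2 * weight t0 g / 2)%:C * ('i%C * ((s + z) * (s - z)^*%C)).
  rewrite !rmorphM /= (_ : (2^-1)%:C = 2^-1) ?fmorphV ?rmorph_nat//; ring.
rewrite ImZ ImM /= mul0r mul1r add0r conjcB.
have -> : complex.Re ((s + z) * (s^*%C - z^*%C)) = cabs s ^+ 2 - cabs z ^+ 2.
  rewrite !cabs2; case: (s) (z) => a b [c d] /=; ring.
by rewrite s1 expr1n; ring.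
Qed.

Lemma martin_hsum z : cabs z < 1 -> hsum Gamma (martin_term^~ z) (martin Gamma t0 z).
Proof.
move=> z1; pose fm g : C := (g t0 + z) / (g t0 - z) * (weight t0 g)%:C.
have -> : martin Gamma t0 z = 'i%C / 2 * summability.sum (fm \_ Gamma).
  rewrite /martin /gsum; suff -> : fm =
    (fun g => (g t0 + z) / (g t0 - z) * `|derive1 g t0|) by [].
  by apply/funext => g; rewrite /fm /weight cabsE.
apply: hsumZ; apply: (gsum_hsum FG (K := 2 * (1 - cabs z)^-1)).
  by rewrite mulr_ge0// invr_ge0 subr_ge0 ltW.
move=> g Gg; rewrite /fm cabsM cabs_real ger0_norm// ler_wpM2r// cabsM.
rewrite ler_pM ?cabs_ge0 ?(orbit_inv_le GF t01 Gg z1)//.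
by rewrite (le_trans (ler_cabsD _ _))// (orbit_cabs GF t01 Gg); lra.
Qed.

Lemma Im_sum (I : Type) (s : seq I) (u : I -> C) :
  complex.Im (\sum_(i <- s) u i) = \sum_(i <- s) complex.Im (u i).
Proof. by elim: s => [|a s IH]; rewrite ?big_nil// !big_cons ImD IH. Qed.

Lemma Im_martin_fin B z : fincl B Gamma -> cabs z < 1 ->
  complex.Im (martin_fin B z) = (1 - cabs z ^+ 2) / 2 * Msum B z.
Proof.
move=> BG z1; rewrite /martin_fin /Msum Im_sum mulr_sumr.
rewrite big_seq [RHS]big_seq; apply: eq_bigr => g gB.
by rewrite Im_martin_term//; exact: BG.
Qed.

Lemma Msum_ge0 B z : 0 <= Msum B z.
Proof. by apply: sumr_ge0 => g _; rewrite divr_ge0// exprn_ge0 ?cabs_ge0. Qed.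

Lemma Im_martin_ge B z : fincl B Gamma -> cabs z < 1 ->
  complex.Im (martin_fin B z) <= complex.Im (martin Gamma t0 z).
Proof.
move=> BG z1; apply/ler_addgt0Pr => e e0.
have /hsumP/(_ _ e0)[A AG AB] := martin_hsum z1.
have UG : fincl (A `|` B)%fset Gamma.
  by move=> g; rewrite finmap.inE => /orP[/AG|/BG].
have := AB _ UG (fsubsetUl _ _); set S := \sum_(i <- _) _ => hS.
have pos g : Gamma g -> 0 <= complex.Im (martin_term g z).
  move=> Gg; rewrite Im_martin_term//.
  rewrite mulr_ge0// divr_ge0// ?exprn_ge0 ?cabs_ge0//.
  by rewrite subr_ge0 expr_le1 ?cabs_ge0// ltW.
have BS : complex.Im (martin_fin B z) <= complex.Im S.
  rewrite /S /martin_fin !Im_sum [leRHS](big_fsetID +%R (fun g => g \in B)) /=.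
  have -> : [fset x in (A `|` B)%fset | x \in B]%fset = B.
    apply/fsetP => i; rewrite !finmap.inE /=; apply/andP/idP => [[]//|iB].
    by rewrite iB orbT.
  rewrite lerDl big_seq sumr_ge0// => g; rewrite !finmap.inE /= => /andP[gU _].
  by apply/pos/UG; rewrite finmap.inE.
have := ler_Im_cabs (S - martin Gamma t0 z); rewrite ImB ler_norml => /andP[_ h].
lra.
Qed.

Lemma Msum_radial B x : (forall g, g \in B -> Gamma g /\ cis x <> g t0) ->
  exists2 K : R, 0 <= K & forall r, 0 <= r -> r < 1 ->
    `|Msum B (r%:C * cis x) - Msum B (cis x)| <= K * (1 - r).
Proof.
move=> hB; have {hB} : forall g, g \in enum_fset B -> Gamma g /\ cis x <> g t0 := hB.
rewrite /Msum; elim: (enum_fset B) => [|g s IH] h.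
  by exists 0 => // r _ _; rewrite !big_nil subrr normr0 mul0r.
have [K K0 hK] := IH (fun f fs => h f (mem_behead (s := g :: s) fs)).
have [Gg gx] := h g (mem_head _ _).
pose A := cabs (g t0 - cis x).
have A0 : 0 < A by rewrite cabs_gt0 subr_eq0; apply/eqP => /esym.
have A2 : A <= 2.
  by rewrite (le_trans (ler_cabsB _ _))// (orbit_cabs GF t01 Gg) cabs_cis; lra.
(* With E the distance to the orbit point from radius r, 16 / A^4 bounds (A + E) / (A^2 E^2), since
   A + E <= 4 and E >= A / 2. *)
exists (weight t0 g * 16 / A ^+ 4 + K).
  by rewrite addr_ge0// divr_ge0 ?exprn_ge0 ?(ltW A0)// mulr_ge0.
move=> r r0 r1; rewrite !big_cons opprD addrACA (le_trans (ler_normD _ _))//.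
rewrite mulrDl lerD ?hK// -mulrBr normrM ger0_norm// -mulrA -mulrA ler_wpM2l//.
set E := cabs (g t0 - _); rewrite -/A.
have EA : `|A - E| <= 1 - r.
  have hr : cabs (cis x - r%:C * cis x : C) = 1 - r.
    have -> : cis x - r%:C * cis x = (1 - r)%:C * cis x :> C by rewrite rmorphB /=; ring.
    by rewrite cabs_rcis// subr_ge0 ltW.
  have h1 := cabs_dist_triangle (cis x) (g t0) (r%:C * cis x).
  have h2 := cabs_dist_triangle (r%:C * cis x) (g t0) (cis x).
  rewrite (cabsBC (r%:C * cis x)) in h2; rewrite hr in h1 h2.
  by rewrite ler_norml; apply/andP; split; rewrite /A /E; lra.
(* An orbit point is at distance at least 1 - r from the point of radius r; together with |A - E| <=
   1 - r this gives E >= A / 2 for every radius. *)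
have Er : 1 - r <= E.
  by rewrite (le_trans _ (orbitB_ge GF t01 _ Gg))// cabs_rcis.
have AE : A / 2 <= E.
  by have := ler_norm (A - E); lra.
have E0 : 0 < E by lra.
have E4 : E <= 2.
  rewrite (le_trans (ler_cabsB _ _))// (orbit_cabs GF t01 Gg) cabs_rcis//; lra.
have -> : (E ^+ 2)^-1 - (A ^+ 2)^-1 = (A - E) * ((A + E) / (A ^+ 2 * E ^+ 2)).
  by field; rewrite !gt_eqF.
rewrite normrM [leRHS](_ : _ = (1 - r) * (16 / A ^+ 4)); last by ring.
rewrite ler_pM//.
rewrite ger0_norm; last by rewrite divr_ge0 ?mulr_ge0 ?exprn_ge0 ?addr_ge0 ?(ltW A0) ?(ltW E0).
rewrite ler_pdivrMr ?mulr_gt0 ?exprn_gt0//.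
have -> : 16 / A ^+ 4 * (A ^+ 2 * E ^+ 2) = 16 * (E / A) ^+ 2.
  by field; rewrite gt_eqF.
have : 4^-1 <= (E / A) ^+ 2.
  rewrite (_ : 4^-1 = (2^-1) ^+ 2); last by rewrite exprVn -natrX.
  rewrite ler_pXn2r ?nnegrE ?divr_ge0 ?invr_ge0 ?(ltW A0) ?(ltW E0)//.
  by rewrite ler_pdivlMr// mulrC.
lra.
Qed.

Lemma martin_term_holo g r : Gamma g -> 0 <= r -> r < 1 ->
  holo_on r (martin_term g) (fun z => 'i%C * g t0 * (weight t0 g)%:C / (g t0 - z) ^+ 2).
Proof.
move=> Gg r0 r1.
have hs : holo_on r (fun z => g t0 - z) (fun=> -1).
  apply: eq_holo_on (holo_onD (holo_on_cst r (g t0)) (holo_onZ (-1) r0 (holo_on_id r))) => z _.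
    by rewrite mulN1r.
  by rewrite add0r mulr1.
have hp : holo_on r (fun z => g t0 + z) (fun=> 1).
  apply: eq_holo_on (holo_onD (holo_on_cst r (g t0)) (holo_on_id r)) => // z _.
  by rewrite add0r.
have c0 : 0 < 1 - r by rewrite subr_gt0.
have hc z : cabs z <= r -> 1 - r <= cabs (g t0 - z).
  by move=> zr; rewrite (le_trans _ (orbitB_ge GF t01 z Gg))// lerB.
have h := holo_onZ ('i%C / 2 * (weight t0 g)%:C) r0
  (holo_onM r0 hp (holo_onV r0 c0 hc hs)).
apply: eq_holo_on h => z zr; rewrite /martin_term; first by ring.
have sz := orbitB_neq0 GF t01 Gg (le_lt_trans zr r1).
by field.
Qed.

Let martin_holo := martin_holo_subproof GF t01 wW FG.

Lemma martin_tail n : cabs (martin Gamma t0 0 - martin_fin (F n) 0) <= (2^-1) ^+ n.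
Proof.
have z0 : cabs (0 : C) < 1 by rewrite cabs0.
have d : dominated Gamma (weight t0) (martin_term^~ 0) 1.
  move=> g Gg; rewrite /martin_term addr0 subr0 mulfV ?mul1r; last first.
    by rewrite -cabs_gt0 (orbit_cabs GF t01 Gg).
  rewrite !cabsM cabs_i mul1r cabs_real ger0_norm// ler_piMl//.
  by rewrite cabsV cabs_nat2 invf_le1 ?ltr0n ?ler1n.
have [FGn _ _] := FG.
apply/ler_addgt0Pr => e e0; have /hsumP/(_ _ e0)[A AG AB] := martin_hsum z0.
have UG : fincl (A `|` F n)%fset Gamma.
  by move=> g; rewrite finmap.inE => /orP[/AG|/FGn].
have h1 := AB _ UG (fsubsetUl _ _).
have h2 := dominated_tail FG ler01 d UG (fsubsetUr _ _); rewrite mul1r in h2.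
rewrite (le_trans (cabs_dist_triangle (\sum_(i <- (A `|` F n)%fset) martin_term i 0) _ _))//.
by rewrite addrC lerD// cabsBC ltW.
Qed.

Lemma martin_fin_holo B r : fincl B Gamma -> 0 <= r -> r < 1 -> holo_on r (martin_fin B)
  (fun z => \sum_(g <- B) 'i%C * g t0 * (weight t0 g)%:C / (g t0 - z) ^+ 2).
Proof. by move=> BG r0 r1; apply: holo_on_sum => // g /BG Gg; exact: martin_term_holo. Qed.

(* The imaginary part of the n-th finite sum tends to zero radially almost
   everywhere, while the mean of the rest is its value at 0, at most 2^-n; radii
   can thus be chosen so that the means are summable. *)
Lemma martin_vanishing : exists rho : nat -> R, [/\ forall n, 0 < rho n < 1,
  forall e, 0 < e -> \forall n \near \oo, 1 - rho n < e &
  {ae mu, forall x, D x -> forall e, 0 < e -> \forall n \near \oo,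
    complex.Im (martin Gamma t0 ((rho n)%:C * cis x)) < e}].
Proof.
have [FGn _ _] := FG.
pose v r x := complex.Im (martin Gamma t0 (r%:C * cis x)).
pose vn n r x := complex.Im (martin_fin (F n) (r%:C * cis x)).
(* The finite sums are not uniformly bounded near the orbit points; truncation at 1 makes dominated
   convergence available and leaves small values unchanged. *)
pose m n r x := Num.min 1 (vn n r x).
have re r x : 0 < r < 1 -> cabs (r%:C * cis x : C) < 1.
  by move=> /andP[/ltW r0 r1]; rewrite cabs_rcis.
have vi r : 0 < r < 1 -> cint (fun x => martin Gamma t0 (r%:C * cis x)).
  by move=> /andP[/ltW r0 r1]; apply/clip_int; exact: clip_circle r0 (martin_holo r0 r1).
have vni n r : 0 < r < 1 -> cint (fun x => martin_fin (F n) (r%:C * cis x)).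
  move=> /andP[/ltW r0 r1]; apply/clip_int.
  exact: clip_circle r0 (martin_fin_holo (FGn n) r0 r1).
have vnE n r x : 0 < r < 1 -> vn n r x = (1 - r ^+ 2) / 2 * Msum (F n) (r%:C * cis x).
  move=> r1; rewrite /vn Im_martin_fin ?re//; case/andP: r1 => /ltW r0 _.
  by rewrite cabs_rcis.
have vn0 n r x : 0 < r < 1 -> 0 <= vn n r x.
  move=> r1; rewrite vnE// mulr_ge0 ?Msum_ge0// divr_ge0// subr_ge0.
  by case/andP: r1 => r0 r1; rewrite expr_le1// ltW.
have mi n r : 0 < r < 1 -> rint (m n r).
  move=> r1; apply: rint_le (rint_cst 1) _.
    apply: measurable_minr; first exact: measurable_cst.
    by apply: rint_measurable; case: (vni n r r1).
  move=> x _; rewrite ger0_norm ?ge_min ?lexx//.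
  by rewrite le_min ler01 vn0.
pose rk k : R := 1 - k.+2%:R^-1.
have rk1 k : 0 < rk k < 1.
  rewrite subr_gt0 invf_lt1 ?ltr0n ?ltr1n//= ltrBlDr ltrDl invr_gt0 ltr0n//.
have aeF n : {ae mu, forall x, D x -> forall g, g \in F n -> Gamma g /\ cis x <> g t0}.
  have H := @ae_seq _ (F n) (fun g x => D x -> cis x <> g t0) (fun g _ => @ae_cis_neq R (g t0)).
  apply: ae_imp H => x h Dx g gF; split; first exact: (FGn n g gF).
  exact: (h g gF Dx).
have step n : exists r, [/\ 0 < r < 1, 1 - n.+2%:R^-1 <= r & rmean (m n r) <= (2^-1) ^+ n].
  have [_ h] : rint (fun=> 0 : R) /\
      rmean (m n (rk k)) @[k --> \oo] --> rmean (fun=> 0 : R).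
    apply: (@rmean_dct R (fun k => m n (rk k)) (fun=> 0) (fun=> 1)).
    - by move=> k; apply: rint_measurable; exact: mi.
    - exact: measurable_cst.
    - exact: rint_cst.
    - move=> k x _; rewrite ger0_norm ?ge_min ?lexx//.
      by rewrite le_min ler01 vn0.
    - apply: ae_imp (aeF n) => x hx Dx; have [K K0 hK] := Msum_radial (hx Dx).
      apply/cvgrPdist_lt => e e0; pose c := K + Msum (F n) (cis x) + 1.
      have c0 : 0 < c by rewrite ltr_wpDl// addr_ge0// Msum_ge0.
      have := near_infty_natSinv_lt (PosNum (divr_gt0 e0 c0)); apply: filterS => k /= ke.
      rewrite sub0r normrN ger0_norm; last by rewrite le_min ler01 vn0.
      rewrite gt_min; apply/orP; right; rewrite vnE//.
      have /andP[r0 r1] := rk1 k; have h1 := hK _ (ltW r0) r1.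
      have h2 : Msum (F n) ((rk k)%:C * cis x) <= c.
        have := ler_norm (Msum (F n) ((rk k)%:C * cis x) - Msum (F n) (cis x)).
        have : K * (1 - rk k) <= K by rewrite ler_piMr// gerBl ltW.
        by rewrite /c; lra.
      have h3 : 1 - rk k < e / c.
        rewrite (lt_trans _ ke)// /rk subKr ltf_pV2 ?posrE ?ltr0n// ltr_nat//.
      rewrite (@le_lt_trans _ _ ((1 - rk k) * c))//; last by rewrite -ltr_pdivlMr.
      apply: ler_pM => //.
      + by rewrite divr_ge0// subr_ge0 expr_le1// ltW.
      + exact: Msum_ge0.
      + by nra.
  have e0 : 0 < (2^-1 : R) ^+ n by rewrite exprn_gt0// invr_gt0.
  rewrite rmean_cst in h; move/cvgrPdist_lt/(_ _ e0): h => h.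
  have [k [hk nk]] := filter_ex (filterI h (nbhs_infty_ge n)).
  exists (rk k); split => //.
    by rewrite lerB// lef_pV2 ?posrE ?ltr0n// ler_nat !ltnS.
  by rewrite ltW// (le_lt_trans _ hk)// sub0r normrN ler_norm.
have [rho rhoP] := choice step.
have r1 n : 0 < rho n < 1 by case: (rhoP n).
exists rho; split => //.
  by apply: natSinv_cvg1 => // n; case: (rhoP n).
pose f n x := (v (rho n) x - vn n (rho n) x) + m n (rho n) x.
have ti n : rint (fun x => v (rho n) x - vn n (rho n) x).
  by apply: rintB; [case: (vi _ (r1 n))|case: (vni n _ (r1 n))].
have fi n : rint (f n) by apply: rintD => //; exact: mi.
have f0 n x : 0 <= f n x.
  rewrite addr_ge0//; last by rewrite le_min ler01 vn0.
  by rewrite subr_ge0; apply: Im_martin_ge; [exact: FGn|exact: re].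
have fm n : rmean (f n) <= 2 * (2^-1) ^+ n.
  rewrite (rmeanD (ti n) (mi _ _ (r1 n))) mulr2n mulrDl mul1r lerD//; last first.
    by case: (rhoP n).
  have /andP[/ltW ra rb] := r1 n.
  have e1 := mean_value_property ra (martin_holo ra rb).
  have e2 := mean_value_property ra (martin_fin_holo (FGn n) ra rb).
  have := cmeanB (vi _ (r1 n)) (vni n _ (r1 n)); rewrite e1 e2.
  move=> /(congr1 (@complex.Im R)).
  rewrite [LHS](_ : _ = rmean (fun x => v (rho n) x - vn n (rho n) x)); last first.
    by rewrite /cmean /=; apply: eq_rmean => x _; rewrite ImB.
  move=> ->; apply: le_trans (martin_tail n).
  by rewrite (le_trans (ler_norm _))// ler_Im_cabs.
apply: ae_imp (summable_means fi f0 fm) => x h Dx e e0.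
have [B hB] := h Dx.
have e1 : 0 < Num.min e 1 by rewrite lt_min e0 ltr01.
apply: filterS (series_terms_cvg0 (f0^~ x) hB e1) => n; rewrite lt_min => /andP[fe f1].
have ht : 0 <= v (rho n) x - vn n (rho n) x.
  by rewrite subr_ge0; apply: Im_martin_ge; [exact: FGn|exact: re].
(* Once [f n x] is below 1 the truncation is inactive, and [f n x] is exactly the imaginary part of
   m. *)
apply: le_lt_trans fe; rewrite -/(v (rho n) x) /f.
move: f1; rewrite /f /m; case: (lerP 1 (vn n (rho n) x)) => hv; first by lra.
by lra.
Qed.

(* Im m is at least about (1 - r) * Msum at the radius r and vanishes along some
   radii tending to 1, so in between |m'| must reach about Msum. *)
Lemma martin_lower B : fincl B Gamma -> {ae mu, forall x, D x -> forall e d,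
  0 < e -> 0 < d -> exists r, [/\ 0 <= r, r < 1, 1 - r < d,
    Msum B (cis x) - e <= cabs (Dsum Gamma t0 (r%:C * cis x)) &
    Msum B (r%:C * cis x) <= Msum B (cis x) + e]}.
Proof.
move=> BG; have [rho [rho01 rho1 cv]] := martin_vanishing.
have aeB := @ae_seq _ B (fun g x => D x -> cis x <> g t0) (fun g _ => @ae_cis_neq R (g t0)).
apply: ae_imp (ae_and cv aeB) => x [hv hB] Dx e d e0 d0.
have [K K0 hK] := Msum_radial (fun g gB => conj (BG g gB) (hB g gB Dx)).
set Mx := Msum B (cis x); have Mx0 : 0 <= Mx := Msum_ge0 _ _.
have S0 : 0 < 4 * (K + Mx + 1) by lra.
(* Over a length t the finite sum changes by at most K t. The last bound makes this change and the
   loss in the factor (1 - r^2) / 2 small compared with e. *)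
pose t := Num.min (Num.min (d / 2) 2^-1) (e / (4 * (K + Mx + 1))).
have tp : 0 < t by rewrite /t !lt_min !divr_gt0// invr_gt0 ltr0n.
have td : t <= d / 2 by rewrite /t !ge_min lexx.
have t2 : t <= 2^-1 by rewrite /t !ge_min lexx orbT.
have te : t * (4 * (K + Mx + 1)) <= e.
  by rewrite -ler_pdivlMr// /t !ge_min lexx !orbT.
pose r := 1 - t; have r0 : 0 <= r by rewrite /r; lra.
have r1 : r < 1 by rewrite /r; lra.
have ve0 : 0 < e / 4 * t by rewrite mulr_gt0// divr_gt0.
have [n [n1 n2]] := filter_ex (filterI (rho1 _ tp) (hv Dx _ ve0)).
have /andP[p0 p1] := rho01 n; set p := rho n in n1 n2 p0 p1.
have rp : r <= p by rewrite /r; lra.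
have good s : r <= s -> s <= p -> Mx - e <= cabs (Dsum Gamma t0 (s%:C * cis x)) ->
  exists r, [/\ 0 <= r, r < 1, 1 - r < d,
    Mx - e <= cabs (Dsum Gamma t0 (r%:C * cis x)) & Msum B (r%:C * cis x) <= Mx + e].
  move=> rs sp h; have s1 := le_lt_trans sp p1; have s0 := le_trans r0 rs.
  exists s; split => //; first by rewrite /r in rs; lra.
  have := ler_norm (Msum B (s%:C * cis x) - Mx); have := hK s s0 s1; rewrite -/Mx.
  by rewrite /r in rs; nra.
have [[s [rs sp h]]|ns] := pselect (exists s, [/\ r <= s, s <= p &
  Mx - e <= cabs (Dsum Gamma t0 (s%:C * cis x))]); first exact: good s rs sp h.
(* If |D| stayed at most Mx - e on [r, p], then Im m would drop by at most (Mx - e) t, whereas it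
   falls from at least (Mx - e / 2) t to less than (e / 4) t. *)
exfalso.
have small s : r <= s <= p -> cabs (Dsum Gamma t0 (s%:C * cis x)) <= Mx - e.
  move=> /andP[rs sp]; apply: ltW; rewrite ltNge; apply/negP => h.
  by apply: ns; exists s.
have B0 : 0 <= Mx - e by rewrite (le_trans (cabs_ge0 _) (small r _))// lexx rp.
have [L L0 hL] := martin_holo (ltW p0) p1.
have inc := @quadratic_increment R (fun s => martin Gamma t0 (s%:C * cis x)) r p (Mx - e) L
  rp L0.
have {}inc : cabs (martin Gamma t0 (p%:C * cis x) - martin Gamma t0 (r%:C * cis x)) <=
    (Mx - e) * (p - r).
  apply: inc => s u rsp rup.
  have [s0 sp] : 0 <= s /\ s <= p by case/andP: rsp => a ->; split=> //; exact: le_trans a.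
  have [u0 up] : 0 <= u /\ u <= p by case/andP: rup => a ->; split=> //; exact: le_trans a.
  have cs : cabs (s%:C * cis x : C) <= p by rewrite cabs_rcis.
  have cu : cabs (u%:C * cis x : C) <= p by rewrite cabs_rcis.
  have := hL _ _ cs cu.
  have -> : u%:C * cis x - s%:C * cis x = (u - s)%:C * cis x :> C.
    by rewrite rmorphB /=; ring.
  set a := martin _ _ _; set b := martin _ _ _; set c := Dsum _ _ _.
  rewrite [cabs ((u - s)%:C * _)]cabsM cabs_cis mulr1 cabs_real real_normK ?num_real// => h.
  have -> : a - b = 'i%C * t0 * c * ((u - s)%:C * cis x) +
      (a - b - 'i%C * t0 * c * ((u - s)%:C * cis x)) by ring.
  rewrite (le_trans (ler_cabsD _ _))// lerD//.
  rewrite !cabsM cabs_i t01 !mul1r cabs_cis mulr1 cabs_real ler_wpM2r//.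
  exact: small.
have vr : t * (Mx - e / 2) <= complex.Im (martin Gamma t0 (r%:C * cis x)).
  have rc : cabs (r%:C * cis x : C) < 1 by rewrite cabs_rcis.
  apply: le_trans (Im_martin_ge BG rc); rewrite Im_martin_fin// cabs_rcis//.
  have := hK r r0 r1; rewrite -/Mx ler_norml => /andP[h _].
  have -> : (1 - r ^+ 2) / 2 = t * (1 - t / 2) by rewrite /r; field.
  rewrite -mulrA ler_pM2l//.
  have h2 : Mx - K * t <= Msum B (r%:C * cis x) by move: h; rewrite /r; lra.
  have h3 : 0 <= 1 - t / 2 by lra.
  have := ler_wpM2l h3 h2; have Kt0 : 0 <= K * t by rewrite mulr_ge0// ltW.
  have Mt0 : 0 <= Mx * t by rewrite mulr_ge0// ltW.
  have Ktt : 0 <= K * t * t by rewrite mulr_ge0// ltW.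
  by lra.
have h1 := ler_Im_cabs (martin Gamma t0 (p%:C * cis x) - martin Gamma t0 (r%:C * cis x)).
rewrite ImB ler_norml in h1; case/andP: h1 => h1 _.
have h2 : (Mx - e) * (p - r) <= (Mx - e) * t by rewrite ler_wpM2l// /r; lra.
have et : 0 < e * t by rewrite mulr_gt0.
by lra.
Qed.

End MartinBoundary.

(** * The contractive theta sums *)

Section InnerQuotients.
Variable R : realType.
Local Notation C := R[i].
Local Notation mu := (@lebesgue_measure R).
Local Notation D := (`[0, 2 * pi]%classic : set R).
Variables (Gamma : set (C -> C)) (t0 : C).
Hypothesis GF : fuchsian Gamma.
Hypothesis t01 : cabs t0 = 1.
Variables (F : nat -> {fset C -> C}) (W : R).
Hypothesis wW : forall B, fincl B Gamma -> \sum_(g <- B) weight t0 g <= W.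
Hypothesis FG : exhausts Gamma (weight t0) F.
Variables (Delta phi psi psi' : C -> C).
Hypothesis Delta_le1 : forall z, cabs z < 1 -> cabs (Delta z) <= 1.
Hypothesis psi_holo : holo psi psi'.
Hypothesis psi_le4 : forall z, cabs z < 1 -> cabs (psi z) <= 4.
Hypothesis psi_fact : forall z, cabs z < 1 -> 'i%C * t0 * Dsum Gamma t0 z * psi z = Delta z.
Implicit Types (B : {fset C -> C}) (g : C -> C).

Let mobG g : Gamma g -> is_mob g. Proof. exact: fuchsian_mob. Qed.

(* For s > 1 the denominator is bounded away from zero, so finite sums are bounded
   and the maximum principle applies; the theorem needs s = 1. *)
Definition quot (s : R) g z : C :=
  psi (ginv Gamma g z) * (ginv Gamma g z - s%:C * t0)^-1 ^+ 2.

Lemma ginv_lt1 g z : Gamma g -> cabs z < 1 -> cabs (ginv Gamma g z) < 1.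
Proof. by move=> Gg z1; apply: mob_cabs_lt => //; exact/mobG/(ginvG GF). Qed.

(** With y = g^-1 z, equivariance gives D z = D(y) (g^-1)'(z), and [psi_fact] replaces Delta y by i
    t0 D(y) psi(y). *)
Lemma quot_Dsum g z : Gamma g -> cabs z < 1 ->
  Delta (ginv Gamma g z) * mterm t0 g z = 'i%C * t0 * quot 1 g z * Dsum Gamma t0 z.
Proof.
move=> Gg z1; have Gi := ginvG GF Gg; have y1 := ginv_lt1 Gg z1.
have -> : mterm t0 g z = tterm t0 (ginv Gamma g) z.
  by rewrite (ttermE GF t01 Gi z1) (ginvK GF Gg).
rewrite -(Dsum_equivariant GF t01 FG Gi z1) -psi_fact// /tterm /quot.
set y := ginv Gamma g z; move: (derive1 _ z) (Dsum _ _ _) (psi y) => a b c.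
by rewrite rmorph1 mul1r -exprVn; ring.
Qed.

(** The difference of the squares is (s - 1) (s + 1 - 2 Re (y conj t0)), nonnegative on the closed
    disk. Moving the pole outwards can only decrease the moduli of the quotients. *)
Lemma cabs_shift (s : R) y : 1 <= s -> cabs y <= 1 -> cabs (y - t0) <= cabs (y - s%:C * t0).
Proof.
move=> s1 y1; rewrite -(ler_pXn2r (ltn0Sn 1)) ?nnegrE ?cabs_ge0//.
have Y : cabs y ^+ 2 <= 1 by rewrite expr_le1 ?cabs_ge0.
have := t01; move/(congr1 (fun x => x ^+ 2)); rewrite expr1n.
move: Y; rewrite !cabs2; move: t0 => [c d]; case: (y) => a b /=; rewrite !mul0r subr0 addr0 => Y T.
have -> : (a - s * c) ^+ 2 + (b - s * d) ^+ 2 = (a - c) ^+ 2 + (b - d) ^+ 2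
   + (s - 1) * ((s + 1) * (c ^+ 2 + d ^+ 2) - 2 * (a * c + b * d)) by ring.
rewrite lerDl mulr_ge0 ?subr_ge0// T.
have : 0 <= (a - c) ^+ 2 + (b - d) ^+ 2 by rewrite addr_ge0 ?sqr_ge0.
lra.
Qed.

Lemma shift_ge (s : R) y : 1 <= s -> cabs y <= 1 -> s - 1 <= cabs (y - s%:C * t0).
Proof.
move=> s1 y1; rewrite cabsBC (le_trans _ (ler_dist_cabs _ _))// cabsM t01 mulr1.
by rewrite cabs_real ger0_norm; lra.
Qed.

Lemma quot_le (s : R) g z : 1 < s -> Gamma g -> cabs z < 1 ->
  cabs (quot s g z) <= 4 * (s - 1)^-1 ^+ 2.
Proof.
move=> s1 Gg z1; have y1 := ginv_lt1 Gg z1.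
rewrite /quot cabsM (cabsX _ 2) ler_pM ?cabs_ge0 ?sqr_ge0 ?psi_le4//.
rewrite ler_pXn2r ?nnegrE ?cabs_ge0 ?invr_ge0 ?subr_ge0 ?(ltW s1)//.
have h := shift_ge (ltW s1) (ltW y1); have s0 : 0 < s - 1 by rewrite subr_gt0.
by rewrite cabsV lef_pV2// posrE// (lt_le_trans s0).
Qed.

Lemma quot_mono (s : R) g z : 1 <= s -> Gamma g -> cabs z < 1 ->
  cabs (quot s g z) <= cabs (quot 1 g z).
Proof.
move=> s1 Gg z1; have y1 := ginv_lt1 Gg z1; rewrite /quot [leLHS]cabsM [leRHS]cabsM ler_wpM2l ?cabs_ge0//.
rewrite !(cabsX _ 2) ler_pXn2r ?nnegrE ?cabs_ge0//.
have h := cabs_shift s1 (ltW y1).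
have p : 0 < cabs (ginv Gamma g z - t0).
  by rewrite cabs_gt0 subr_eq0; apply/eqP => e; move: y1; rewrite e t01 ltxx.
by rewrite rmorph1 mul1r !cabsV lef_pV2// posrE// (lt_le_trans p).
Qed.

Lemma quot_Dsum_le (s : R) g z : 1 <= s -> Gamma g -> cabs z < 1 ->
  cabs (quot s g z) * cabs (Dsum Gamma t0 z) <= weight t0 g / cabs (g t0 - z) ^+ 2.
Proof.
move=> s1 Gg z1; apply: (@le_trans _ _ (cabs (quot 1 g z) * cabs (Dsum Gamma t0 z))).
  by rewrite ler_wpM2r ?cabs_ge0// quot_mono.
have -> : cabs (quot 1 g z) * cabs (Dsum Gamma t0 z) =
    cabs ('i%C * t0 * quot 1 g z * Dsum Gamma t0 z).
  by rewrite !cabsM cabs_i t01 !mul1r.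
rewrite -quot_Dsum// cabsM /mterm (cabsM (derive1 g t0)) cabsV (cabsX _ 2).
rewrite ler_piMl ?Delta_le1 ?ginv_lt1//.
by rewrite divr_ge0 ?cabs_ge0 ?exprn_ge0 ?cabs_ge0.
Qed.

Lemma quot_holo (s : R) g : 1 <= s -> Gamma g -> exists f', holo (quot s g) f'.
Proof.
move=> s1 Gg; pose q y : C := psi y * ((y - s%:C * t0)^-1 * (y - s%:C * t0)^-1).
have [q' hq] : exists q', holo q q'.
  exists (fun y => psi' y * ((y - s%:C * t0)^-1 * (y - s%:C * t0)^-1) +
    psi y * (- 1 / (y - s%:C * t0) ^+ 2 * (y - s%:C * t0)^-1 +
    (y - s%:C * t0)^-1 * (- 1 / (y - s%:C * t0) ^+ 2))) => r r0 r1.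
  have hl : holo_on r (fun y => y - s%:C * t0) (fun=> 1).
    apply: eq_holo_on (holo_onD (holo_on_id r) (holo_on_cst r (- (s%:C * t0)))) => // z _.
    by rewrite addr0.
  have hb z : cabs z <= r -> 1 - r <= cabs (z - s%:C * t0).
    move=> zr; rewrite cabsBC (le_trans _ (ler_dist_cabs _ _))// cabsM t01 mulr1.
    by rewrite cabs_real ger0_norm; lra.
  have r2 : 0 < 1 - r by rewrite subr_gt0.
  have hV := holo_onV r0 r2 hb hl.
  exact: holo_onM r0 (psi_holo r0 r1) (holo_onM r0 hV hV).
exists (fun z => q' (ginv Gamma g z) * derive1 (ginv Gamma g) z) => r r0 r1.
have mi := mobG (ginvG GF Gg); have [u [u0 u1 hu]] := mob_cabs_le mi r0 r1.
by apply: eq_holo_on (holo_on_comp r0 u0 hu (hq u u0 u1) (mob_holo mi r0 r1)) => //.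
Qed.

Lemma ler_cabs_sum (I : Type) (s : seq I) (u : I -> C) :
  cabs (\sum_(i <- s) u i) <= \sum_(i <- s) cabs (u i).
Proof.
elim: s => [|a s IH]; first by rewrite !big_nil cabs0.
by rewrite !big_cons (le_trans (ler_cabsD _ _))// lerD2l.
Qed.

Lemma quot_comb_le1 (s : R) B (c : (C -> C) -> C) : 1 < s -> fincl B Gamma ->
  (forall g, cabs (c g) <= 1) -> bounded_by (fun z => \sum_(g <- B) c g * quot s g z) 1.
Proof.
move=> s1 BG c1.
have /choice[f' hf'] : forall g, exists f', Gamma g -> holo (quot s g) f'.
  move=> g; have [Gg|nG] := pselect (Gamma g); last by exists (fun=> 0).
  by have [f' hf'] := quot_holo (ltW s1) Gg; exists f'.
have hS : holo (fun z => \sum_(g <- B) c g * quot s g z) (fun z => \sum_(g <- B) c g * f' g z).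
  move=> r r0 r1; apply: holo_on_sum => // g /BG Gg.
  exact: holo_onZ (hf' g Gg r r0 r1).
have bS : bounded_by (fun z => \sum_(g <- B) c g * quot s g z)
    (\sum_(g <- B) 4 * (s - 1)^-1 ^+ 2).
  move=> z z1; rewrite (le_trans (ler_cabs_sum _ _))//.
  rewrite big_seq [leRHS]big_seq ler_sum// => g gB; rewrite cabsM.
  rewrite (le_trans _ (quot_le s1 (BG g gB) z1))// ler_piMl ?cabs_ge0//.
have key z : cabs z < 1 ->
    cabs (\sum_(g <- B) c g * quot s g z) * cabs (Dsum Gamma t0 z) <= Msum t0 B z.
  move=> z1; rewrite (le_trans (ler_wpM2r (cabs_ge0 _) (ler_cabs_sum _ _)))//.
  rewrite mulr_suml /Msum big_seq [leRHS]big_seq ler_sum// => g gB.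
  rewrite cabsM (le_trans _ (quot_Dsum_le (ltW s1) (BG g gB) z1))//.
  by rewrite ler_wpM2r ?cabs_ge0// ler_piMl ?cabs_ge0.
(* The empty sum is treated apart, because the comparison below divides by a multiple of [Msum] at
   the boundary point. *)
have [B0|[g0 g0B]] := fset_0Vmem B.
  by move=> z _; rewrite B0 big_seq_fset0 cabs0.
apply: (maximum_principle hS bS).
have Gg0 := BG g0 g0B.
apply: ae_imp (ae_and (martin_lower GF t01 wW FG BG) (ae_cis_neq (g0 t0))) => x [h xg] Dx e d e0 d0.
set M := Msum t0 B (cis x) in h *.
have M0 : 0 < M.
  have := h Dx; rewrite /M /Msum (big_fsetD1 g0)//= => _.
  rewrite ltr_pwDl// ?divr_gt0 ?(weight_gt0 GF t01 Gg0) ?exprn_gt0//.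
    by rewrite cabs_gt0 subr_eq0; apply/eqP => /esym; exact: xg.
  by rewrite sumr_ge0// => g _; rewrite divr_ge0 ?exprn_ge0 ?cabs_ge0.
(* This [t] solves (1 + t) / (1 - t) = 1 + e. *)
pose t := e / (2 + e); have e2 : 0 < 2 + e by lra.
have t0' : 0 < t by rewrite divr_gt0.
have te : 1 + t = (1 + e) * (1 - t) by rewrite /t; field; rewrite gt_eqF.
have t1 : t < 1 by rewrite /t ltr_pdivrMr//; lra.
have [r [r0 r1 rd lo hi]] := h Dx (M * t) d (mulr_gt0 M0 t0') d0.
exists r; split => //.
have z1 : cabs (r%:C * cis x) < 1 by rewrite cabs_rcis.
have A0 : 0 < M * (1 - t) by rewrite mulr_gt0// subr_gt0.
rewrite -(ler_pM2r A0).
have -> : (1 + e) * (M * (1 - t)) = M * (1 + t) by rewrite te; ring.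
apply: le_trans (_ : _ <= M + M * t) _; last by rewrite mulrDr mulr1.
apply: le_trans hi; apply: le_trans (key _ z1).
by rewrite ler_wpM2l ?cabs_ge0// mulrBr mulr1.
Qed.

Lemma quot_sum_le1 B z : fincl B Gamma -> cabs z < 1 -> \sum_(g <- B) cabs (quot 1 g z) <= 1.
Proof.
move=> BG z1.
have shifted (s : R) : 1 < s -> \sum_(g <- B) cabs (quot s g z) <= 1.
  (* Phases taken at the fixed point z turn the combination into the sum of moduli there; a
     vanishing quotient gets coefficient 0, by the convention for division by zero. *)
  move=> s1; pose c g : C := (quot s g z)^*%C / (cabs (quot s g z))%:C.
  have c1 g : cabs (c g) <= 1.
    rewrite /c cabsM cabsV cabs_conj cabs_real ger0_norm ?cabs_ge0//.
    have [->|q0] := eqVneq (cabs (quot s g z)) 0; first by rewrite mul0r ler01.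
    by rewrite mulfV.
  have := quot_comb_le1 s1 BG c1 z1.
  have -> : \sum_(g <- B) c g * quot s g z = (\sum_(g <- B) cabs (quot s g z))%:C.
    rewrite rmorph_sum /=; apply: eq_bigr => g _; rewrite /c.
    have [q0|q0] := eqVneq (quot s g z) 0; first by rewrite q0 mulr0 cabs0.
    rewrite mulrAC mulrC -[_^*%C * _]mulrC mul_conj rmorphXn /= expr2 mulKf//.
    by rewrite -cabs_eq0 cabs_real normr_eq0 cabs_eq0.
  by rewrite cabs_real ger0_norm// sumr_ge0// => g _; exact: cabs_ge0.
(* The finitely many points g^-1 z keep a positive distance [m] from [t0], so removing the shift by
   m t costs each quotient a factor at most (1 + t)^2. *)
have [m m0 hm] : exists2 m : R, 0 < m & forall g, g \in B -> m <= cabs (ginv Gamma g z - t0).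
  have {}BG : forall g, g \in enum_fset B -> Gamma g := BG.
  suff : exists2 m : R, 0 < m & forall g, g \in enum_fset B -> m <= cabs (ginv Gamma g z - t0).
    by [].
  elim: (enum_fset B) BG => [|a l IH] lG; first by exists 1.
  have [m m0 hm] := IH (fun g gl => lG g (mem_behead (s := a :: l) gl)).
  have Ga := lG a (mem_head _ _); have y1 := ginv_lt1 Ga z1.
  exists (Num.min m (cabs (ginv Gamma a z - t0))).
    rewrite lt_min m0 cabs_gt0 subr_eq0; apply/eqP => e.
    by move: y1; rewrite e t01 ltxx.
  move=> g; rewrite in_cons => /orP[/eqP->|/hm h]; rewrite ge_min ?lexx ?orbT//.
  by rewrite h.
apply/ler_addgt0Pr => e e0; pose t := Num.min 1 (e / 3).
have tp : 0 < t by rewrite lt_min ltr01 divr_gt0.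
have t1 : t <= 1 by rewrite ge_min lexx.
have t3 : t <= e / 3 by rewrite ge_min lexx orbT.
pose s := 1 + m * t; have s1 : 1 < s by rewrite ltrDl mulr_gt0.
apply: (@le_trans _ _ ((1 + t) ^+ 2)); last by rewrite expr2; nra.
rewrite -[leRHS]mulr1 (le_trans _ (ler_wpM2l (sqr_ge0 _) (shifted s s1)))//.
rewrite mulr_sumr big_seq [leRHS]big_seq ler_sum// => g gB.
have y1 := ginv_lt1 (BG g gB) z1; have ym := hm g gB.
rewrite /quot rmorph1 mul1r; set y := ginv Gamma g z in y1 ym *.
rewrite !(cabsM (psi y)) mulrCA ler_wpM2l ?cabs_ge0// !(cabsX _ 2) -exprMn.
have yt : 0 < cabs (y - t0) by exact: lt_le_trans m0 ym.
have ys : 0 < cabs (y - s%:C * t0) by rewrite (lt_le_trans yt)// cabs_shift// ltW.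
rewrite ler_pXn2r ?nnegrE ?cabs_ge0 ?mulr_ge0 ?cabs_ge0//; last by lra.
rewrite !cabsV ler_pdivlMr// mulrC ler_pdivrMr//.
have -> : y - s%:C * t0 = (y - t0) - (m * t)%:C * t0 by rewrite /s rmorphD rmorph1 /=; ring.
rewrite (le_trans (ler_cabsB _ _))// cabsM t01 mulr1 cabs_real ger0_norm; last first.
  by rewrite mulr_ge0// ltW.
have : m * t <= cabs (y - t0) * t by rewrite ler_wpM2r// ltW.
lra.
Qed.

End InnerQuotients.

(** * Isolated zeros and removal of singularities *)

Section HoloLimits.
Variable R : realType.
Local Notation C := R[i].
Local Notation mu := (@lebesgue_measure R).
Local Notation D := (`[0, 2 * pi]%classic : set R).

(** Derivatives found on different disks all agree with [derive1], but this is known at interior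
    points; hence the detour through a larger radius. *)
Lemma holo_derive1_intro (F : C -> C) :
  (forall r, 0 <= r -> r < 1 -> exists F', holo_on r F F') -> holo F (derive1 F).
Proof.
move=> h r r0 r1; have [|| F' hF] := h ((1 + r) / 2); [lra|lra|].
have rr : r < (1 + r) / 2 by lra.
apply: eq_holo_on (holo_onS (ltW rr) hF) => // z zr.
by rewrite (holo_on_derive1 hF)// (le_lt_trans zr).
Qed.

(** Dominated convergence in Cauchy's formula on a circle of radius p exhibits the limit as a Cauchy
    transform; pointwise convergence under a uniform bound is all this takes. *)
Lemma holo_bounded_limit (P : nat -> C -> C) (Q : C -> C) (M : R) :
  (forall n, exists P', holo (P n) P') -> (forall n, bounded_by (P n) M) ->
  (forall z, cabs z < 1 -> P n z @[n --> \oo] --> Q z) -> holo Q (derive1 Q).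
Proof.
move=> Ph PM PQ; apply: holo_derive1_intro => r r0 r1.
pose p := (1 + r) / 2; have p0 : 0 < p by rewrite /p; lra.
have p1 : p < 1 by rewrite /p; lra.
have pc z : cabs z <= 1 -> cabs (p%:C * z) < 1.
  by move=> z1; rewrite cabsM cabs_real gtr0_norm// (le_lt_trans _ p1)// ler_piMr// ltW.
have Pc n : clip (fun x => P n (p%:C * cis x)).
  by have [P' hP] := Ph n; exact: clip_circle (ltW p0) (hP p (ltW p0) p1).
have Pcv x : P n (p%:C * cis x) @[n --> \oo] --> Q (p%:C * cis x).
  by apply: PQ; apply: pc; rewrite cabs_cis.
have mQ : cmeas (fun x => Q (p%:C * cis x)).
  split.
    apply: (@measurable_fun_cvg _ _ R D
      (fun n x => complex.Re (P n (p%:C * cis x)))).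
      by move=> n; case: (clip_meas (Pc n)).
    by move=> x _; case/cvg_complexP: (Pcv x).
  apply: (@measurable_fun_cvg _ _ R D
    (fun n x => complex.Im (P n (p%:C * cis x)))).
    by move=> n; case: (clip_meas (Pc n)).
  by move=> x _; case/cvg_complexP: (Pcv x).
have bQ x : cabs (Q (p%:C * cis x)) <= M.
  by apply: cvg_cabs_le (Pcv x) => n; apply: PM; apply: pc; rewrite cabs_cis.
have iQ : cint (fun x => Q (p%:C * cis x)) by apply: (cint_bounded mQ) => x _; exact: bQ.
have QE z : cabs z < 1 ->
    Q (p%:C * z) = cmean (fun x => Q (p%:C * cis x) * ckernel z x).
  move=> z1; have zc := pc z (ltW z1).
  have M0 : 0 <= M by rewrite (le_trans (cabs_ge0 _) (bQ 0)).
  have hB n x : D x -> cabs (P n (p%:C * cis x) * ckernel z x) <= M * (1 - cabs z)^-1.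
    move=> _; rewrite cabsM ler_pM ?cabs_ge0 ?cabs_ckernel//.
    by apply: PM; apply: pc; rewrite cabs_cis.
  have hC : {ae mu, forall x, D x ->
      P n (p%:C * cis x) * ckernel z x @[n --> \oo] --> Q (p%:C * cis x) * ckernel z x}.
    by apply: aeW => x _; apply: cvgM => //; exact: cvg_cst.
  have [_ cv] := @cmean_dct R (fun n x => P n (p%:C * cis x) * ckernel z x)
    (fun x => Q (p%:C * cis x) * ckernel z x) (fun=> M * (1 - cabs z)^-1)
    (fun n => clip_meas (clipM (Pc n) (clip_ckernel z1)))
    (cmeasM mQ (clip_meas (clip_ckernel z1))) (rint_cst _) hB hC.
  apply: (cvg_unique (@Chausdorff R) (PQ _ zc)); apply: cvg_trans cv.
  have -> : (fun n => cmean (fun x => P n (p%:C * cis x) * ckernel z x)) =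
            (fun n => P n (p%:C * z)) => //.
  apply/funext => n; have [P' hP] := Ph n.
  exact: cauchy_formula (holo_on_scale (ltW p0) (hP p (ltW p0) p1)) z1.
have s0 : 0 <= r / p by rewrite divr_ge0// ltW.
have s1 : r / p < 1 by rewrite ltr_pdivrMr// mul1r /p; lra.
have hT := holo_on_cauchy_transform iQ s0 s1.
have hl := holo_onZ p^-1%:C r0 (holo_on_id r).
have hb z : cabs z <= r -> cabs (p^-1%:C * z) <= r / p.
  by move=> zr; rewrite cabsM cabs_real ger0_norm ?invr_ge0 ?(ltW p0)// mulrC ler_wpM2r// invr_ge0 ltW.
exists (fun z => cmean (fun x => Q (p%:C * cis x) * ((cis x)^*%C * ckernel (p^-1%:C * z) x ^+ 2))
  * (p^-1%:C * 1)).
apply: eq_holo_on (holo_on_comp r0 s0 hb hT hl) => // z zr.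
rewrite -QE ?(le_lt_trans (hb z zr))// mulrA -rmorphM /= mulfV ?gt_eqF// rmorph1.
by rewrite mul1r.
Qed.

Section IsolatedZeros.
Variables (f f' : C -> C) (b : C).
Hypothesis fh : holo f f'.
Hypothesis b1 : cabs b < 1.
Hypothesis fb : f b != 0.

(* With c k the first non-zero Taylor coefficient, f(p z) = z^k T_k(z) where T_k is
   a Cauchy transform and T_k(0) = c k. *)
Lemma isolated_zero0 : exists2 d : R, 0 < d & forall z, z != 0 -> cabs z < d -> f z != 0.
Proof.
pose p := (1 + cabs b) / 2; have b0 := cabs_ge0 b; have hb := b1.
have p0 : 0 < p by rewrite /p; lra.
have p1 : p < 1 by rewrite /p; lra.
have bp : cabs b < p by rewrite /p; lra.
have hp := fh (ltW p0) p1; pose u x := f (p%:C * cis x).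
have uc : clip u by exact: clip_circle (ltW p0) hp.
have := uc => -[_ [M [_ M0 _ uM]]].
pose e n x : C := ((cis x)^*%C) ^+ n.
have ec n : clip (e n).
  elim: n => [|n IH]; first exact: clip_cst.
  have -> : e n.+1 = (fun x => (cis x)^*%C * e n x) by apply/funext => x; rewrite /e exprS.
  exact: clipM (clip_conj (@clip_cis R)) IH.
have e1 n x : cabs (e n x) = 1 by rewrite /e cabsX cabs_conj cabs_cis expr1n.
pose c n := cmean (fun x => u x * e n x).
pose T n z := cmean (fun x => u x * e n x * ckernel z x).
have TS n z : cabs z < 1 -> T n z = c n + z * T n.+1 z.
  move=> z1; have i1 := clip_int (clipM uc (ec n)).
  have i2 := clip_int (clipM (clipM uc (ec n.+1)) (clip_ckernel z1)).
  rewrite /c /T -cmeanZ// -cmeanD//; last exact: cintZ.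
  apply: eq_cmean => x _; have := ckernel_den_neq0 x z1.
  rewrite /ckernel /e exprS; move: (u x) (cis x)^*%C => a w w0.
  by move: (w ^+ n) => v; field; rewrite -opprB oppr_eq0 -[_ - 1]opprB oppr_eq0.
have Tle n z : cabs z < 1 -> cabs (T n z) <= M * (1 - cabs z)^-1.
  move=> z1; rewrite -[leRHS](@rmean_cst R); apply: ler_cmean.
  - exact: clip_int (clipM (clipM uc (ec n)) (clip_ckernel z1)).
  - exact: rint_cst.
  - by move=> x _; rewrite !cabsM e1 mulr1 ler_pM ?cabs_ge0 ?cabs_ckernel.
have fT0 z : cabs z < 1 -> f (p%:C * z) = T 0%N z.
  move=> z1; rewrite -(cauchy_formula (holo_on_scale (ltW p0) hp) z1).
  by apply: eq_cmean => x _; rewrite /e expr0 mulr1.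
have fT k z : (forall j, (j < k)%N -> c j = 0) -> cabs z < 1 -> f (p%:C * z) = z ^+ k * T k z.
  move=> + z1; elim: k => [|k IH] ck; first by rewrite expr0 mul1r fT0.
  rewrite IH; last by move=> j jk; apply: ck; rewrite ltnS ltnW.
  by rewrite TS// ck// add0r exprS; ring.
have pz z : z = p%:C * (p^-1%:C * z).
  by rewrite mulrA -rmorphM /= mulfV ?gt_eqF// rmorph1 mul1r.
have cz z : cabs (p^-1%:C * z) = cabs z / p.
  by rewrite cabsM cabs_real ger0_norm ?invr_ge0 ?(ltW p0)// mulrC.
(* If all coefficients vanished, f(b) would be z^n T_n(z) for every n, with |z| < 1 and T_n(z)
   bounded independently of n, hence 0. *)
have [k ck] : exists k, c k != 0.
  apply: contrapT => h; have c0 j : c j = 0 by apply/eqP/negPn/negP => cj; apply: h; exists j.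
  pose z := p^-1%:C * b; have z1 : cabs z < 1 by rewrite cz ltr_pdivrMr// mul1r.
  have [L0|fb0] := lerP (cabs (f b)) 0.
    by move: fb; rewrite -cabs_gt0 ltNge L0.
  have K0 : 0 < M * (1 - cabs z)^-1 + 1 by rewrite ltr_wpDl// mulr_ge0// invr_ge0; lra.
  have zn : `|cabs z| < 1 by rewrite ger0_norm ?cabs_ge0.
  have /cvgrPdist_lt/(_ _ (divr_gt0 fb0 K0))/filter_ex[n /=] := cvg_expr zn.
  rewrite sub0r normrN ger0_norm ?exprn_ge0 ?cabs_ge0// ltNge => /negP; apply.
  rewrite ler_pdivrMr// (pz b) -/z (fT n z)// cabsM cabsX.
  rewrite ler_wpM2l ?exprn_ge0 ?cabs_ge0// (le_trans (Tle n z z1))//; lra.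
have [k' ck' kmin] := ex_minnP (ex_intro (fun k => c k != 0) k ck).
have cj j : (j < k')%N -> c j = 0.
  by move=> jk; apply/eqP/negPn/negP => /kmin; rewrite leqNgt jk.
(* For |y| <= 1/2 the next transform is at most 2 M, so y times it cannot cancel [c k']. *)
pose d := Num.min 2^-1 (cabs (c k') / (2 * M + 1)).
have d0 : 0 < d by rewrite lt_min invr_gt0 ltr0n divr_gt0 ?cabs_gt0//; lra.
exists (p * d) => [|z z0 zd]; first by rewrite mulr_gt0.
pose y := p^-1%:C * z; have yd : cabs y < d by rewrite cz ltr_pdivrMr// mulrC.
have y2 : cabs y < 2^-1 by rewrite (lt_le_trans yd)// ge_min lexx.
have yc : cabs y * (2 * M + 1) < cabs (c k').
  rewrite -ltr_pdivlMr; last by lra.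
  by rewrite (lt_le_trans yd)// ge_min lexx orbT.
have y1 : cabs y < 1 by lra.
rewrite (pz z) -/y (fT k')// mulf_neq0//.
  rewrite expf_neq0// mulf_neq0// -cabs_eq0 cabs_real normr_eq0 invr_eq0 gt_eqF//.
rewrite TS//; apply/eqP => /eqP; rewrite addr_eq0 => /eqP h.
have := congr1 (@cabs R) h; rewrite cabsN cabsM => h2.
have h3 := Tle k'.+1 y y1.
have h4 : (1 - cabs y)^-1 <= 2.
  by rewrite invf_ple ?posrE//; lra.
have h5 : cabs (T k'.+1 y) <= 2 * M + 1.
  by rewrite (le_trans h3)// (le_trans (ler_wpM2l M0 h4))//; lra.
have := ler_wpM2l (cabs_ge0 y) h5; lra.
Qed.

End IsolatedZeros.
End HoloLimits.

Section IsolatedZeros.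
Variable R : realType.
Local Notation C := R[i].

Lemma mobius_transport (a : C) : cabs a < 1 -> exists m n : C -> C,
  [/\ is_mob m, is_mob n, m 0 = a, forall z, cabs z < 1 -> m (n z) = z & n a = 0].
Proof.
move=> a1; pose s := 1 - cabs a ^+ 2; have s0 : 0 < s.
  by rewrite subr_gt0 expr_lt1 ?cabs_ge0.
(* The pair (1, a) has determinant 1 - |a|^2; scaling it by p puts it into SU(1,1). *)
pose p : R := Num.sqrt s^-1; have p2 : p ^+ 2 = s^-1 by rewrite sqr_sqrtr// invr_ge0 ltW.
have p0 : p != 0 by rewrite gt_eqF// sqrtr_gt0 invr_gt0.
have S (q : C) : cabs q = cabs a -> SU11 (p%:C, p%:C * q).
  move=> qa; rewrite /SU11 /= -!cabsE -!rmorphXn -rmorphB /=; congr (_%:C).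
  rewrite cabsM cabs_real qa exprMn real_normK ?num_real// p2.
  by rewrite -[X in X - _]mulr1 -mulrBr mulVf// gt_eqF.
have Sa : SU11 (p%:C, p%:C * a) by exact: S.
have SN : SU11 (p%:C, p%:C * - a) by apply: S; rewrite cabsN.
have p0' : p%:C != 0 :> C by rewrite -cabs_eq0 cabs_real normr_eq0.
have cp : (p%:C)^*%C = p%:C :> C by rewrite /= oppr0.
exists (mobius p%:C (p%:C * a)), (mobius p%:C (p%:C * - a)); split.
- by exists (p%:C, p%:C * a).
- by exists (p%:C, p%:C * - a).
- by rewrite mobiusE !mulr0 !add0r cp mulrC mulKf.
- move=> z z1; have [_ _ -> _] := mobius_comp Sa SN (ltW z1).
  have -> : p%:C * (p%:C * - a) + p%:C * a * (p%:C)^*%C = 0 by rewrite cp; ring.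
  have -> : p%:C * p%:C + p%:C * a * (p%:C * - a)^*%C = 1.
    by rewrite -(SU11_det Sa) cp mulrN [(- _)^*%C]rmorphN mulrN.
  by rewrite mobiusE rmorph0 rmorph1 mul0r add0r addr0 mul1r divr1.
- by rewrite mobiusE mulrN subrr mul0r.
Qed.

(** An automorphism of the disk moves a to 0, where Taylor coefficients are at hand; its Lipschitz
    bound transfers the radius. *)
Lemma isolated_zeros (f f' : C -> C) a b : holo f f' -> cabs b < 1 -> f b != 0 ->
  cabs a < 1 -> exists2 d : R, 0 < d & forall w, w != a -> cabs (w - a) < d ->
    cabs w < 1 /\ f w != 0.
Proof.
move=> fh b1 fb a1; have [m [n [mm mn m0 mnK na]]] := mobius_transport a1.
have fmh : holo (fun z => f (m z)) (fun z => f' (m z) * derive1 m z).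
  move=> r r0 r1; have [u [u0 u1 hu]] := mob_cabs_le mm r0 r1.
  exact: holo_on_comp r0 u0 hu (fh u u0 u1) (mob_holo mm r0 r1).
have fmb : f (m (n b)) != 0 by rewrite mnK.
have [d d0 hd] := isolated_zero0 fmh (mob_cabs_lt mn b1) fmb.
pose r := (1 + cabs a) / 2; have a0 := cabs_ge0 a.
have r0 : 0 <= r by rewrite /r; lra.
have r1 : r < 1 by rewrite /r; lra.
have ar : cabs a <= r by rewrite /r; lra.
have [L L0 hL] := holo_on_lip r0 (mob_holo mn r0 r1).
exists (Num.min (r - cabs a) (d / (L + 1))) => [|w wa].
  by rewrite lt_min subr_gt0 divr_gt0 ?andbT//; [rewrite /r|]; lra.
rewrite lt_min => /andP[w1 w2].
have wr : cabs w <= r.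
  by have := ler_dist_cabs w a; lra.
have wc : cabs w < 1 by lra.
split=> //; rewrite -(mnK w wc); apply: hd.
  by apply/eqP => e; move/eqP: wa; apply; rewrite -(mnK w wc) e.
have := hL a w ar wr; rewrite na subr0 => h; apply: le_lt_trans h _.
move: w2; rewrite ltr_pdivlMr; last by lra.
by apply: le_lt_trans; rewrite mulrC ler_wpM2l ?cabs_ge0//; lra.
Qed.
End IsolatedZeros.

(** * The theta quotient as a limit of contractive sums *)

Section ThetaQuotient.
Variable R : realType.
Local Notation C := R[i].
Variables (Gamma : set (C -> C)) (t0 : C).
Hypothesis GF : fuchsian Gamma.
Hypothesis t01 : cabs t0 = 1.
Variables (F : nat -> {fset C -> C}) (W : R).
Hypothesis wW : forall B, fincl B Gamma -> \sum_(g <- B) weight t0 g <= W.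
Hypothesis FG : exhausts Gamma (weight t0) F.
Variables (Delta psi psi' : C -> C).
Hypothesis Delta_le1 : forall z, cabs z < 1 -> cabs (Delta z) <= 1.
Hypothesis psi_holo : holo psi psi'.
Hypothesis psi_le4 : forall z, cabs z < 1 -> cabs (psi z) <= 4.
Hypothesis psi_fact : forall z, cabs z < 1 -> 'i%C * t0 * Dsum Gamma t0 z * psi z = Delta z.
Variable c : (C -> C) -> C.
Hypothesis c1 : forall g, Gamma g -> cabs (c g) <= 1.

Local Notation dsum := (Dsum Gamma t0).
Local Notation quo := (quot Gamma t0 psi 1).

Definition Psum n z : C := \sum_(g <- F n) 'i%C * t0 * c g * quo g z.

Let FGn n : fincl (F n) Gamma. Proof. by case: FG. Qed.

Let quot_le1 B z : fincl B Gamma -> cabs z < 1 -> \sum_(g <- B) cabs (quo g z) <= 1.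
Proof. exact: (quot_sum_le1 GF t01 wW FG Delta_le1 psi_holo psi_le4 psi_fact). Qed.

Let term_le g z : Gamma g -> cabs ('i%C * t0 * c g * quo g z) <= cabs (quo g z).
Proof.
by move=> Gg; rewrite cabsM ler_piMl ?cabs_ge0// !cabsM cabs_i t01 !mul1r c1.
Qed.

Lemma Psum_le1 n : bounded_by (Psum n) 1.
Proof.
move=> z z1; rewrite (le_trans (ler_cabs_sum _ _))// (le_trans _ (quot_le1 (@FGn n) z1))//.
rewrite big_seq [leRHS]big_seq ler_sum// => g gF; exact/term_le/(FGn gF).
Qed.

Lemma Psum_holo n : exists f', holo (Psum n) f'.
Proof.
have /choice[f' hf'] : forall g, exists f', Gamma g -> holo (quo g) f'.
  move=> g; have [Gg|nG] := pselect (Gamma g); last by exists (fun=> 0).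
  by have [f' hf'] := quot_holo GF t01 psi_holo (lexx 1) Gg; exists f'.
exists (fun z => \sum_(g <- F n) 'i%C * t0 * c g * f' g z) => r r0 r1.
apply: holo_on_sum => // g /FGn Gg; apply: holo_onZ => //; exact: hf'.
Qed.

(** The sums of the moduli increase with n and stay at most 1, so the partial sums have bounded
    variation in each coordinate. *)
Lemma Psum_cvg z : cabs z < 1 -> cvgn (Psum^~ z).
Proof.
move=> z1; pose q n := \sum_(g <- F n) cabs (quo g z).
have dP n : cabs (Psum n.+1 z - Psum n z) <= q n.+1 - q n.
  have split (T : nmodType) (u : (C -> C) -> T) : \sum_(g <- F n.+1) u g =
      \sum_(g <- F n) u g + \sum_(g <- [fset g in F n.+1 | g \notin F n]%fset) u g.
    rewrite (big_fsetID _ (fun g => g \in F n)) /=; congr (_ + _).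
    have -> // : [fset x in F n.+1 | x \in F n]%fset = F n.
    apply/fsetP => i; rewrite !finmap.inE /=; apply/andP/idP => [[]//|iF].
    by split=> //; have [_ FS _] := FG; exact: (fsubsetP (FS n)).
  rewrite /Psum /q !split addrC addKr addrC addKr (le_trans (ler_cabs_sum _ _))//.
  rewrite big_seq [leRHS]big_seq ler_sum// => g; rewrite !finmap.inE /= => /andP[gF _].
  exact/term_le/(FGn gF).
have q0 n : 0 <= q n by apply: sumr_ge0 => g _; exact: cabs_ge0.
have bv (p : C -> R) : (forall y, `|p y| <= cabs y) -> (forall x y, p (x - y) = p x - p y) ->
    cvgn (fun n => p (Psum n z)).
  move=> pc pB; apply: (@bounded_variation_cvg R _ 1) => n.
  apply: (@le_trans _ _ (\sum_(0 <= k < n) (q k.+1 - q k))).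
    by apply: ler_sum => k _; rewrite -pB (le_trans (pc _)).
  rewrite telescope_sumr// (le_trans (_ : _ <= q n)) ?gerBl//.
  exact: quot_le1 (@FGn n) z1.
have /cvg_ex[l1 h1] := bv (@complex.Re R) (@ler_Re_cabs R) (@ReB R).
have /cvg_ex[l2 h2] := bv (@complex.Im R) (@ler_Im_cabs R) (@ImB R).
by apply/cvg_ex; exists (l1 +i* l2); apply/cvg_complexP; split.
Qed.

Definition Plim z : C := limn (Psum^~ z).

Lemma Psum_lim z : cabs z < 1 -> Psum n z @[n --> \oo] --> Plim z.
Proof. exact: Psum_cvg. Qed.

Lemma Plim_holo : holo Plim (derive1 Plim).
Proof. exact: holo_bounded_limit Psum_holo Psum_le1 Psum_lim. Qed.

Lemma Plim_le1 : bounded_by Plim 1.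
Proof.
by move=> z z1; apply: cvg_cabs_le (Psum_lim z1) => n; exact: Psum_le1.
Qed.

(** After the exchange of g and g^-1 each term is a term of [Psum] times D. Nothing is divided by D,
    so the identity also covers its zeros. *)
Lemma theta_num_hsum z : cabs z < 1 ->
  hsum Gamma (fun g => c (ginv Gamma g) * Delta (g z) * tterm t0 g z) (Plim z * dsum z).
Proof.
move=> z1; pose v g := c g * (Delta (ginv Gamma g z) * mterm t0 g z).
have dv : dominated Gamma (weight t0) v ((1 - cabs z)^-1 ^+ 2).
  move=> g Gg; rewrite (le_trans _ (mterm_dominated GF t01 z1 (lexx _) Gg))//.
  rewrite /v mulrA cabsM ler_piMl ?cabs_ge0// cabsM mulr_ile1 ?cabs_ge0 ?c1//.
  by apply/Delta_le1/(ginv_lt1 GF).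
have cv := gsum_cvg FG (sqr_ge0 _) dv.
have h := gsum_hsum FG (sqr_ge0 _) dv.
have e : summability.sum (v \_ Gamma) = Plim z * dsum z.
  apply: (cvg_unique (@Chausdorff R) cv).
  have -> : (fun n => \sum_(g <- F n) v g) = (fun n => Psum n z * dsum z).
    apply/funext => n; rewrite /Psum mulr_suml big_seq [RHS]big_seq.
    apply: eq_bigr => g /FGn Gg; rewrite /v (quot_Dsum GF t01 FG psi_fact Gg z1); ring.
  by apply: cvgM; [exact: Psum_lim|exact: cvg_cst].
rewrite e in h; apply: eq_hsum (hsum_ginv GF h) => g Gg.
by rewrite /v (ginvK GF Gg) (ttermE GF t01 Gg z1) mulrA.
Qed.

(** D does not vanish identically, hence has no zeros near z other than possibly z. There the
    quotient is [Plim], whose continuity gives the punctured limit, even at a zero of D. *)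
Lemma theta_Plim (alpha : (C -> C) -> C) b : (forall g, Gamma g -> c (ginv Gamma g) = (alpha g)^*) ->
  cabs b < 1 -> dsum b != 0 -> forall z, cabs z < 1 -> theta Gamma t0 alpha Delta z = Plim z.
Proof.
move=> ca b1 Db z z1; have [D' Dh] := Dsum_holo GF t01 wW FG.
have [d d0 hd] := isolated_zeros Dh b1 Db z1.
have [r [zr r1]] : exists r : R, cabs z < r /\ r < 1.
  by exists ((1 + cabs z) / 2); split; lra.
have r0 : 0 <= r by rewrite (le_trans (cabs_ge0 z))// ltW.
have [L L0 hL] := holo_on_lip r0 (Plim_holo r0 r1).
have PF := pdnbhsC_proper z; apply: cvg_lim; first exact: Chausdorff.
apply/cvgC => e e0; apply/pdnbhsC.
exists (Num.min d (Num.min (r - cabs z) (e / (L + 1)))).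
  by rewrite !lt_min d0 subr_gt0 zr divr_gt0//; lra.
move=> w wz; rewrite !lt_min => /and3P[wd wr we].
have [w1 Dw] := hd w wz wd.
have wr' : cabs w <= r by have := ler_dist_cabs w z; lra.
have -> : theta_num Gamma t0 alpha Delta w = Plim w * dsum w.
  apply: hsum_lim; apply: eq_hsum (theta_num_hsum w1) => g Gg.
  by rewrite ca.
rewrite (theta_denE GF t01 FG w1) mulfK//.
rewrite (le_lt_trans (hL z w (ltW zr) wr'))//.
move: we; rewrite ltr_pdivlMr; last by lra.
by apply: le_lt_trans; rewrite mulrC ler_wpM2l ?cabs_ge0//; lra.
Qed.

End ThetaQuotient.

(** * Expansion at the distinguished boundary point *)

Section NontangentialExpansion.
Variable R : realType.
Local Notation C := R[i].
Implicit Types (z t : C) (F G : C -> C).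

Lemma nontangentialP t (A : set C) : nontangential t A <-> forall M : R,
  exists2 d : R, 0 < d & forall z, stolz t M z -> cabs (z - t) < d -> A z.
Proof.
split=> [h M|h M].
  by have /nbhsC[d d0 hd] := h M; exists d => // z zM zd; exact: hd.
by have [d d0 hd] := h M; apply/nbhsC; exists d => // z zd zM; exact: hd.
Qed.

Lemma stolz_neq t (M : R) z : cabs t = 1 -> stolz t M z -> 0 < cabs (z - t).
Proof.
move=> t1 [/diskE z1 _]; rewrite cabs_gt0 subr_eq0; apply/eqP => e.
by move: z1; rewrite e t1 ltxx.
Qed.

Lemma nt_expansionP F t a b : cabs t = 1 -> nt_expansion F t a b <->
  forall (M e : R), 0 < e -> exists2 d : R, 0 < d & forall z, stolz t M z ->
    cabs (z - t) < d -> cabs (F z - a - b * (z - t)) <= e * cabs (z - t).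
Proof.
move=> t1; have NF := nontangential_filter t.
split=> [/cvgC h M e e0|h].
  have /nontangentialP/(_ M)[d d0 hd] := h e e0; exists d => // z zM zd.
  have := hd z zM zd; rewrite subr0 cabsM cabsV ltr_pdivrMr; first exact: ltW.
  exact: stolz_neq zM.
apply/cvgC => e e0; apply/nontangentialP => M.
have e2 : 0 < e / 2 by rewrite divr_gt0.
have [d d0 hd] := h M _ e2; exists d => // z zM zd; have p := stolz_neq t1 zM.
rewrite subr0 cabsM cabsV ltr_pdivrMr// (le_lt_trans (hd z zM zd))//.
by rewrite ltr_pM2r//; lra.
Qed.

(** A nonzero limit keeps F away from 0 close to t. For Delta this excludes that D vanishes
    identically, as the isolation of its zeros requires. *)
Lemma nt_expansion_neq0 F t a b : cabs t = 1 -> nt_expansion F t a b -> a != 0 ->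
  exists2 z, cabs z < 1 & F z != 0.
Proof.
move=> t1 /(nt_expansionP _ _ _ t1)/(_ 1 1 ltr01)[d d0 hd] a0.
pose k := cabs a / (cabs b + 1); have b0 := cabs_ge0 b.
have k0 : 0 < k by rewrite divr_gt0 ?cabs_gt0//; lra.
have [z [[z1 z2] z3]] : exists z, stolz t 1 z /\ cabs (z - t) < Num.min d k.
  by have [|z] := @stolz_near R t (Num.min d k) t1; [rewrite lt_min d0|exists z].
exists z; first exact/diskE.
move: z3; rewrite lt_min => /andP[zd zk]; apply/eqP => Fz.
have := hd z (conj z1 z2) zd; rewrite Fz sub0r mul1r -cabsN opprD !opprK => h.
have h2 := ler_dist_cabs a (- (b * (z - t))); rewrite opprK cabsN cabsM in h2.
move: zk; rewrite ltr_pdivlMr; last by lra.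
lra.
Qed.

Lemma nt_expansion_near F G t a b : cabs t = 1 -> nt_expansion F t a b ->
  (forall M e : R, 0 < e -> exists2 d : R, 0 < d & forall z, stolz t M z ->
    cabs (z - t) < d -> cabs (G z - F z) <= e * cabs (z - t)) -> nt_expansion G t a b.
Proof.
move=> t1 /(nt_expansionP _ _ _ t1) hF hG; apply/(nt_expansionP _ _ _ t1) => M e e0.
have e2 : 0 < e / 2 by rewrite divr_gt0.
have [d1 d10 h1] := hF M _ e2; have [d2 d20 h2] := hG M _ e2.
exists (Num.min d1 d2) => [|z zM]; first by rewrite lt_min d10.
rewrite lt_min => /andP[z1 z2].
have -> : G z - a - b * (z - t) = (G z - F z) + (F z - a - b * (z - t)) by ring.
rewrite (le_trans (ler_cabsD _ _))//.
have := h1 z zM z1; have := h2 z zM z2; lra.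
Qed.

Lemma esum_fincl_le (I : choiceType) (G : set I) (w : I -> R) (B : {fset I}) :
  fincl B G -> ((\sum_(i <- B) w i)%:E <= \esum_(i in G) (w i)%:E)%E.
Proof.
move=> BG; apply: esum_ge; exists [set` B].
  by split; [exact: finite_fset|move=> i /= iB; exact: BG].
by rewrite -(fsbig_seq _ _ (fset_uniq B)) -sumEFin.
Qed.

(** The extended-real sum bounds all finite sums at once, with one [d] for all of them; finite sums
    are the input of [hsum_dist]. *)
Lemma esum_smallP (I : choiceType) (G : set I) (w : I -> C -> R) t : cabs t = 1 ->
  ((cabs (t - z))%:E * \esum_(i in G) (w i z)%:E)%E @[z --> nontangential t] --> 0%E ->
  forall M e : R, 0 < e -> exists2 d : R, 0 < d & forall z, stolz t M z ->
    cabs (z - t) < d -> forall B, fincl B G -> cabs (z - t) * \sum_(i <- B) w i z <= e.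
Proof.
move=> t1 h M e e0; have NF := nontangential_filter t.
have : nbhs (0%E : \bar R) [set x : \bar R | (x < e%:E)%E].
  by apply: open_nbhs_nbhs; split; [exact: open_ereal_lt_ereal|rewrite /= lte_fin].
move=> /h; rewrite /= => /nontangentialP/(_ M)[d d0 hd]; exists d => // z zM zd B BG.
have := hd z zM zd; rewrite /= => h2; rewrite -lee_fin (le_trans _ (ltW h2))//.
by rewrite EFinM cabsBC lee_wpmul2l ?lee_fin ?cabs_ge0// esum_fincl_le.
Qed.

End NontangentialExpansion.

(** * Transfer of the expansion from Delta to the theta quotient *)

Section ThetaExpansion.
Variable R : realType.
Local Notation C := R[i].
Variables (Gamma : set (C -> C)) (t0 : C).
Hypothesis GF : fuchsian Gamma.
Hypothesis t01 : cabs t0 = 1.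
Variables (F : nat -> {fset C -> C}) (W : R).
Hypothesis wW : forall B, fincl B Gamma -> \sum_(g <- B) weight t0 g <= W.
Hypothesis FG : exhausts Gamma (weight t0) F.
Variables (Delta psi psi' : C -> C).
Hypothesis Delta_le1 : forall z, cabs z < 1 -> cabs (Delta z) <= 1.
Hypothesis psi_holo : holo psi psi'.
Hypothesis psi_le4 : forall z, cabs z < 1 -> cabs (psi z) <= 4.
Hypothesis psi_fact : forall z, cabs z < 1 -> 'i%C * t0 * Dsum Gamma t0 z * psi z = Delta z.
Variable c : (C -> C) -> C.
Hypothesis c1 : forall g, Gamma g -> cabs (c g) <= 1.
Hypothesis cid : c idfun = 1.

Local Notation P := (Plim Gamma t0 F psi c).

(** Write X = (t0 - z)^-2 for the term of the identity in D. Both D - X and P D - Delta X have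
    modulus at most E, and |P| <= 1, so (P - Delta) X has modulus at most 2 E. *)
Lemma Plim_near (E : R) z : cabs z < 1 ->
  (forall B, fincl B (Gamma `\ idfun) ->
    \sum_(g <- B) weight t0 g / cabs (g t0 - z) ^+ 2 <= E) ->
  cabs (P z - Delta z) <= 2 * E * cabs (z - t0) ^+ 2.
Proof.
move=> z1 hE; have Gi := fuchsian_id GF.
have zt : t0 - z != 0 by exact: (orbitB_neq0 GF t01 Gi z1).
have cm g : cabs (mterm t0 g z) = weight t0 g / cabs (g t0 - z) ^+ 2.
  by rewrite /mterm cabsM cabsV (cabsX _ 2).
have mi : mterm t0 idfun z = (t0 - z)^-1 ^+ 2 by rewrite /mterm derive1_idfun mul1r exprVn.
have hD : cabs (Dsum Gamma t0 z - (t0 - z)^-1 ^+ 2) <= E.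
  rewrite -mi; apply: (hsum_dist (Dsum_hsum GF t01 FG z1) Gi) => B BG.
  by rewrite (le_trans _ (hE B BG))//; apply: ler_sum => g _; rewrite cm.
have hN : cabs (P z * Dsum Gamma t0 z - Delta z * (t0 - z)^-1 ^+ 2) <= E.
  have h := hsum_ginv GF (theta_num_hsum GF t01 wW FG Delta_le1 psi_holo psi_le4 psi_fact c1 z1).
  have E1 : c (ginv Gamma (ginv Gamma idfun)) * Delta (ginv Gamma idfun z) *
      tterm t0 (ginv Gamma idfun) z = Delta z * (t0 - z)^-1 ^+ 2.
    rewrite !(ginv_id GF) cid mul1r (ttermE GF t01 Gi z1) (ginv_id GF) mi.
    by [].
  rewrite -E1; apply: (hsum_dist h Gi) => B BG.
  rewrite (le_trans _ (hE B BG))// big_seq [leRHS]big_seq; apply: ler_sum => g /BG[Gg _].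
  have Gj := ginvG GF Gg.
  rewrite (ttermE GF t01 Gj z1) (ginvK GF Gg) -cm cabsM ler_piMl ?cabs_ge0//.
  by rewrite cabsM mulr_ile1 ?cabs_ge0 ?c1//; apply/Delta_le1/(ginv_lt1 GF).
have Pz := Plim_le1 GF t01 wW FG Delta_le1 psi_holo psi_le4 psi_fact c1 z1.
have -> : P z - Delta z = ((P z * Dsum Gamma t0 z - Delta z * (t0 - z)^-1 ^+ 2) -
    P z * (Dsum Gamma t0 z - (t0 - z)^-1 ^+ 2)) * (t0 - z) ^+ 2.
  by move: (Dsum _ _ _) (P z) (Delta z) (t0 - z) zt => a b e s s0; field.
rewrite cabsM (cabsX _ 2) (cabsBC t0) ler_wpM2r ?sqr_ge0//.
rewrite (le_trans (ler_cabsB _ _))// cabsM.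
have := ler_pM (cabs_ge0 _) (cabs_ge0 _) Pz hD; lra.
Qed.

Lemma Plim_expansion (a b : C) : nt_expansion Delta t0 a b ->
  ((cabs (t0 - z))%:E * \esum_(g in Gamma `\ idfun)
    (cabs (derive1 g t0) / cabs (g t0 - z) ^+ 2)%:E)%E @[z --> nontangential t0] --> 0%E ->
  nt_expansion P t0 a b.
Proof.
move=> hD /(esum_smallP (w := fun g z => weight t0 g / cabs (g t0 - z) ^+ 2) t01) h.
apply: (nt_expansion_near t01 hD) => M e e0.
have e2 : 0 < e / 2 by rewrite divr_gt0.
have [d d0 hd] := h M _ e2; exists d => // z zM zd; have p := stolz_neq t01 zM.
have [/diskE z1 _] := zM.
have hE B : fincl B (Gamma `\ idfun) ->
    \sum_(g <- B) weight t0 g / cabs (g t0 - z) ^+ 2 <= e / 2 / cabs (z - t0).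
  by move=> BG; rewrite ler_pdivlMr// mulrC; exact: hd.
have := Plim_near z1 hE.
rewrite (_ : 2 * _ * _ = e * cabs (z - t0))//.
by field; rewrite gt_eqF.
Qed.

End ThetaExpansion.

(** * The angular derivative *)

Import HBNNSimple.
Section AngularDerivative.
Variable R : realType.
Local Notation C := R[i].
Local Notation mu := (@lebesgue_measure R).
Local Notation D := (`[0, 2 * pi]%classic : set R).

(* A function equal almost everywhere to a measurable one need not be Borel, so
   the lemmas on integrals of measurable functions do not apply to it. *)
Lemma ae_eq_integralW (f g : R -> \bar R) : {ae mu, forall x, D x -> f x = g x} ->
  (\int[mu]_(x in D) f x = \int[mu]_(x in D) g x)%E.
Proof.
move=> [N [mN N0 PN]].
have NE x : ~ N x -> (f \_ D) x = (g \_ D) x.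
  move=> nN; rewrite !patchE; case: ifPn => // /set_mem Dx.
  by apply: contrapT => h; apply: nN; apply: PN => /= k; apply: h; exact: k.
have le (p q : R -> \bar R) : (forall x, ~ N x -> p x = q x) -> (forall x, 0%E <= q x)%E ->
  (ereal_sup [set sintegral mu h | h in
     [set h : {nnsfun measurableTypeR R >-> R} | forall x, (h x)%:E <= p x]] <=
   ereal_sup [set sintegral mu h | h in
     [set h : {nnsfun measurableTypeR R >-> R} | forall x, (h x)%:E <= q x]])%E.
  move=> pq q0; apply: ge_ereal_sup => _ [h hp <-].
  have mC : measurable (~` N) by exact: measurableC.
  (* Annihilating a simple minorant on the null set [N] keeps its integral and makes it a minorant
     of [q]. *)
  apply: ereal_sup_ubound; exists (proj_nnsfun h mC).
    move=> x /=; rewrite mindicE; have [xN|xN] := boolP (x \in ~` N).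
      by rewrite mulr1 -pq; [exact: hp|move/set_mem: xN].
    by rewrite mulr0; exact: q0.
  rewrite -!integralT_nnsfun; apply: ae_eq_integral => //.
  - by apply/measurable_EFinP; exact: measurable_funPT.
  - by apply/measurable_EFinP; exact: measurable_funPT.
  exists N; split => // x /= nh; apply: contrapT => nN; apply: nh => _.
  by rewrite mindicE mem_set ?mulr1.
have eqs p q : (forall x, ~ N x -> p x = q x) -> (forall x, 0%E <= p x)%E ->
    (forall x, 0%E <= q x)%E -> _ = _ := fun pq p0 q0 => le_anti (introT andP (conj
      (le p q pq q0) (le q p (fun x nN => esym (pq x nN)) p0))).
rewrite /integral; congr (_ - _)%E; apply: eqs.
- by move=> x nN; rewrite !funeposE NE.
- by move=> x; exact: funepos_ge0.
- by move=> x; exact: funepos_ge0.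
- by move=> x nN; rewrite !funenegE NE.
- by move=> x; exact: funeneg_ge0.
- by move=> x; exact: funeneg_ge0.
Qed.

Lemma circle_integral_ae (F : C -> \bar R) (f : R -> R) : rint f ->
  {ae mu, forall x, D x -> F (cis x) = (f x)%:E} -> circle_integral F = (rmean f)%:E.
Proof.
move=> fi Ff; rewrite /circle_integral (ae_eq_integralW Ff) rmean_integral//.
by rewrite -EFinM mulVKf// gt_eqF// twopi_gt0.
Qed.

Lemma measurable_inv (q : R -> R) : measurable_fun D q -> (forall x, 0 <= q x) ->
  measurable_fun D (fun x => (q x)^-1).
Proof.
move=> mq q0; have -> : (fun x => (q x)^-1) = (@powR R ^~ (-1)) \o q.
  by apply/funext => x /=; rewrite powR_inv1.
exact: measurableT_comp (measurable_powR _) mq.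
Qed.

Lemma rint_fatou (h_ : nat -> R -> R) (h : R -> R) (B : R) :
  (forall n, rint (h_ n)) -> (forall n x, 0 <= h_ n x) -> measurable_fun D h ->
  (forall x, 0 <= h x) -> {ae mu, forall x, D x -> h_ n x @[n --> \oo] --> h x} ->
  (forall n, rmean (h_ n) <= B) -> rint h.
Proof.
move=> hi h0 mh hh hc hB.
have F := @fatou _ _ R mu D (@measurable_circle R) (fun n => EFin \o h_ n)
  (fun n => measurable_EFin (rint_measurable (hi n)))
  (fun n x _ => h0 n x).
apply/integrableP; split; first exact: measurable_EFin.
have -> : (\int[mu]_(x in D) `|(EFin \o h) x| =
    \int[mu]_(x in D) limn_einf (fun n => (h_ n x)%:E))%E.
  apply: ae_eq_integralW; apply: ae_imp hc => x hx Dx.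
  have /cvg_limn_einf_sup[-> _] : (h_ n x)%:E @[n --> \oo] --> (h x)%:E.
    by apply/cvg_EFin; [exact: nearW|exact: hx].
  by rewrite /= ger0_norm.
apply: le_lt_trans F _; apply: (@le_lt_trans _ _ (2 * pi * B)%:E); last exact: ltry.
rewrite limn_einf_lim; apply: lime_le; first exact: is_cvg_einfs.
apply: nearW => n; apply: (@le_trans _ _ (\int[mu]_(x in D) (h_ n x)%:E)%E).
  by apply: ereal_inf_lbound; exists n => /=.
rewrite rmean_integral// lee_fin ler_wpM2l ?(ltW (twopi_gt0 R))//.
Qed.

(** Fatou's boundary function has modulus at most 1 almost everywhere. Dividing it by max(1, |u|)
    makes this hold everywhere, preserves measurability and does not affect the integrals. *)
Lemma fatou_unit (F F' : C -> C) : holo F F' -> bounded_by F 1 ->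
  exists u : R -> C, [/\ cmeas u, forall x, cabs (u x) <= 1,
    forall z, cabs z < 1 -> F z = cmean (fun x => u x * (pkernel z x)%:C) &
    {ae mu, forall x, D x -> F @ nontangential (cis x) --> u x}].
Proof.
move=> Fh F1; have [u [ui FE cu]] := fatou_nontangential Fh F1.
have u1 : {ae mu, forall x, D x -> cabs (u x) <= 1}.
  apply: ae_imp cu => x h Dx; apply: cabs_boundary_le (h Dx) _ => e d e0 d0.
  pose r := 1 - Num.min (d / 2) 2^-1.
  have m0 : 0 < Num.min (d / 2) 2^-1 :> R by rewrite lt_min divr_gt0// invr_gt0 ltr0n.
  have m1 : Num.min (d / 2) 2^-1 <= 2^-1 :> R by rewrite ge_min lexx orbT.
  have m2 : Num.min (d / 2) 2^-1 <= d / 2 by rewrite ge_min lexx.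
  have r0 : 0 <= r by rewrite /r; lra.
  have r1 : r < 1 by rewrite /r; lra.
  exists r; split => //; first by rewrite /r; lra.
  rewrite (le_trans (F1 _ _)) ?cabs_rcis//; lra.
have mu1 := cint_meas ui.
pose k x := Num.max 1 (cabs (u x)); have k1 x : 1 <= k x by rewrite le_max lexx.
have k0 x : 0 < k x := lt_le_trans ltr01 (k1 x).
have mk : measurable_fun D (fun x => (k x)^-1).
  apply: measurable_inv; last by move=> x; exact: ltW.
  apply: measurable_maxr; first exact: measurable_cst.
  exact: cmeas_cabs.
have mkc : cmeas (fun x => ((k x)^-1)%:C) by split; [exact: mk|exact: measurable_cst].
pose v x := u x * ((k x)^-1)%:C.
have v1 x : cabs (v x) <= 1.
  rewrite /v cabsM cabs_real ger0_norm ?invr_ge0 ?(ltW (k0 x))//.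
  by rewrite ler_pdivrMr// mul1r le_max lexx orbT.
have mv : cmeas v by exact: cmeasM.
have uv : {ae mu, forall x, D x -> u x = v x}.
  by apply: ae_imp u1 => x h Dx; rewrite /v /k max_l ?h// invr1 rmorph1 mulr1.
have vi : cint v by apply: (cint_bounded mv) => x _; exact: v1.
exists v; split; [exact: mv|exact: v1| |]; last first.
  by apply: ae_imp (ae_and cu uv) => x [h1 h2] Dx; rewrite -(h2 Dx); exact: h1.
move=> z z1; rewrite (FE z z1).
have [L [B [_ _ _ kB]]] := clip_pkernel z1.
have uk : cint (fun y => u y * (pkernel z y)%:C).
  exact: cintM ui (clip_meas (clip_pkernel z1)) (fun y _ => kB y).
have vk : cint (fun y => v y * (pkernel z y)%:C).
  exact: cintM vi (clip_meas (clip_pkernel z1)) (fun y _ => kB y).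
case: uk vk => [u2 u3] [v2 v3]; rewrite /cmean; congr (_ +i* _); apply: ae_eq_rmean => //.
- by apply: ae_imp uv => x h Dx; rewrite h.
- by apply: ae_imp uv => x h Dx; rewrite h.
Qed.

Variables (P P' : C -> C) (t a b : C).
Hypothesis t1 : cabs t = 1.
Hypothesis Ph : holo P P'.
Hypothesis P1 : bounded_by P 1.
Hypothesis a1 : cabs a = 1.
Hypothesis Pexp : nt_expansion P t a b.
Local Notation w := (t * (b / a)).

Let aa : a * a^*%C = 1. Proof. by rewrite mul_conj a1 expr1n. Qed.
Let a0 : a != 0. Proof. by rewrite -cabs_eq0 a1 oner_eq0. Qed.
Let aV : a^-1 = a^*%C. Proof. by apply: (mulfI a0); rewrite mulfV ?aa. Qed.

Lemma Re_unit_ge0 z : cabs z < 1 -> 0 <= complex.Re (1 - P z * a^*%C).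
Proof.
move=> z1; rewrite ReB /= subr_ge0 (le_trans (ler_norm _))//.
by rewrite (le_trans (ler_Re_cabs _))// cabsM cabs_conj a1 mulr1 P1.
Qed.

(** Every direction of the open half-plane stays within a Stolz region. The directions off the
    radius are what will force [w] to be real. *)
Lemma ray_expansion (om : C) : 0 < complex.Re om -> forall e : R, 0 < e -> exists2 d : R, 0 < d &
  forall s, 0 < s -> s < d -> cabs (t * (1 - s%:C * om)) < 1 /\
    cabs (1 - P (t * (1 - s%:C * om)) * a^*%C - w * om * s%:C) <= e * s.
Proof.
move=> q0 e e0; set q := complex.Re om in q0.
have om0 : 0 < cabs om.
  by rewrite (lt_le_trans q0)// (le_trans _ (ler_Re_cabs _))// ler_norm.
have e1 : 0 < e / cabs om by rewrite divr_gt0.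
(* On this ray |z - t| = s |om| and 2 (1 - |z|) >= s q, which gives the aperture. The bound s < q /
   |om|^2 below ensures |z|^2 <= 1 - s q. *)
have [d d0 hd] := (nt_expansionP _ _ _ t1).1 Pexp (2 * cabs om / q) _ e1.
exists (Num.min (d / cabs om) (q / cabs om ^+ 2)).
  by rewrite lt_min !divr_gt0// exprn_gt0.
move=> s s0; rewrite lt_min => /andP[s1 s2]; set z := t * _.
have zt : z - t = - (s%:C * (t * om)) by rewrite /z; ring.
have czt : cabs (z - t) = s * cabs om.
  by rewrite zt cabsN !cabsM t1 mul1r cabs_real gtr0_norm.
have zd : cabs (z - t) < d by rewrite czt -ltr_pdivlMr.
have z2 : cabs z ^+ 2 = 1 - 2 * s * q + s ^+ 2 * cabs om ^+ 2.
  rewrite /z cabsM t1 mul1r /q !cabs2; case: (om) => x y /=.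
  by rewrite !mul0r !subr0 !addr0; ring.
have sq : s ^+ 2 * cabs om ^+ 2 <= s * q.
  rewrite expr2 -mulrA ler_pM2l// -ler_pdivlMr ?exprn_gt0//; exact: ltW.
have sq0 : 0 < s * q by exact: mulr_gt0.
have z2' : cabs z ^+ 2 <= 1 - s * q by lra.
have z1 : cabs z < 1.
  by rewrite -(expr_lt1 (n := 2)) ?cabs_ge0//; lra.
have zs : s * q <= 2 * (1 - cabs z).
  have h : (1 - cabs z) ^+ 2 >= 0 by exact: sqr_ge0.
  have -> : 2 * (1 - cabs z) = (1 - cabs z) ^+ 2 + (1 - cabs z ^+ 2) by ring.
  lra.
split=> //.
have zM : stolz t (2 * cabs om / q) z.
  split; first exact/diskE.
  have -> : 2 * cabs om / q * (1 - cabs z) = cabs om * (2 * (1 - cabs z)) / q by ring.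
  by rewrite czt ler_pdivlMr// mulrAC mulrC ler_wpM2l// ltW.
have := hd z zM zd; rewrite czt (_ : e / cabs om * (s * cabs om) = e * s); last first.
  by field; rewrite gt_eqF.
apply: le_trans.
have -> : 1 - P z * a^*%C - w * om * s%:C = - ((P z - a - b * (z - t)) * a^*%C).
  by rewrite zt -aV; field.
by rewrite cabsN cabsM cabs_conj a1 mulr1.
Qed.

(** Re (1 - P conj a) is nonnegative on the ray; divided by s it tends to Re (w om). *)
Lemma Re_ray_ge0 om : 0 < complex.Re om -> 0 <= complex.Re (w * om).
Proof.
move=> om0; apply/ler_addgt0Pr => e e0; have [d d0 hd] := ray_expansion om0 e0.
have d2 : 0 < d / 2 by rewrite divr_gt0.
have [||z1 h] := hd (d / 2); [done|lra|].
have := Re_unit_ge0 z1; move: h; set X := 1 - _ => h hX.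
have := le_trans (ler_Re_cabs _) h; rewrite ReB ler_norml => /andP[_ h2].
have E : complex.Re (w * om * (d / 2)%:C) = complex.Re (w * om) * (d / 2).
  by rewrite [_ * (_)%:C]mulrC ReZ mulrC.
rewrite E in h2; have h3 : 0 <= (complex.Re (w * om) + e) * (d / 2) by lra.
by rewrite pmulr_lge0 in h3.
Qed.

Lemma angular_Re_ge0 : 0 <= complex.Re w.
Proof. by rewrite -[w]mulr1; apply: Re_ray_ge0; rewrite /= ltr01. Qed.

Lemma angular_real : complex.Im w = 0.
Proof.
have p (k l : R) : 0 < k -> 0 <= complex.Re w * k - complex.Im w * l.
  by move=> k0; have := @Re_ray_ge0 (k +i* l) k0; rewrite ReM.
set x := complex.Re w in p *; set y := complex.Im w in p *.
have x0 : 0 <= x := angular_Re_ge0.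
apply/eqP; rewrite -normr_eq0 eq_le normr_ge0 andbT leNgt; apply/negP => y0.
(* In the direction with real part k and imaginary part the sign of y, the quantity is x k - |y|, at
   most -|y| / 2 for this k. *)
pose k := `|y| / (2 * (x + 1)); have k0 : 0 < k by rewrite divr_gt0//; lra.
have kx : x * k <= `|y| / 2.
  have -> : `|y| / 2 = (x + 1) * k by rewrite /k; field; rewrite gt_eqF//; lra.
  by rewrite ler_wpM2r ?(ltW k0)//; lra.
have := p k (Num.sg y) k0; rewrite mulrC [y * _]mulrC -normrEsg -[_ * x]mulrC.
lra.
Qed.

End AngularDerivative.

(** * The angular derivative as a boundary integral *)

Section AngularIntegral.
Variable R : realType.
Local Notation C := R[i].
Local Notation mu := (@lebesgue_measure R).
Local Notation D := (`[0, 2 * pi]%classic : set R).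
Variables (P P' : C -> C) (t a b : C).
Hypothesis t1 : cabs t = 1.
Hypothesis Ph : holo P P'.
Hypothesis P1 : bounded_by P 1.
Hypothesis a1 : cabs a = 1.
Hypothesis Pexp : nt_expansion P t a b.
Local Notation w := (t * (b / a)).

Lemma rmean_Re_poisson (u : R -> C) z : cmeas u -> (forall x, cabs (u x) <= 1) ->
  P z = cmean (fun x => u x * (pkernel z x)%:C) -> cabs z < 1 ->
  rint (fun x => pkernel z x * complex.Re (1 - u x * a^*%C)) /\
  rmean (fun x => pkernel z x * complex.Re (1 - u x * a^*%C)) =
    complex.Re (1 - P z * a^*%C).
Proof.
move=> mu1 u1 PE z1; have rk := rint_pkernel z1.
have [L [B [_ _ _ kB]]] := clip_pkernel z1.
have ui : cint u by apply: (cint_bounded mu1) => x _; exact: u1.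
have uk : cint (fun x => u x * (pkernel z x)%:C).
  exact: cintM ui (clip_meas (clip_pkernel z1)) (fun y _ => kB y).
have [ri _] := cintZ a^*%C uk.
have E : (fun x => pkernel z x * complex.Re (1 - u x * a^*%C)) =
    (fun x => pkernel z x - complex.Re (a^*%C * (u x * (pkernel z x)%:C))).
  apply/funext => x; rewrite ReB /= mulrBr mulr1; congr (_ - _).
  by rewrite -ReZ [_%:C * (_ * _)]mulrC [u x * a^*%C]mulrC -mulrA.
split; first by rewrite E; exact: rintB.
rewrite E rmeanB// rmean_pkernel// ReB /=; congr (_ - _).
by rewrite PE mulrC -cmeanZ.
Qed.

(* With f = Re (1 - u conj a), Poisson's formula at r t reads
   Re (1 - P(r t) conj a) / (1 - r) = mean of (1 + r) f / |e - r t|^2; the limit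
   r -> 1 is justified by Fatou's lemma and |e - t| <= 2 |e - r t|. *)
Lemma angular_integral :
  (circle_integral (fun s => (cabs (boundary_value P s - a) ^+ 2 / cabs (s - t) ^+ 2)%:E) +
   circle_integral (fun s => ((1 - cabs (boundary_value P s) ^+ 2) / cabs (s - t) ^+ 2)%:E) =
   (complex.Re w)%:E)%E.
Proof.
have [u [mu1 u1 PE cu]] := fatou_unit Ph P1.
have bv : {ae mu, forall x, D x -> boundary_value P (cis x) = u x}.
  apply: ae_imp cu => x h Dx; have PF := nontangential_proper (cabs_cis x).
  by apply: cvg_lim (h Dx); exact: Chausdorff.
pose q x := cabs (cis x - t) ^+ 2.
have q0 x : 0 <= q x by exact: sqr_ge0.
have mcis : cmeas (fun x => cis x - t) by exact: clip_meas (clipB (@clip_cis R) (clip_cst t)).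
have mq : measurable_fun D q by apply: measurable_funX; exact: cmeas_cabs.
have mqi := measurable_inv mq q0.
pose f x := complex.Re (1 - u x * a^*%C).
have fE x : 2 * f x = cabs (u x - a) ^+ 2 + (1 - cabs (u x) ^+ 2).
  have := a1; move/(congr1 (fun y => y ^+ 2)); rewrite expr1n /f !cabs2.
  by case: (u x) (a) => p r [c d] /= h; nra.
have f01 x : 0 <= f x <= 2.
  have : `|complex.Re (u x * a^*%C)| <= 1.
    by rewrite (le_trans (ler_Re_cabs _))// cabsM cabs_conj a1 mulr1.
  by rewrite /f ReB /= ler_norml => /andP[]; lra.
pose g1 x := cabs (u x - a) ^+ 2 / q x.
pose g2 x := (1 - cabs (u x) ^+ 2) / q x.
have g10 x : 0 <= g1 x by rewrite divr_ge0// sqr_ge0.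
have g20 x : 0 <= g2 x by rewrite divr_ge0// subr_ge0 expr_le1 ?cabs_ge0.
have mcu := cmeas_cabs mu1.
have mg1 : measurable_fun D g1.
  apply: measurable_funM => //; apply: measurable_funX; apply: cmeas_cabs.
  by apply: cmeasD => //; exact: cmeas_cst.
have mg2 : measurable_fun D g2.
  apply: measurable_funM => //; apply: measurable_funB; first exact: measurable_cst.
  exact: measurable_funX.
pose h x := g1 x + g2 x.
have h0 x : 0 <= h x by exact: addr_ge0.
have mh : measurable_fun D h by exact: measurable_funD.
have hE x : h x = 2 * f x / q x by rewrite fE /h -mulrDl.
have om1 : 0 < complex.Re (1 : C) by rewrite /= ltr01.
have [d d0 hd] := ray_expansion t1 a1 Pexp om1 ltr01.
pose m := Num.min (d / 2) 2^-1.
have m0 : 0 < m by rewrite lt_min invr_gt0 ltr0n divr_gt0.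
have m2 : m <= 2^-1 by rewrite ge_min lexx orbT.
have md : m <= d / 2 by rewrite ge_min lexx.
pose s n := m * (n.+1%:R^-1 : R).
have s0 n : 0 < s n by rewrite mulr_gt0// invr_gt0 ltr0n.
have sm n : s n <= m by rewrite ler_piMr ?(ltW m0)// invf_le1 ?ltr0n ?ler1n.
have s1 n : s n <= 2^-1 by rewrite (le_trans (sm n)).
have sd n : s n < d by have := sm n; lra.
have scv : s n @[n --> \oo] --> (0 : R).
  by rewrite -(mulr0 m); apply: cvgM; [exact: cvg_cst|exact: cvg_harmonic].
pose r n := 1 - s n; have r0 n : 0 <= r n by have := s1 n; rewrite /r; lra.
have r1 n : r n < 1 by have := s0 n; rewrite /r; lra.
have zr n : cabs ((r n)%:C * t) = r n.
  by rewrite cabsM t1 mulr1 cabs_real ger0_norm.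
have zr1 n : cabs ((r n)%:C * t) < 1 by rewrite zr.
have zE n : t * (1 - (s n)%:C * 1) = (r n)%:C * t by rewrite /r rmorphB rmorph1 /=; ring.
pose p n x := cabs (cis x - (r n)%:C * t) ^+ 2.
have pE n x : p n x = s n ^+ 2 + r n * q x.
  have : cabs t ^+ 2 = 1 by rewrite t1 expr1n.
  have : cabs (cis x : C) ^+ 2 = 1 by rewrite cabs_cis expr1n.
  rewrite /p /q !cabs2 /r; case: (cis x) (t) => y z [v c] /= e1 e2.
  rewrite !mul0r subr0 addr0; move: (s n) => l.
  have -> : (y - (1 - l) * v) ^+ 2 + (z - (1 - l) * c) ^+ 2 = l * (y ^+ 2 + z ^+ 2) -
      l * (1 - l) * (v ^+ 2 + c ^+ 2) + (1 - l) * ((y - v) ^+ 2 + (z - c) ^+ 2) by ring.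
  by rewrite e1 e2; ring.
have p0 n x : 0 < p n x.
  by rewrite pE ltr_pwDl ?exprn_gt0// mulr_ge0.
have mp n : measurable_fun D (p n).
  apply: measurable_funX; apply: cmeas_cabs.
  exact: clip_meas (clipB (@clip_cis R) (clip_cst _)).
have mpi n := measurable_inv (mp n) (fun x => ltW (p0 n x)).
(* Where [cis x] differs from [t], k n h is the Poisson kernel at r t times f, divided by s n. The
   ratio tends to 1 there, and it is at most 4 because r >= 1/2. *)
pose k n x := (1 + r n) / 2 * q x / p n x.
have k0 n x : 0 <= k n x.
  have r1' : 0 <= (1 + r n) / 2 by have := r0 n; lra.
  exact: divr_ge0 (mulr_ge0 r1' (q0 x)) (ltW (p0 n x)).
have k4 n x : k n x <= 4.
  rewrite ler_pdivrMr// pE; have r2 : 2^-1 <= r n.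
    by have := s1 n; rewrite /r; lra.
  have rq := ler_wpM2r (q0 x) r2; have qx0 := q0 x; have ss := sqr_ge0 (s n).
  have -> : (1 + r n) / 2 * q x = q x / 2 + r n * q x / 2 by ring.
  lra.
have kcv x : q x != 0 -> k n x @[n --> \oo] --> (1 : R).
  move=> qx; have rcv : r n @[n --> \oo] --> (1 : R).
    by rewrite -[X in _ --> X]subr0; apply: cvgB => //; exact: cvg_cst.
  have -> : (1 : R) = (1 + 1) / 2 * q x / (0 ^+ 2 + 1 * q x) by field; rewrite qx.
  have -> : (fun n => k n x) = (fun n => (1 + r n) / 2 * q x * (s n ^+ 2 + r n * q x)^-1).
    by apply/funext => n; rewrite /k pE.
  apply: cvgM.
    apply: cvgM; last exact: cvg_cst.
    apply: cvgM; last exact: cvg_cst.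
    by apply: cvgD => //; exact: cvg_cst.
  apply: cvgV; first by rewrite expr0n add0r mul1r.
  apply: cvgD; first by rewrite expr2; under eq_cvg do rewrite expr2; exact: cvgM.
  by apply: cvgM => //; exact: cvg_cst.
pose h_ n x := k n x * h x.
have h_0 n x : 0 <= h_ n x by exact: mulr_ge0.
have h_i n : rint (h_ n).
  apply: (@rint_bounded R _ (4 / s n ^+ 2)).
    apply: measurable_funM => //; apply: measurable_funM; last exact: mpi.
    by apply: measurable_funM => //; exact: measurable_cst.
  move=> x _; rewrite ger0_norm// /h_ hE /k.
  (* At [cis x = t] the factor [q x] makes the function vanish; elsewhere it cancels. *)
  have [e|qx] := eqVneq (q x) 0.
    by rewrite e !mulr0 mul0r mul0r divr_ge0// sqr_ge0.
  have -> : (1 + r n) / 2 * q x / p n x * (2 * f x / q x) = (1 + r n) * f x / p n x.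
    by field; rewrite qx gt_eqF.
  apply: ler_pM.
  - by apply: mulr_ge0; [have := r0 n; lra|case/andP: (f01 x)].
  - by rewrite invr_ge0 ltW.
  - by have := f01 x; have := r0 n; have := r1 n; nra.
  - rewrite lef_pV2 ?posrE ?p0 ?exprn_gt0//.
    by rewrite pE lerDl mulr_ge0.
have h_m n : rmean (h_ n) = complex.Re (1 - P ((r n)%:C * t) * a^*%C) / s n.
  have [i e] := rmean_Re_poisson mu1 u1 (PE _ (zr1 n)) (zr1 n).
  rewrite -e mulrC -rmeanZ//; apply: ae_eq_rmean => //; first exact: rintZ.
  apply: ae_imp (ae_cis_neq t) => x hx Dx.
  have qx : q x != 0.
    by rewrite expf_neq0// cabs_eq0 subr_eq0; apply/eqP; exact: hx.
  rewrite /h_ hE /k -/(f x) /pkernel zr -/(p n x).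
  have -> : 1 - r n ^+ 2 = s n * (1 + r n) by rewrite /r; ring.
  by field; rewrite qx !gt_eqF.
have h_e n e : cabs (1 - P (t * (1 - (s n)%:C * 1)) * a^*%C - w * 1 * (s n)%:C) <= e * s n ->
    `|rmean (h_ n) - complex.Re w| <= e.
  rewrite zE mulr1 => he; have := le_trans (ler_Re_cabs _) he.
  rewrite ReB [w * _]mulrC ReZ h_m => he'.
  rewrite -(ler_pM2r (s0 n)) -[X in _ * X <= _](ger0_norm (ltW (s0 n))) -normrM mulrBl.
  by rewrite divfK ?gt_eqF// [complex.Re w * _]mulrC.
have h_b n : `|rmean (h_ n) - complex.Re w| <= 1.
  by apply: h_e; case: (hd _ (s0 n) (sd n)).
have h_cv : rmean (h_ n) @[n --> \oo] --> complex.Re w.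
  apply/cvgrPdist_lt => e e0; have e2 : 0 < e / 2 by rewrite divr_gt0.
  have [d' d'0 hd'] := ray_expansion t1 a1 Pexp om1 e2.
  have /cvgrPdist_lt/(_ _ d'0) := scv; apply: filterS => n.
  rewrite sub0r normrN ger0_norm ?(ltW (s0 n))// => sn.
  rewrite distrC (le_lt_trans (h_e n (e / 2) _))//; last by lra.
  by case: (hd' _ (s0 n) sn).
have hcv : {ae mu, forall x, D x -> h_ n x @[n --> \oo] --> h x}.
  apply: ae_imp (ae_cis_neq t) => x hx Dx.
  have qx : q x != 0.
    by rewrite expf_neq0// cabs_eq0 subr_eq0; apply/eqP; exact: hx.
  by rewrite -[h x]mul1r; apply: cvgM; [exact: kcv|exact: cvg_cst].
(* Fatou's lemma with bounded means first gives integrability of [h]; only then can [4 * h] dominate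
   the sequence and identify the limit of the means. *)
have hi : rint h.
  apply: (rint_fatou (B := complex.Re w + 1) h_i h_0 mh h0 hcv) => n.
  by have := h_b n; rewrite ler_norml => /andP[_]; lra.
have [_ hl] : rint h /\ rmean (h_ n) @[n --> \oo] --> rmean h.
  apply: (@rmean_dct R h_ h (fun x => 4 * h x)) => //.
  - by move=> n; apply: rint_measurable.
  - exact: rintZ.
  - by move=> n x _; rewrite ger0_norm// ler_wpM2r.
have hw : rmean h = complex.Re w.
  exact: (cvg_unique _ hl h_cv).
have g1i : rint g1 by apply: (rint_le mg1 hi) => x _; rewrite ger0_norm// lerDl.
have g2i : rint g2 by apply: (rint_le mg2 hi) => x _; rewrite ger0_norm// lerDr.
rewrite (circle_integral_ae g1i); last by apply: ae_imp bv => x e Dx; rewrite e.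
rewrite (circle_integral_ae g2i); last by apply: ae_imp bv => x e Dx; rewrite e.
by rewrite -EFinD -rmeanD// -hw.
Qed.

End AngularIntegral.

Theorem theorem4p2 (R : realType) (Gamma : set (R[i] -> R[i])) (t0 : R[i])
  (Delta phi : R[i] -> R[i]) (Delta0 Delta1 : R[i])
  (Gamma_fuchsian : fuchsian Gamma)
  (t0_circle : `|t0| = 1)
  (summable_t0 : (\esum_(g in Gamma) (cabs (derive1 g t0))%R%:E < +oo)%E)
  (martin_bc : bounded_characteristic (derive1 (martin Gamma t0)))
  (Delta_inner : inner Delta)
  (phi_outer : outer phi)
  (phi_le4 : forall z, disk z -> `|phi z| <= 4)
  (martin_fact : forall z, disk z -> derive1 (martin Gamma t0) z = Delta z / phi z)
  (Delta0_unit : `|Delta0| = 1)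
  (Delta_expansion : nt_expansion Delta t0 Delta0 Delta1)
  (sum_small :
    ((cabs (t0 - z))%R%:E *
      \esum_(g in Gamma `\ idfun)
        (cabs (derive1 g t0) / cabs (g t0 - z) ^+ 2)%R%:E)%E
      @[z --> nontangential t0] --> 0%E) :
  forall alpha : (R[i] -> R[i]) -> R[i], unitary_character Gamma alpha ->
  let P := theta Gamma t0 alpha Delta in
  let w := t0 * (Delta1 / Delta0) in
  [/\ Hinfty P /\ Hinfty_norm P <= 1,
      nt_expansion P t0 Delta0 Delta1 &
      complex.Im w = 0 /\
      (circle_integral (fun t =>
          (cabs (boundary_value P t - Delta0) ^+ 2 / cabs (t - t0) ^+ 2)%R%:E) +
       circle_integral (fun t =>
          ((1 - cabs (boundary_value P t) ^+ 2) / cabs (t - t0) ^+ 2)%R%:E))%E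
      = (complex.Re w)%:E].
Proof.
have t01 : cabs t0 = 1 by apply: (@complexI R); rewrite cabsE t0_circle.
have a1 : cabs Delta0 = 1 by apply: (@complexI R); rewrite cabsE Delta0_unit.
pose W := fine (\esum_(g in Gamma) (weight t0 g)%:E).
have wW B : fincl B Gamma -> \sum_(g <- B) weight t0 g <= W.
  move=> BG; rewrite -lee_fin /W fineK; first exact: esum_fincl_le.
  rewrite fin_numElt summable_t0 andbT (lt_le_trans (ltNyr 0))// esum_ge0// => g _.
  by rewrite lee_fin weight_ge0.
have [F FG] := exhaustion (weight_ge0 t0) wW.
have [psi [psi' psi_holo] psiE] := outer_holo phi_outer.
have Delta_le1 z : cabs z < 1 -> cabs (Delta z) <= 1.
  by case: Delta_inner => _ h _ z1; apply/h/diskE.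
have psi_le4 z : cabs z < 1 -> cabs (psi z) <= 4.
  move=> z1; have [<- _] := psiE z z1.
  have := phi_le4 z ((diskE z).2 z1); rewrite -cabsE.
  by rewrite (_ : 4 = (4 : R)%:C) ?lecR// rmorph_nat.
have psi_fact z : cabs z < 1 -> 'i%C * t0 * Dsum Gamma t0 z * psi z = Delta z.
  move=> z1; have [e p0] := psiE z z1.
  by rewrite -(martin_derive1 Gamma_fuchsian t01 wW FG z1) martin_fact ?e ?divfK//; exact/diskE.
(* The expansion of Delta at [t0] provides a point where D is nonzero, so that the zeros of D are
   isolated. *)
have [b b1 Db] : exists2 b, cabs b < 1 & Dsum Gamma t0 b != 0.
  have [|b b1 Db] := nt_expansion_neq0 t01 Delta_expansion.
    by rewrite -cabs_eq0 a1 oner_eq0.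
  exists b => //; apply/eqP => D0; move/eqP: Db; apply.
  by rewrite -psi_fact// D0 mulr0 mul0r.
move=> alpha alphaU P w.
have Gi := fuchsian_id Gamma_fuchsian.
have alpha1 g : Gamma g -> cabs (alpha g) = 1.
  by move=> Gg; apply: (@complexI R); rewrite cabsE (character_unit alphaU).
(* The sum for P is indexed by the inverses of the elements that index the numerator of the theta
   series, whence the inverse here. *)
pose c g : R[i] := (alpha (ginv Gamma g))^*%C.
have c1 g : Gamma g -> cabs (c g) <= 1.
  by move=> Gg; rewrite /c cabs_conj alpha1//; exact: ginvG.
have cid : c idfun = 1.
  rewrite /c (ginv_id Gamma_fuchsian).
  have : alpha idfun = alpha idfun * alpha idfun by apply: (character_comp alphaU).
  have i0 : alpha idfun != 0 by rewrite -cabs_eq0 alpha1// oner_eq0.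
  rewrite -[LHS]mulr1 => /(mulfI i0) <-; exact: rmorph1.
have PE z : cabs z < 1 -> P z = Plim Gamma t0 F psi c z.
  apply: (theta_Plim Gamma_fuchsian t01 wW FG Delta_le1 psi_holo psi_le4 psi_fact c1 _ b1 Db).
  by move=> g Gg; rewrite /c (ginvK Gamma_fuchsian Gg).
have Qh := Plim_holo Gamma_fuchsian t01 wW FG Delta_le1 psi_holo psi_le4 psi_fact c1.
have Q1 := Plim_le1 Gamma_fuchsian t01 wW FG Delta_le1 psi_holo psi_le4 psi_fact c1.
have Ph : holo P (derive1 (Plim Gamma t0 F psi c)).
  move=> r r0 r1; apply: eq_holo_on (Qh r r0 r1) => // z zr.
  by rewrite PE// (le_lt_trans zr).
have P1 : bounded_by P 1 by move=> z z1; rewrite PE//; exact: Q1.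
have Pexp : nt_expansion P t0 Delta0 Delta1.
  have := Plim_expansion Gamma_fuchsian t01 wW FG Delta_le1 psi_holo psi_le4 psi_fact c1 cid
    Delta_expansion sum_small.
  move=> /(nt_expansion_near t01); apply => M e e0; exists 1 => // z [/diskE z1 _] _.
  by rewrite PE// subrr cabs0 mulr_ge0 ?cabs_ge0// ltW.
split; [split; [split|]|exact: Pexp|split].
- exact: holo_analytic Ph.
- by exists 1 => z /diskE; exact: P1.
- apply: ge_sup; first by exists (cabs (P 0)), 0 => //; apply/diskE; rewrite cabs0.
  by move=> _ [z /diskE z1 <-]; exact: P1.
- exact: angular_real t01 P1 a1 Pexp.
- exact: angular_integral t01 Ph P1 a1 Pexp.
Qed.
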